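(* Let $\delta>0$ and let $Z=\{Z^i\}$ be a stationary sequence of centered doubly stochastic processes that is $(\kappa,Y)$-weakly dependent with random variable $V(\mathrm y)$ and coefficients $\kappa(r)$. Assume: (i) $E[|Z^i_t|^{2+\delta}]<\infty$; (ii) for every $\tau\in\mathbb Z$, $\Gamma^N(\tau,Y)$ converges $\nu$-a.s. to a limit $\Gamma(\tau)$ as $N\to\infty$; (iii) $E[V(\mathrm y)]<\infty$; (iv) $\kappa(r)=\mathcal O(r^{-\kappa})$ as $r\to\infty$, for some exponent $\kappa>2+\frac2\delta$. Then, for $\nu$-almost every $Y$, the partial aggregation process $X^N(Y)=\{X^N_t(Y)\}_{t\in\mathbb Z}$ converges in distribution, as $N\to\infty$, to a Gaussian process $X$ with covariance function $\Gamma$.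
   Context: Setting. $Y=\{\mathrm y^i\}$ is an i.i.d. sequence of $\mathbb R^s$-valued random variables with law $\mu$; $\nu=\mu^{\otimes\mathbb N}$ is the law of $Y$. $\{\varepsilon^i_t\}$ is an array of real random variables independent of $Y$ such that for each $i$ the sequence $\varepsilon^i=\{\varepsilon^i_t\}_{t\in\mathbb Z}$ is a strong white noise (i.i.d.). The doubly stochastic processes are $Z^i=\{Z^i_t=Z_t(\mathrm y^i,\varepsilon^i):t\in\mathbb Z\}$, stationary and centered given $Y$ ($E^Y[Z^i_t]=0$). $E^Y$, $\mathrm{cov}(\cdot,\cdot\,|\,Y)$ denote conditional expectation and covariance given $Y$, $E^{\mathrm y^i}$ conditional expectation given $\mathrm y^i$. The partial aggregation is, for a fixed trajectory $Y$, $X^N_t(Y)=\frac1{\sqrt N}\sum_{i=1}^NZ^i_t$, and its covariance function is $\Gamma^N(\tau,Y)=E^Y[X^N_t(Y)X^N_{t+\tau}(Y)]$. Convergence in distribution is with respect to the law of the innovations, $Y$ being fixed (convergence of finite-dimensional distributions). $\Delta^{(k)}_1$ is the set of functions $f:\mathbb R^k\to\mathbb R$ with $\|f\|_\infty\le1$ and $|f(z)-f(z')|\le \mathrm{Lip}(f)\sum_{m=1}^k|z_m-z'_m|$ for a finite constant $\mathrm{Lip}(f)$ (the Lipschitz constant). $Z$ is $(\kappa,Y)$-weakly dependent with random variable $V(\mathrm y)>0$ and coefficients $\kappa(r)$ decreasing to $0$ if, for almost every trajectory $Y$, $$|\mathrm{cov}(f(Z^{i_1}_{t_1},\dots,Z^{i_u}_{t_u}),g(Z^{j_1}_{t'_1},\dots,Z^{j_v}_{t'_v})\,|\,Y)|\le\mathrm{Lip}(f)\,\mathrm{Lip}(g)\Big(\sum_{m=1}^uV(\mathrm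 y^{i_m})\Big)\Big(\sum_{m=1}^vV(\mathrm y^{j_m})\Big)\kappa(r)$$ for all $u,v\ge1$, all $(t_1,\dots,t_u)\in\mathbb Z^u$, $(t'_1,\dots,t'_v)\in\mathbb Z^v$, all $r\ge0$, all $i_1<\dots<i_u\le i_u+r<j_1<\dots<j_v$ and all $(f,g)\in\Delta_1^{(u)}\times\Delta_1^{(v)}$, and moreover $E^{\mathrm y^i}[|Z^i_t|^2]\le V^2(\mathrm y^i)<\infty$ $\mu$-a.s.
   Formalization: Weak dependence is assumed with i_1≤…≤i_u and j_1≤…≤j_v within each group (printed: strict <), so a component may be seen at several times. With strict inequalities the claim fails: Z^i_t=A_iS_t with independent random signs A_i, S_t has a non-Gaussian limit. *)

(* Defs.v *)
From HB Require Import structures.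
From mathcomp Require Import all_boot all_order all_algebra.
From mathcomp Require Import all_classical all_reals all_analysis.
From mathcomp Require Import measurable_realfun.

Set Implicit Arguments.
Unset Strict Implicit.
Unset Printing Implicit Defensive.

Import Order.TTheory GRing.Theory Num.Theory.
Import numFieldNormedType.Exports.

Local Open Scope classical_set_scope.
Local Open Scope ring_scope.

(* The product sigma-algebra on T^I. *)
Definition cylinders (I : Type) d (T : measurableType d) : set (set (I -> T)) :=
  [set A | exists (i : I) (B : set T), measurable B /\ A = [set x | B (x i)]].

Definition family_space (I : Type) d (T : measurableType d) :=
  g_sigma_algebraType (@cylinders I d T).

Section independence.
Context d (Omega : measurableType d) (R : realType) (P : probability Omega R).

Definition mutually_independent (I : eqType) d' (T : measurableType d')
    (X : I -> Omega -> T) : Prop :=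
  forall (J : seq I) (B : I -> set T), uniq J ->
    (forall i, measurable (B i)) ->
    P [set w | forall i, i \in J -> B i (X i w)] =
    (\prod_(i <- J) P [set w | B i (X i w)])%E.

Definition independent2 d1 d2 (T1 : measurableType d1) (T2 : measurableType d2)
    (X1 : Omega -> T1) (X2 : Omega -> T2) : Prop :=
  forall (A : set T1) (B : set T2), measurable A -> measurable B ->
    P [set w | A (X1 w) /\ B (X2 w)] =
    (P [set w | A (X1 w)] * P [set w | B (X2 w)])%E.

Definition strong_white_noise (X : int -> Omega -> R) : Prop :=
  mutually_independent X /\
  forall (s t : int) (B : set R), measurable B ->
    P [set w | B (X s w)] = P [set w | B (X t w)].

(* Strict stationarity; used with I = int (time) and I = nat (components). *)
Definition stationary (I : nmodType) d' (T : measurableType d')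
    (X : I -> Omega -> T) : Prop :=
  forall (n : nat) (t : 'I_n -> I) (h : I) (B : 'I_n -> set T),
    (forall k, measurable (B k)) ->
    P [set w | forall k, B k (X (t k + h) w)] =
    P [set w | forall k, B k (X (t k) w)].

End independence.

Section lipschitz.
Context (R : realType) (k : nat).

Definition lipschitz_const (f : 'rV[R]_k -> R) : set R :=
  [set L | 0 <= L /\
    forall z z', `|f z - f z'| <= L * \sum_(m < k) `|z ord0 m - z' ord0 m| ].

Definition Lip (f : 'rV[R]_k -> R) : R := inf (lipschitz_const f).

Definition Delta1 (f : 'rV[R]_k -> R) : Prop :=
  (forall z, `|f z| <= 1) /\ lipschitz_const f !=set0.

End lipschitz.

Section doubly_stochastic.
Context d (Omega : measurableType d) (R : realType) (P : probability Omega R).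
Context (s : nat).

Notation param := (s.-tuple R).
Notation trajectory := (family_space nat (s.-tuple R)).
Notation innovation := (family_space int R).
Notation innovations := (family_space nat (family_space int R)).

Context (eps : Omega -> innovations) (Z : int -> param -> innovation -> R).

(* The component Z^i with parameter frozen at x.  When the trajectory Y and the
   innovations eps are independent, integrating frozen quantities against P is
   the regular version of the conditional expectation given Y
   (see [freezing] below). *)
Definition frozen (x : param) (i : nat) (t : int) : Omega -> R :=
  fun w => Z t x (eps w i).

(* t |-> Z^i_t along the fixed trajectory y *)
Definition quenched (y : trajectory) (i : nat) (t : int) : Omega -> R :=
  frozen (y i) i t.

(* i |-> Z^i, with Y random *)
Definition annealed (Y : Omega -> trajectory) (i : nat) : Omega -> innovation :=
  fun w t => Z t (Y w i) (eps w i).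

Definition partial_aggregation (N : nat) (y : trajectory) (t : int)
    : Omega -> R :=
  fun w => (Num.sqrt N%:R)^-1 * \sum_(i < N) quenched y i t w.

Definition aggregation_cov (N : nat) (t tau : int) (y : trajectory) : \bar R :=
  ('E_P[ (fun w => (partial_aggregation N y t w *
                    partial_aggregation N y (t + tau) w)%R) ])%E.

(* Within each of the two groups the component indices are only nondecreasing:
   a group may observe the same component at several times.  With strict
   inequalities the joint law of (Z_t, Z_t') at two times t, t' would escape the
   condition, which would then say nothing about two-dimensional laws. *)
Definition weakly_dependent (mu : probability param R)
    (nu : probability trajectory R) (V : param -> R) (kappa : nat -> R) : Prop :=
  [/\ measurable_fun [set: param] V /\ {ae mu, forall x, 0 < V x},
      nonincreasing_seq kappa,
      kappa @ \oo --> (0 : R),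
      {ae nu, forall y : trajectory,
         forall (u v : nat) (i : 'I_u.+1 -> nat) (t : 'I_u.+1 -> int)
           (j : 'I_v.+1 -> nat) (t' : 'I_v.+1 -> int) (r : nat)
           (f : 'rV[R]_u.+1 -> R) (g : 'rV[R]_v.+1 -> R),
         {homo i : a b / (a <= b)%N} -> {homo j : a b / (a <= b)%N} ->
         (i ord_max + r < j ord0)%N -> Delta1 f -> Delta1 g ->
         (`| covariance P (fun w => f (\row_m quenched y (i m) (t m) w))
                          (fun w => g (\row_m quenched y (j m) (t' m) w)) | <=
          (Lip f * Lip g * (\sum_m V (y (i m))) * (\sum_m V (y (j m)))
           * kappa r)%:E)%E} &
      forall (i : nat) (t : int),
        {ae mu, forall x : param,
           ('E_P[ (fun w => (`| frozen x i t w | ^+ 2)%R) ] <=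
            ((V x) ^+ 2)%:E)%E}].

End doubly_stochastic.

Section gaussian.
Context (R : realType).

(* N(m, sigma^2), with N(m, 0) the Dirac mass: [normal_prob m 0] is not. *)
Definition gaussian_law (m sigma : R) (B : set R) : \bar R :=
  if sigma == 0 then \d_m B else normal_prob m sigma B.

Definition centered_gaussian_process d (Omega : measurableType d)
    (P : probability Omega R) (X : int -> {RV P >-> R}) (Gamma : int -> R)
    : Prop :=
  [/\ forall (n : nat) (t : 'I_n -> int) (a : 'I_n -> R),
        exists m sigma : R, forall B : set R, measurable B ->
          P [set w | B (\sum_k a k * X (t k) w)] = gaussian_law m sigma B,
      forall t, ('E_P[X t] = 0)%E &
      forall t tau, covariance P (X t) (X (t + tau)) = (Gamma tau)%:E].

Definition cvg_fdd d (Omega : measurableType d) (P : probability Omega R)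
    (XN : nat -> int -> Omega -> R)
    d' (Omega' : measurableType d') (P' : probability Omega' R)
    (X : int -> {RV P' >-> R}) : Prop :=
  forall (n : nat) (t : 'I_n -> int) (f : 'rV[R]_n -> R),
    continuous f -> (exists M : R, forall z, `|f z| <= M) ->
    (fun N => 'E_P[ (fun w => f (\row_k XN N (t k) w)) ])%E @ \oo -->
    ('E_P'[ (fun w => f (\row_k X (t k) w)) ])%E.

End gaussian.

Section freezing.
Context d (Omega : measurableType d) (R : realType) (P : probability Omega R).
Context d1 d2 (T1 : measurableType d1) (T2 : measurableType d2).
Context (Y : {RV P >-> T1}) (eps : {RV P >-> T2}).
Local Open Scope ereal_scope.

(* y |-> E[G(y, eps)] is a version of E[G(Y, eps) | Y]. *)
Lemma freezing (G : (T1 * T2)%type -> \bar R) (A : set T1) :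
  independent2 P Y eps -> measurable A ->
  measurable_fun setT G -> (forall q, 0 <= G q) ->
  \int[P]_(w in Y @^-1` A) G (Y w, eps w) =
  \int[distribution P Y]_(y in A) \int[P]_w G (y, eps w).
Proof.
move=> indep mA mG G0.
pose W w := (Y w, eps w).
have mW : measurable_fun [set: Omega] W by exact: measurable_fun_pair.
pose MF := isMeasurableFun.Build _ _ _ _ W mW.
pose J : {mfun Omega >-> (T1 * T2)%type} := HB.pack W MF.
have joint B : measurable B ->
    distribution P J B = (distribution P Y \x distribution P eps) B.
  move=> mB; apply/esym.
  refine (@product_measure_unique _ _ _ _ _ (distribution P Y)
    (distribution P eps) (distribution P J) _ B mB) => A1 A2 mA1 mA2.
  exact: indep.
transitivity (\int[distribution P J]_(q in A `*` setT) G q).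
  rewrite ge0_integral_pushforward//; first last.
  - exact: measurable_funTS.
  - exact: measurableX.
  by congr (integral _ _ _); apply/seteqP; split=> w //= [].
have mAT : measurable (A `*` [set: T2]) by exact: measurableX.
rewrite (eq_measure_integral (distribution P Y \x distribution P eps)); last first.
  by move=> B mB _; exact: joint.
rewrite integral_mkcond fubini_tonelli1//=; first last.
- by move=> q; rewrite patchE; case: ifP.
- by apply/(measurable_restrictT G mAT); exact: measurable_funTS.
rewrite [RHS]integral_mkcond; apply: eq_integral => y _.
rewrite /fubini_F patchE; case: ifPn => yA.
  rewrite -[RHS](@ge0_integral_pushforward _ _ _ _ _ eps _ P setT (fun e => G (y, e)))//.
  - by apply: eq_integral => e _; rewrite patchE mem_set//; split => //; rewrite -inE.
  - exact: measurableT_comp.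
apply: integral0_eq => e _; rewrite patchE ifN//.
by apply: contra yA; rewrite !inE => -[].
Qed.

End freezing.

(* Main.v *)
(** Fix a trajectory y and write W_i for a linear combination of the values of
    the i-th component at finitely many times, so that everything reduces to the
    limit of E cos (N^(-1/2) sum_(i < N) W_i + th): real cosines with a phase
    play the part of characteristic functions.

    The indices below N are cut into big blocks of length b separated by gaps of
    length q.  Weak dependence bounds the covariances of the W_i (after
    truncation, since its bound does not depend on the truncation level) and
    decouples the cosine of each big block from the preceding ones; a second
    order expansion of each block with Lindeberg remainders then gives
    exp (- sigma^2 / 2) cos th, where sigma^2 is the assumed limit variance.
    The errors are controlled by three sums over i, j: of kappa (q) V_i V_j and
    of kappa (|i - j|) V_i V_j with i in a gap, of the variances over the gaps,
    and of the moments of order 2 + delta.  The laws of the components may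
    depend on i, so that no law of large numbers applies to these sums; but
    their expectations in y decay geometrically along N = 2^(J l), with
    q = 2^(x l) and b = 2^((x + 1) l), precisely because kappa decays faster
    than r^(-(2 + 2 / delta)), and hence they tend to 0 almost surely.

    Convergence of the cosine means gives convergence in distribution since,
    on compact sets, bounded continuous functions are approximated by
    trigonometric polynomials with the same bound: Bernstein polynomials in the
    variables (1 + sin (c x_k)) / 2, for small c.

    The limit process is built on the unit interval: splitting base 4 digits
    gives two independent uniform variables, hence by iteration a sequence of
    independent normal variables, and Gamma, being a limit of covariances, is
    nonnegative definite and has a Cholesky factorization. *)

(* Only the mean of [V] is finite, and this shapes the estimates. For i <> j independence gives E
   (V_i V_j) = (E V)^2, but V_i^2 need not be integrable; so the double sums leave out the diagonal,
   and variances are bounded through the moments of order 2 + delta. The exponent arises as follows.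
   The pairs weighted by kappa (q) contribute about N q^(-p), small when J < p x; the Lindeberg term
   is about N^(-delta/2) b^(1 + delta), small when (x + 1) (1 + delta) < J delta / 2. For large J
   some x satisfies both as soon as 1 / p < delta / (2 (1 + delta)), that is p > 2 + 2 / delta. The
   gaps fill a fraction of about q / b = 2^(-l) of the indices. Block variances are never computed:
   their sum is compared with the variance of X^N, whose limit is a hypothesis, and the discrepancy
   comes from covariances between blocks and from the gaps. *)
Require Import Defs.
From HB Require Import structures.
From mathcomp Require Import all_boot all_order all_algebra.
From mathcomp Require Import all_classical all_reals all_analysis.
From mathcomp Require Import measurable_realfun.
From mathcomp Require Import ring lra zify.

Set Implicit Arguments.
Unset Strict Implicit.
Unset Printing Implicit Defensive.

Import Order.TTheory GRing.Theory Num.Theory.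
Import numFieldNormedType.Exports.

Local Open Scope classical_set_scope.
Local Open Scope ring_scope.

(** * Means and square integrable variables *)

Section mean_theory.
Context d (T : measurableType d) (R : realType) (P : probability T R).
Implicit Types f g : T -> R.

(** A real number, equal to 0 by convention when the integral is infinite; this is why linearity is
    stated under [integ] hypotheses. *)
Definition mean f : R := \int[P]_w f w.
Definition integ f : Prop := P.-integrable setT (EFin \o f).

Lemma integ_meas f : integ f -> measurable_fun setT f.
Proof. by move=> /integrableP[/measurable_EFinP]. Qed.

Lemma le_integ f g : measurable_fun setT f -> integ g ->
  (forall w, `|f w| <= g w) -> integ f.
Proof.
move=> mf ig fg; apply: le_integrable ig => //; first exact/measurable_EFinP.
by move=> w _; rewrite /= lee_fin (le_trans (fg w))// ler_norm.
Qed.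

Lemma integ_cst c : integ (fun=> c).
Proof. exact: finite_measure_integrable_cst. Qed.

Lemma integ_bounded f c : measurable_fun setT f -> (forall w, `|f w| <= c) ->
  integ f.
Proof. by move=> mf fc; exact: (le_integ mf (integ_cst c)). Qed.

Lemma integD f g : integ f -> integ g -> integ (fun w => f w + g w).
Proof. by move=> hf hg; exact: (integrableD _ hf hg). Qed.

Lemma integZ c f : integ f -> integ (fun w => c * f w).
Proof. by move=> hf; exact: (integrableZl _ c hf). Qed.

Lemma integN f : integ f -> integ (fun w => - f w).
Proof. by move=> hf; under eq_fun do rewrite -mulN1r; exact: integZ. Qed.

Lemma integB f g : integ f -> integ g -> integ (fun w => f w - g w).
Proof. by move=> hf hg; apply: integD hf (integN hg). Qed.

Lemma integ_sum (I : Type) (s : seq I) (p : pred I) (F : I -> T -> R) :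
  (forall i, integ (F i)) -> integ (fun w => \sum_(i <- s | p i) F i w).
Proof.
move=> iF; elim: s => [|i s ih].
  by under eq_fun do rewrite big_nil; exact: integ_cst.
under eq_fun do rewrite big_cons; by case: (p i) => //; exact: integD.
Qed.

Lemma integ_norm f : integ f -> integ (fun w => `|f w|).
Proof. by move=> hf; exact: integrable_norm. Qed.

Lemma eq_mean f g : (forall w, f w = g w) -> mean f = mean g.
Proof. by move=> fg; apply: eq_Rintegral => w _. Qed.

Lemma mean_cst c : mean (fun=> c) = c.
Proof.
by rewrite /mean Rintegral_cst// [X in fine X](@probability_setT _ _ _ P)/= mulr1.
Qed.

Lemma meanD f g : integ f -> integ g ->
  mean (fun w => f w + g w) = mean f + mean g.
Proof. exact: RintegralD. Qed.

Lemma meanB f g : integ f -> integ g ->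
  mean (fun w => f w - g w) = mean f - mean g.
Proof. exact: RintegralB. Qed.

Lemma meanZ c f : integ f -> mean (fun w => c * f w) = c * mean f.
Proof. by move=> hf; exact: RintegralZl. Qed.

Lemma mean_sum (I : Type) (s : seq I) (p : pred I) (F : I -> T -> R) :
  (forall i, integ (F i)) ->
  mean (fun w => \sum_(i <- s | p i) F i w) = \sum_(i <- s | p i) mean (F i).
Proof.
move=> iF; elim: s => [|i s ih].
  by rewrite big_nil -[RHS](mean_cst 0); apply: eq_mean => w; rewrite big_nil.
rewrite big_cons -ih; case: ifP => pi; last first.
  by apply: eq_mean => w; rewrite big_cons pi.
rewrite -meanD//; first by apply: eq_mean => w; rewrite big_cons pi.
exact: integ_sum.
Qed.

Lemma le_mean f g : integ f -> integ g -> (forall w, f w <= g w) ->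
  mean f <= mean g.
Proof. by move=> hf hg fg; exact: le_Rintegral. Qed.

Lemma mean_ge0 f : (forall w, 0 <= f w) -> 0 <= mean f.
Proof. by move=> f0; apply: Rintegral_ge0 => w _. Qed.

Lemma mean_sqr_ge0 f : 0 <= mean (fun w => f w ^+ 2).
Proof. by apply: mean_ge0 => w; exact: sqr_ge0. Qed.

Lemma mean_powR_ge0 f q : 0 <= mean (fun w => f w `^ q).
Proof. by apply: mean_ge0 => w; exact: powR_ge0. Qed.

Lemma norm_mean f : integ f -> `|mean f| <= mean (fun w => `|f w|).
Proof. by move=> hf; exact: le_normr_Rintegral. Qed.

Lemma norm_mean_le f g : measurable_fun setT f -> integ g ->
  (forall w, `|f w| <= g w) -> `|mean f| <= mean g.
Proof.
move=> mf ig fg; have hf := le_integ mf ig fg.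
by apply: (le_trans (norm_mean hf)); apply: le_mean => //; exact: integ_norm.
Qed.

Lemma norm_meanB_le f g h : integ f -> integ g -> integ h ->
  (forall w, `|f w - g w| <= h w) -> `|mean f - mean g| <= mean h.
Proof.
move=> hf hg hh fgh; rewrite -meanB//; apply: norm_mean_le => //.
by apply: integ_meas; exact: integB.
Qed.

Lemma expectation_mean f : integ f -> ('E_P[f] = (mean f)%:E)%E.
Proof.
by move=> hf; rewrite unlock /mean /Rintegral fineK//; exact: integrable_fin_num.
Qed.

Lemma integ_dominated_cvg (F : nat -> T -> R) f g :
  (forall n, measurable_fun setT (F n)) -> measurable_fun setT f -> integ g ->
  (forall w, F ^~ w @ \oo --> f w) -> (forall n w, `|F n w| <= g w) ->
  (fun n => mean (F n)) @ \oo --> mean f.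
Proof.
move=> mF mf ig cF Fg.
have m1 n : measurable_fun setT (EFin \o F n) by exact/measurable_EFinP.
have m2 : measurable_fun setT (EFin \o f) by exact/measurable_EFinP.
have c1 : {ae P, forall w, setT w -> (EFin \o F n) w @[n --> \oo] --> (EFin \o f) w}.
  by apply/aeW => w _; apply: cvg_EFin (cF w); exact: nearW.
have b1 : {ae P, forall w n, setT w -> (`|(EFin \o F n) w| <= (EFin \o g) w)%E}.
  by apply/aeW => w n _ /=; rewrite lee_fin.
have [h1 _ h3] := dominated_convergence (@measurableT _ T) m1 m2 c1 ig b1.
by apply: fine_cvg; rewrite /mean /Rintegral fineK//; exact: integrable_fin_num.
Qed.

Definition sqint f : Prop := measurable_fun setT f /\ integ (fun w => f w ^+ 2).

Lemma sqint_mul f g : sqint f -> sqint g -> integ (fun w => f w * g w).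
Proof.
move=> [mf f2] [mg g2]; apply: (le_integ _ (integD f2 g2)).
  exact: measurable_funM.
move=> w; rewrite normrM -(normr_id (f w)) -[X in _ <= X + _]real_normK ?num_real//.
rewrite -[X in _ <= _ + X]real_normK ?num_real// normr_id.
by have := normr_ge0 (f w); have := normr_ge0 (g w); nra.
Qed.

Lemma sqint_cst c : sqint (fun=> c).
Proof. by split; [exact: measurable_cst|exact: integ_cst]. Qed.

Lemma sqint_integ f : sqint f -> integ f.
Proof.
move=> hf; have := sqint_mul hf (sqint_cst 1).
by under eq_fun do rewrite mulr1.
Qed.

Lemma sqintD f g : sqint f -> sqint g -> sqint (fun w => f w + g w).
Proof.
move=> hf hg; split; first by apply: measurable_funD; [case: hf|case: hg].
under eq_fun do rewrite sqrrD -mulr_natl.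
apply: integD; last by case: hg.
by apply: integD; [case: hf|apply: integZ; exact: sqint_mul].
Qed.

Lemma sqintZ c f : sqint f -> sqint (fun w => c * f w).
Proof.
move=> [mf f2]; split; first by apply: measurable_funM => //; exact: measurable_cst.
by under eq_fun do rewrite exprMn; exact: integZ.
Qed.

Lemma sqint_sum (I : Type) (s : seq I) (p : pred I) (F : I -> T -> R) :
  (forall i, sqint (F i)) -> sqint (fun w => \sum_(i <- s | p i) F i w).
Proof.
move=> iF; elim: s => [|i s ih].
  by under eq_fun do rewrite big_nil; exact: sqint_cst.
under eq_fun do rewrite big_cons; by case: (p i) => //; exact: sqintD.
Qed.

Lemma mean_sqr_sum (n : nat) (F : nat -> T -> R) : (forall i, sqint (F i)) ->
  mean (fun w => (\sum_(i < n) F i w) ^+ 2) =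
  \sum_(i < n) \sum_(j < n) mean (fun w => F i w * F j w).
Proof.
move=> hF; transitivity (\sum_(i < n) mean (fun w => \sum_(j < n) F i w * F j w)); last first.
  apply: eq_bigr => i _.
  by rewrite (mean_sum _ _ (F := fun (j : 'I_n) w => F i w * F j w))// => j; exact: sqint_mul.
rewrite -mean_sum; last by move=> i; apply: integ_sum => j; exact: sqint_mul.
apply: eq_mean => w; rewrite expr2 big_distrl/=.
by apply: eq_bigr => i _; rewrite big_distrr.
Qed.

(** The pointwise bound x <= e + x^2 / e replaces the Cauchy-Schwarz inequality: when the second
    moment tends to 0, the first moment is in the limit at most e, and e is arbitrary. *)
Lemma mean_norm_le_sqr f e : sqint f -> 0 < e ->
  mean (fun w => `|f w|) <= e + e^-1 * mean (fun w => f w ^+ 2).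
Proof.
move=> hf e0; rewrite -[X in _ <= X + _](mean_cst e) -meanZ; last by case: hf.
rewrite -meanD; [|exact: integ_cst|by apply: integZ; case: hf].
apply: le_mean.
- by apply/integ_norm/sqint_integ.
- by apply: integD; [exact: integ_cst|apply: integZ; case: hf].
move=> w; rewrite -(real_normK (num_real (f w))) mulrC.
set x := `|f w|; rewrite -subr_ge0.
have -> : e + x ^+ 2 / e - x = ((x - e / 2) ^+ 2 + 3 / 4 * e ^+ 2) / e.
  by field; rewrite gt_eqF.
apply: divr_ge0; last exact: ltW.
by rewrite addr_ge0 ?sqr_ge0// mulr_ge0// sqr_ge0.
Qed.

End mean_theory.

(** * Real inequalities *)

Section real_inequalities.
Context (R : realType).
Implicit Types (x u e s : R).

(** Mean value theorem between 0 and x. It is used as a ladder: each of the Taylor bounds below is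
    the sign of the derivative needed for the next one. *)
Lemma ge0_of_derive (f df : R -> R) : (forall x, is_derive x 1 f (df x)) ->
  0 <= f 0 -> (forall x, 0 <= x -> 0 <= df x) -> forall x, 0 <= x -> 0 <= f x.
Proof.
move=> hf f0 hdf x x0.
have cf : {within `[0, x], continuous f}.
  by apply: derivable_within_continuous => y _; have [] := hf y.
have [c] := MVT_segment x0 (fun y _ => hf y) cf.
rewrite in_itv/= => /andP[c0 _] /eqP; rewrite subr_eq => /eqP ->.
by rewrite addr_ge0// mulr_ge0 ?hdf// subr0.
Qed.

Lemma sin_le_id x : 0 <= x -> sin x <= x.
Proof.
move=> x0; rewrite -subr_ge0.
apply: (@ge0_of_derive (fun x => x - sin x) (fun x => 1 - cos x)) => //.
by rewrite sin0 subr0.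
Qed.

Lemma is_derive_scaled_exp (n : nat) (a x : R) :
  is_derive x 1 (fun y => a * y ^+ n.+1) (a * (n.+1%:R * x ^+ n)).
Proof.
have -> : (fun y => a * y ^+ n.+1) = a *: (@id R ^+ n.+1).
  by apply/funext => y; rewrite /GRing.scale/= exprfctE.
apply: is_derive_eq.
by rewrite /GRing.scale/= mulr1.
Qed.

Lemma cos_ge_quadratic x : 0 <= x -> 0 <= cos x - 1 + 2^-1 * x ^+ 2.
Proof.
move=> x0.
apply: (@ge0_of_derive (fun x => cos x - 1 + 2^-1 * x ^+ 2) (fun x => x - sin x)) => //.
- move=> y.
  have h1 : is_derive y 1 (fun x : R => cos x - 1) (- sin y).
    rewrite -[- sin y]subr0; exact: is_deriveB.
  have h2 := is_derive_scaled_exp 1 2^-1 y.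
  refine (is_derive_eq (is_deriveD h1 h2) _).
  by field.
- by rewrite cos0 subrr expr0n/= mulr0 add0r.
- by move=> y y0; rewrite subr_ge0 sin_le_id.
Qed.

Lemma sin_ge_cubic x : 0 <= x -> 0 <= sin x - x + 6^-1 * x ^+ 3.
Proof.
move=> x0.
apply: (@ge0_of_derive (fun x => sin x - x + 6^-1 * x ^+ 3)
   (fun x => cos x - 1 + 2^-1 * x ^+ 2)) => //.
- move=> y.
  have h1 : is_derive y 1 (fun x : R => sin x - x) (cos y - 1).
    exact: is_deriveB.
  have h2 := is_derive_scaled_exp 2 6^-1 y.
  refine (is_derive_eq (is_deriveD h1 h2) _).
  by field.
- by rewrite sin0 subrr expr0n/= mulr0 add0r.
- exact: cos_ge_quadratic.
Qed.

Lemma cos_le_quartic x : 0 <= x -> 0 <= 24^-1 * x ^+ 4 - (cos x - 1 + 2^-1 * x ^+ 2).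
Proof.
move=> x0.
apply: (@ge0_of_derive (fun x => 24^-1 * x ^+ 4 - (cos x - 1 + 2^-1 * x ^+ 2))
   (fun x => sin x - x + 6^-1 * x ^+ 3)) => //.
- move=> y.
  have h1 : is_derive y 1 (fun x : R => cos x - 1) (- sin y).
    rewrite -[- sin y]subr0; exact: is_deriveB.
  have h2 := is_derive_scaled_exp 1 2^-1 y.
  have h3 := is_derive_scaled_exp 3 24^-1 y.
  refine (is_derive_eq (is_deriveB h3 (is_deriveD h1 h2)) _).
  by field.
- by rewrite cos0 subrr !expr0n/= !mulr0 addr0 subrr.
- exact: sin_ge_cubic.
Qed.

(** Both bounds are kept for [lindeberg_split], where the cubic one serves for small u and the
    quadratic one for large u. *)
Lemma sin_sub_id u : `|sin u - u| <= 2 * u ^+ 2 /\ `|sin u - u| <= `|u| ^+ 3.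
Proof.
wlog u0 : u / 0 <= u.
  move=> h; have [/h//|/ltW u0] := leP 0 u.
  have := h (- u); rewrite oppr_ge0 => /(_ u0).
  by rewrite sinN -opprD !normrN sqrrN.
have h1 := sin_le_id u0; have h2 := sin_ge_cubic u0; have h3 := sin_geN1 u.
have u3 : 0 <= u ^+ 3 by exact: exprn_ge0.
have -> : `|sin u - u| = u - sin u by rewrite distrC ger0_norm// subr_ge0.
rewrite (ger0_norm u0); split; last by lra.
have [u1|u1] := leP u 1; last by nra.
have : u ^+ 3 <= u ^+ 2 by rewrite exprS ler_piMl// sqr_ge0.
by have := sqr_ge0 u; lra.
Qed.

Lemma cos_sub_quadratic u :
  `|cos u - (1 - u ^+ 2 / 2)| <= u ^+ 2 /\ `|cos u - (1 - u ^+ 2 / 2)| <= `|u| ^+ 3.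
Proof.
wlog u0 : u / 0 <= u.
  move=> h; have [/h//|/ltW u0] := leP 0 u.
  by have := h (- u); rewrite oppr_ge0 => /(_ u0); rewrite cosN normrN sqrrN.
have h1 := cos_ge_quadratic u0; have h2 := cos_le_quartic u0; have h3 := cos_le1 u.
have -> : cos u - (1 - u ^+ 2 / 2) = cos u - 1 + 2^-1 * u ^+ 2 by field.
have u2 := sqr_ge0 u.
rewrite (ger0_norm h1) (ger0_norm u0); split; first by lra.
(* Up to 24 the quartic remainder u^4 / 24 is at most u^3; beyond, u^2 already is. *)
have [u1|u1] := leP u 24.
  have : u ^+ 4 <= 24 * u ^+ 3 by rewrite exprS ler_wpM2r// exprn_ge0.
  by lra.
have : u ^+ 2 <= u ^+ 3 by rewrite [leRHS]exprS ler_peMl//; lra.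
by lra.
Qed.

Lemma expRN_sub_linear s : 0 <= s -> `|expR (- s) - (1 - s)| <= s ^+ 2.
Proof.
move=> s0; have h1 := expR_ge1Dx (- s); have h2 := expR_ge1Dx s.
have h : expR (- s) <= 1 - s + s ^+ 2.
  rewrite expRN -[leLHS]mul1r ler_pdivrMr ?expR_gt0//.
  (* The left side equals 1 + s^3, which is at least 1. *)
  have : (1 - s + s ^+ 2) * (1 + s) <= (1 - s + s ^+ 2) * expR s.
    by rewrite ler_wpM2l//; nra.
  by have := exprn_ge0 3 s0; nra.
by rewrite ger0_norm; lra.
Qed.

Lemma sqr_le_trunc_powR (e dlt u : R) : 0 < e -> 0 < dlt ->
  e < `|u| -> u ^+ 2 <= (e `^ dlt)^-1 * `|u| `^ (2 + dlt).
Proof.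
move=> e0 d0 ue; have u0 : 0 < `|u| by exact: lt_trans ue.
rewrite powRD; last by rewrite gt_eqF ?implybT//; lra.
rewrite powR_mulrn// real_normK ?num_real// mulrCA -[leLHS]mulr1.
rewrite ler_wpM2l ?sqr_ge0// mulrC ler_pdivlMr ?powR_gt0// mul1r.
by rewrite ge0_ler_powR ?nnegrE// ltW.
Qed.

(** Below the threshold e the cubic bound gives e u^2; above it u^2 is at most e^(-dlt) |u|^(2 +
    dlt). The first term will sum to a small multiple of the variance, the second is controlled by
    the moments. *)
Lemma lindeberg_split (a e dlt u : R) : 0 < e -> 0 < dlt ->
  a <= 2 * u ^+ 2 -> a <= `|u| ^+ 3 ->
  a <= 2 * (e * u ^+ 2 + (e `^ dlt)^-1 * `|u| `^ (2 + dlt)).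
Proof.
move=> e0 d0 h1 h2.
have h3 : 0 <= (e `^ dlt)^-1 * `|u| `^ (2 + dlt).
  by rewrite mulr_ge0 ?invr_ge0 ?powR_ge0.
have [ue|eu] := leP `|u| e.
  have : `|u| ^+ 3 <= e * u ^+ 2.
    by rewrite exprS -(real_normK (num_real u)) ler_wpM2r// sqr_ge0.
  have : 0 <= e * u ^+ 2 by rewrite mulr_ge0 ?sqr_ge0// ltW.
  lra.
have := sqr_le_trunc_powR e0 d0 eu.
have : 0 <= e * u ^+ 2 by rewrite mulr_ge0 ?sqr_ge0// ltW.
lra.
Qed.

Lemma sqr_le_powR (e dlt u : R) : 0 < e -> 0 < dlt ->
  u ^+ 2 <= e ^+ 2 + (e `^ dlt)^-1 * `|u| `^ (2 + dlt).
Proof.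
move=> e0 d0.
have h3 : 0 <= (e `^ dlt)^-1 * `|u| `^ (2 + dlt).
  by rewrite mulr_ge0 ?invr_ge0 ?powR_ge0.
have [ue|eu] := leP `|u| e.
  have : u ^+ 2 <= e ^+ 2 by rewrite -(real_normK (num_real u)) lerXn2r// nnegrE// ltW.
  lra.
by have := sqr_le_trunc_powR e0 d0 eu; have := sqr_ge0 e; lra.
Qed.

(* Young's inequality for each x_i against the arithmetic mean of all of them. *)
Lemma powR_sum_le (m : nat) (x : 'I_m -> R) (q : R) : 1 < q ->
  (forall i, 0 <= x i) ->
  (\sum_i x i) `^ q <= m%:R `^ (q - 1) * \sum_i x i `^ q.
Proof.
case: m x => [|m] x q1 x0.
  by rewrite !big_ord0 mulr0 powR0// gt_eqF; lra.
have q0 : 0 < q by lra.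
set S := \sum_i x i; have S0 : 0 <= S by exact: sumr_ge0.
set a := S / m.+1%:R.
have a0 : 0 <= a by rewrite divr_ge0.
have hS : S = m.+1%:R * a by rewrite /a mulrC divfK// pnatr_eq0.
pose p := q / (q - 1).
have p0 : 0 < p by rewrite divr_gt0//; lra.
have hap : (a `^ (q - 1)) `^ p = a `^ q.
  by rewrite -powRrM /p mulrC divfK//; apply/eqP; lra.
have key : m.+1%:R * a `^ q <= \sum_i x i `^ q.
  have h i : x i * a `^ (q - 1) <= x i `^ q / q + a `^ q / p.
    rewrite -hap; apply: conjugate_powR => //; first exact: powR_ge0.
    by rewrite /p; field; apply/andP; split; apply/eqP; lra.
  have : \sum_i x i * a `^ (q - 1) <= \sum_i (x i `^ q / q + a `^ q / p).
    by apply: ler_sum.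
  rewrite -big_distrl/= -/S big_split/= -big_distrl/= sumr_const card_ord -[X in _ <= _ + X -> _]mulr_natl.
  rewrite {1}hS -mulrA mulr_powRB1//.
  set A := m.+1%:R * _; set B := \sum_i _.
  have -> : m.+1%:R * (a `^ q / p) = A * (1 - q^-1).
    by rewrite /A /p; field; apply/andP; split; apply/eqP; lra.
  move=> h2; rewrite -subr_ge0.
  have -> : B - A = q * (B / q + A * (1 - q^-1) - A).
    by field; apply/eqP; lra.
  by rewrite mulr_ge0 ?subr_ge0// ltW.
rewrite hS powRM// -(mulr_powRB1 (ler0n _ m.+1) q0) [X in X * _]mulrC -mulrA.
by rewrite ler_wpM2l ?powR_ge0.
Qed.

Lemma cos_lip x y : `|cos (x + y) - cos x| <= `|y|.
Proof.
wlog xy : x y / 0 <= y.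
  move=> H; have [/H//|/ltW y0] := leP 0 y.
  have := H (x + y) (- y); rewrite oppr_ge0 addrK => /(_ y0).
  by rewrite distrC normrN.
have cc : {within `[x, x + y], continuous (@cos R)}.
  by apply: continuous_subspaceT => z; exact: continuous_cos.
have [|c _] := @MVT_segment R (@cos R) (fun z => - sin z) x (x + y) _
  (fun z _ => is_derive_cos z) cc.
  by rewrite lerDl.
rewrite addrAC subrr add0r => ->; rewrite normrM normrN.
by rewrite ler_piMl// sin_max.
Qed.

Lemma expRN_lip x y : 0 <= x -> 0 <= y ->
  `|expR (- (x / 2)) - expR (- (y / 2))| <= `|x - y|.
Proof.
wlog xy : x y / x <= y.
  move=> H x0 y0; have [/H|/ltW/H] := leP x y; first exact.
  by rewrite distrC (distrC y); exact.
move=> x0 y0; rewrite distrC (distrC x) ler0_norm; last first.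
  by rewrite subr_le0 ler_expR; lra.
rewrite ger0_norm ?subr_ge0// opprB.
have -> : expR (- (y / 2)) = expR (- (x / 2)) * expR (- ((y - x) / 2)).
  by rewrite -expRD; congr expR; field.
have h1 := expR_ge1Dx (- ((y - x) / 2)).
have h2 : expR (- (x / 2)) <= 1 by rewrite -[leRHS]expR0 ler_expR; lra.
have h3 := expR_ge0 (- (x / 2)).
nra.
Qed.

Definition truncate (M x : R) : R := Num.max (- M) (Num.min x M).

Lemma truncate_id M x : `|x| <= M -> truncate M x = x.
Proof.
by rewrite ler_norml /truncate => /andP[h1 h2]; rewrite (min_idPl h2) (max_idPr h1).
Qed.

Lemma truncate_le M x : 0 <= M -> `|truncate M x| <= M.
Proof.
move=> M0; rewrite /truncate ler_norml le_max lexx/= ge_max ge_min lexx orbT andbT.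
by lra.
Qed.

Lemma truncate_norm M x : 0 <= M -> `|truncate M x| <= `|x|.
Proof.
move=> M0; rewrite /truncate; have [h1|h1] := lerP x M; last first.
  have -> : Num.max (- M) M = M by apply/max_idPr; lra.
  by rewrite ger0_norm// (le_trans (ltW h1))// ler_norm.
have [h2|h2] := leP (- M) x => //.
by rewrite normrN ger0_norm// -(normrN x) (le_trans _ (ler_norm _))//; lra.
Qed.

Lemma truncate_lip M x z : `|truncate M x - truncate M z| <= `|x - z|.
Proof.
wlog xz : x z / z <= x.
  by move=> H; have [/H|/ltW/H] := leP z x => //; rewrite distrC (distrC z).
rewrite (ger0_norm (x := x - z)) ?subr_ge0//.
rewrite ger0_norm; last first.
  rewrite subr_ge0 /truncate ge_max le_max lexx/= le_max; apply/orP; right.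
  by rewrite le_min !ge_min xz lexx !orbT.
rewrite /truncate lerBlDr ge_max; apply/andP; split.
  by rewrite -[leLHS]add0r lerD ?subr_ge0// le_max lexx.
have [h|h] := leP z M.
  apply: (@le_trans _ _ x); first by rewrite ge_min lexx.
  by rewrite -lerBlDl opprB addrC subrK le_max lexx orbT.
apply: (@le_trans _ _ M); first by rewrite ge_min lexx orbT.
by rewrite -[leLHS]add0r lerD ?subr_ge0// le_max lexx orbT.
Qed.

Lemma continuous_truncate M : continuous (truncate M).
Proof.
move=> x; apply/cvgrPdist_lt => e e0; near=> z.
apply: (le_lt_trans (truncate_lip M x z)).
by near: z; apply: cvgr_dist_lt.
Unshelve. all: by end_near. Qed.

Lemma truncate_cvg x : (fun N : nat => truncate N%:R x) @ \oo --> x.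
Proof.
apply/cvgrPdist_lt => e e0; near=> N.
rewrite truncate_id ?subrr ?normr0//; near: N; exact: nbhs_infty_ger.
Unshelve. all: by end_near. Qed.

End real_inequalities.

(** * Cosine means of sums of nearly decoupled blocks *)

Section block_sums.
Context d (T : measurableType d) (R : realType) (P : probability T R).
Local Notation E := (mean P).

Lemma measurable_cos_shift (X : T -> R) (th : R) : measurable_fun setT X ->
  measurable_fun setT (fun w => cos (X w + th)).
Proof.
move=> mX.
apply: (@measurableT_comp _ _ _ _ _ _ (@cos R) _ (fun w => X w + th)).
  by apply: continuous_measurable_fun; exact: continuous_cos.
by apply: measurable_funD => //; exact: measurable_cst.
Qed.

Lemma measurable_sin_comp (X : T -> R) : measurable_fun setT X ->
  measurable_fun setT (fun w => sin (X w)).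
Proof.
move=> mX; apply: (@measurableT_comp _ _ _ _ _ _ (@sin R) _ X) => //.
by apply: continuous_measurable_fun; exact: continuous_sin.
Qed.

Lemma measurable_norm_powR (X : T -> R) (q : R) : measurable_fun setT X ->
  measurable_fun setT (fun w => `|X w| `^ q).
Proof.
move=> mX; apply: (@measurableT_comp _ _ _ _ _ _ (fun x : R => x `^ q) _ (fun w => `|X w|)).
  exact: measurable_powR.
exact: measurableT_comp.
Qed.

Lemma integ_cos_shift (X : T -> R) (th : R) : measurable_fun setT X ->
  integ P (fun w => cos (X w + th)).
Proof.
move=> mX; apply: (@integ_bounded _ _ _ _ _ 1); first exact: measurable_cos_shift.
by move=> w; exact: cos_max.
Qed.

Lemma norm_mean_cos (X : T -> R) (th : R) : measurable_fun setT X ->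
  `|E (fun w => cos (X w + th))| <= 1.
Proof.
move=> mX; rewrite -[leRHS](mean_cst P 1); apply: norm_mean_le.
- exact: measurable_cos_shift.
- exact: integ_cst.
- by move=> w; exact: cos_max.
Qed.

Variables (U : nat -> T -> R) (c : nat -> R) (dlt e : R).
Hypotheses (hU : forall k, sqint P (U k)) (U0 : forall k, E (U k) = 0)
  (Uq : forall k, integ P (fun w => `|U k w| `^ (2 + dlt)))
  (e0 : 0 < e) (dlt0 : 0 < dlt).

Let S k w := \sum_(j < k) U j w.
Let sig2 k := E (fun w => U k w ^+ 2).
Let mom k := E (fun w => `|U k w| `^ (2 + dlt)).

(** Both phases are free because the addition formula also produces sines, which are cosines with
    phase - pi / 2. *)
Hypothesis decoupling : forall k (a b : R),
  `|E (fun w => cos (S k w + a) * cos (U k w + b)) -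
    E (fun w => cos (S k w + a)) * E (fun w => cos (U k w + b))| <= c k.

Let tau k := 2 * (e * sig2 k + (e `^ dlt)^-1 * mom k).

Let mU k : measurable_fun setT (U k). Proof. by case: (hU k). Qed.

Let mS k : measurable_fun setT (S k).
Proof. by apply: measurable_sum => j; exact: mU. Qed.

Let integ_split k : integ P (fun w => 2 * (e * U k w ^+ 2 +
  (e `^ dlt)^-1 * `|U k w| `^ (2 + dlt))).
Proof.
by apply/integZ/integD; apply: integZ; [case: (hU k)|exact: Uq].
Qed.

Let mean_split k : E (fun w => 2 * (e * U k w ^+ 2 +
  (e `^ dlt)^-1 * `|U k w| `^ (2 + dlt))) = tau k.
Proof.
have h2 : integ P (fun w => U k w ^+ 2) by case: (hU k).
have hq := Uq k.
rewrite meanZ; last by apply: integD; exact: integZ.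
by rewrite meanD ?meanZ//; exact: integZ.
Qed.

Lemma sig2_ge0 k : 0 <= sig2 k.
Proof. by exact: mean_sqr_ge0. Qed.

(** As [U k] is centered, it can be subtracted from its sine under the mean, which leaves a Taylor
    remainder. *)
Let mean_sin k : `|E (fun w => sin (U k w))| <= tau k.
Proof.
rewrite -mean_split -[X in `|X|]subr0 -(U0 k); apply: norm_meanB_le => //.
- apply: (@integ_bounded _ _ _ _ _ 1); first exact: measurable_sin_comp.
  by move=> w; exact: sin_max.
- exact: sqint_integ.
- by move=> w; apply: lindeberg_split => //; have [] := sin_sub_id (U k w).
Qed.

Let mean_cos k : `|E (fun w => cos (U k w + 0)) - expR (- (sig2 k / 2))| <=
  tau k + sig2 k ^+ 2 / 4.
Proof.
have h2 : integ P (fun w => U k w ^+ 2 / 2).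
  by under eq_fun do rewrite mulrC; apply: integZ; case: (hU k).
have -> : E (fun w => cos (U k w + 0)) - expR (- (sig2 k / 2)) =
  (E (fun w => cos (U k w + 0)) - E (fun w => 1 - U k w ^+ 2 / 2)) -
  (expR (- (sig2 k / 2)) - (1 - sig2 k / 2)).
  rewrite meanB//; last exact: integ_cst.
  rewrite mean_cst (_ : E (fun w => U k w ^+ 2 / 2) = sig2 k / 2); first ring.
  rewrite mulrC -meanZ; last by case: (hU k).
  by apply: eq_mean => w; rewrite mulrC.
apply: (le_trans (ler_normB _ _)); apply: lerD.
  rewrite -mean_split; apply: norm_meanB_le => //.
  - exact: integ_cos_shift.
  - by apply: integB => //; exact: integ_cst.
  move=> w; rewrite addr0; have [h1 h3] := cos_sub_quadratic (U k w).
  apply: lindeberg_split => //; apply: (le_trans h1).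
  by have := sqr_ge0 (U k w); lra.
have s0 := sig2_ge0 k.
apply: (le_trans (expRN_sub_linear _)); first by rewrite divr_ge0.
by rewrite expr_div_n -natrX.
Qed.

(** The addition formula gives two products, whose means are separated by decoupling. The mean sine
    of the block is a remainder, its mean cosine is nearly exp (- sig2 k / 2), and the factors
    coming from the past are at most 1. *)
Let cos_step k th :
  `|E (fun w => cos (S k.+1 w + th)) -
    expR (- (sig2 k / 2)) * E (fun w => cos (S k w + th))| <=
  2 * c k + (2 * tau k + sig2 k ^+ 2 / 4).
Proof.
pose A := E (fun w => cos (S k w + th)).
pose B := E (fun w => cos (S k w + (th - pi / 2))).
pose C := E (fun w => cos (U k w + 0)).
pose D := E (fun w => cos (U k w + - (pi / 2))).
have hm a b : integ P (fun w => cos (S k w + a) * cos (U k w + b)).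
  apply: (@integ_bounded _ _ _ _ _ 1).
    by apply: measurable_funM; exact: measurable_cos_shift.
  by move=> w; rewrite normrM mulr_ile1// cos_max.
have -> : E (fun w => cos (S k.+1 w + th)) =
    E (fun w => cos (S k w + th) * cos (U k w + 0)) -
    E (fun w => cos (S k w + (th - pi / 2)) * cos (U k w + - (pi / 2))).
  rewrite -meanB//; apply: eq_mean => w.
  rewrite [S k.+1 w]big_ord_recr/= -/(S k w) addr0 addrA !cosBpihalf.
  by rewrite addrAC cosD.
have h1 := decoupling k th 0; have h2 := decoupling k (th - pi / 2) (- (pi / 2)).
have hA : `|A| <= 1 by exact: norm_mean_cos.
have hB : `|B| <= 1 by exact: norm_mean_cos.
have hC := mean_cos k.
have hD : `|D| <= tau k.
  have -> : D = E (fun w => sin (U k w)).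
    by apply: eq_mean => w; rewrite cosBpihalf.
  exact: mean_sin.
have hAC : `|A * (C - expR (- (sig2 k / 2)))| <= tau k + sig2 k ^+ 2 / 4.
  by rewrite normrM (le_trans _ hC)// ler_piMl.
have hBD : `|B * D| <= tau k by rewrite normrM (le_trans _ hD)// ler_piMl.
set X := E _ in h1 *; set Y := E _ in h2 *.
rewrite -/A -/C in h1; rewrite -/B -/D in h2.
have -> : X - Y - expR (- (sig2 k / 2)) * A =
  (X - A * C) - (Y - B * D) + A * (C - expR (- (sig2 k / 2))) - B * D by ring.
apply: (le_trans (ler_normB _ _)).
have := ler_normD (X - A * C - (Y - B * D)) (A * (C - expR (- (sig2 k / 2)))).
have := ler_normB (X - A * C) (Y - B * D).
rewrite -/C in hC; lra.
Qed.

(** The factors exp (- sig2 k / 2) are at most 1, so the errors of the successive steps add up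
    without being amplified. *)
Lemma mean_cos_block_sum K th :
  `|E (fun w => cos (S K w + th)) -
    expR (- ((\sum_(k < K) sig2 k) / 2)) * cos th| <=
  \sum_(k < K) (2 * c k + (2 * tau k + sig2 k ^+ 2 / 4)).
Proof.
elim: K => [|K IH].
  rewrite !big_ord0 mul0r oppr0 expR0 mul1r (_ : E _ = cos th) ?subrr ?normr0//.
  rewrite -[RHS](mean_cst P); apply: eq_mean => w.
  by rewrite /S big_ord0 add0r.
rewrite !big_ord_recr/= [leRHS]addrC.
have -> : E (fun w => cos (S K.+1 w + th)) -
    expR (- ((\sum_(k < K) sig2 k + sig2 K) / 2)) * cos th =
  (E (fun w => cos (S K.+1 w + th)) -
    expR (- (sig2 K / 2)) * E (fun w => cos (S K w + th))) +
  expR (- (sig2 K / 2)) * (E (fun w => cos (S K w + th)) -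
    expR (- ((\sum_(k < K) sig2 k) / 2)) * cos th).
  by rewrite mulrDl opprD expRD; ring.
apply: (le_trans (ler_normD _ _)); apply: lerD; first exact: cos_step.
rewrite normrM (le_trans _ IH)// ler_piMl// ger0_norm ?expR_ge0//.
by rewrite -expR0 ler_expR oppr_le0 divr_ge0// sig2_ge0.
Qed.

End block_sums.

(** * The limit theorem along a fixed trajectory *)

Lemma sum_blocks (V : nmodType) (F : nat -> V) (K c : nat) :
  \sum_(i < K * c) F i = \sum_(k < K) \sum_(i < c) F (k * c + i)%N.
Proof.
elim: K => [|K IH]; first by rewrite !big_ord0.
rewrite big_ord_recr/= -IH mulSn addnC.
by rewrite big_split_ord.
Qed.

(** Truncated subtraction makes the sum equal to |i - j|. The predecessor is taken because weak
    dependence at distance r asks for i + r < j, so that r = |i - j| - 1 is the best choice. *)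
Definition gap (i j : nat) : nat := (i - j + (j - i)).-1.

Section limit_bound.
Context (R : realType).

(** Here e is fixed first, N tends to infinity next, and e is made small in terms of the limit of
    the bound. *)
Lemma cvg_of_bound (u h g f x : nat -> R) (C L sigma2 dlt : R) : 0 <= sigma2 ->
  h @ \oo --> (0 : R) -> g @ \oo --> (0 : R) -> f @ \oo --> (0 : R) ->
  x @ \oo --> sigma2 ->
  (forall e N, 0 < e -> (0 < N)%N ->
    let D := C * h N + (g N + C * h N) * (1 + e^-1) + e * x N in
    `|u N - L| <= e + (g N + C * h N) / e +
      (2 * (C * h N) + (4 * e + e ^+ 2 + (e `^ dlt)^-1 * f N) * (x N + D)
       + 4 * ((e `^ dlt)^-1 * f N)) + (D + `|x N - sigma2|)) ->
  u @ \oo --> L.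
Proof.
move=> s0 hh hg hf hx hu; apply/cvgrPdist_le => eps eps0.
(* For e <= 1 the limit of the bound is at most e + 5 e * 2 sigma2 + e sigma2 = e (1 + 11
   sigma2). *)
have k0 : 0 < 2 * (1 + 11 * sigma2) by lra.
pose e := Num.min 1 (eps / (2 * (1 + 11 * sigma2))).
have e0 : 0 < e by rewrite lt_min ltr01/= divr_gt0.
have e1 : e <= 1 by rewrite ge_min lexx.
have e2 : e * (1 + 11 * sigma2) <= eps / 2.
  have : e <= eps / (2 * (1 + 11 * sigma2)) by rewrite ge_min lexx orbT.
  by rewrite ler_pdivlMr// => he; lra.
pose D N := C * h N + (g N + C * h N) * (1 + e^-1) + e * x N.
pose k := (e `^ dlt)^-1.
have hc (z : R) : (fun=> z) @ \oo --> z by exact: cvg_cst.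
have hCh : (fun N => C * h N) @ \oo --> (C * 0 : R) by apply: cvgM.
have hkf : (fun N => k * f N) @ \oo --> (k * 0 : R) by apply: cvgM.
have hrho : (fun N => g N + C * h N) @ \oo --> (0 + C * 0 : R) by apply: cvgD.
have hD : D @ \oo --> (C * 0 + (0 + C * 0) * (1 + e^-1) + e * sigma2 : R).
  by apply: cvgD; [apply: cvgD => //; apply: cvgM|apply: cvgM].
pose Bd N := e + (g N + C * h N) * e^-1 +
      (2 * (C * h N) + (4 * e + e ^+ 2 + k * f N) * (x N + D N)
       + 4 * (k * f N)) + (D N + `|x N - sigma2|).
have hB : Bd @ \oo --> (e + (0 + C * 0) * e^-1 +
    (2 * (C * 0) + (4 * e + e ^+ 2 + k * 0) *
      (sigma2 + (C * 0 + (0 + C * 0) * (1 + e^-1) + e * sigma2)) + 4 * (k * 0)) +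
    ((C * 0 + (0 + C * 0) * (1 + e^-1) + e * sigma2) + `|sigma2 - sigma2|) : R).
  apply: cvgD; last first.
    by apply: (cvgD hD); apply: cvg_norm; apply: cvgB.
  apply: cvgD; first by apply: cvgD => //; apply: cvgM.
  apply: cvgD; last by apply: cvgM.
  apply: cvgD; first by apply: cvgM.
  by apply: cvgM; apply: cvgD.
set v := (X in _ --> X) in hB.
have hv : v <= eps / 2.
  rewrite /v subrr normr0 !mulr0 !addr0 !mul0r !add0r !addr0.
  have : e ^+ 2 <= e by rewrite expr2 ler_piMr// ltW.
  have : e * sigma2 <= sigma2 by rewrite ler_piMl.
  have es : 0 <= e * sigma2 by rewrite mulr_ge0// ltW.
  move=> h1 h2.
  have : (4 * e + e ^+ 2) * (sigma2 + e * sigma2) <= (5 * e) * (2 * sigma2).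
    by apply: ler_pM; rewrite ?addr_ge0// ?sqr_ge0//; lra.
  lra.
have /cvgrPdist_lt /(_ (eps / 2)) := hB.
rewrite divr_gt0// => /(_ isT) hB'.
near=> N.
have N0 : (0 < N)%N by near: N; exact: nbhs_infty_gt.
rewrite distrC; apply: (le_trans (hu e N e0 N0)).
rewrite -/(D N) -/k -/(Bd N).
have : `|v - Bd N| < eps / 2 by near: N.
by rewrite ltr_norml => /andP[? ?]; lra.
Unshelve. all: by end_near. Qed.

End limit_bound.

Section quenched_clt.
Context d (Om : measurableType d) (R : realType) (P : probability Om R).
Local Notation E := (mean P).
Variables (W : nat -> Om -> R) (v : nat -> R) (kappa : nat -> R) (C dlt : R).
Hypotheses (W2 : forall i, sqint P (W i)) (W0 : forall i, E (W i) = 0)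
  (Wq : forall i, integ P (fun w => `|W i w| `^ (2 + dlt)))
  (v0 : forall i, 0 <= v i) (C0 : 0 <= C) (dlt0 : 0 < dlt)
  (kappa0 : forall r, 0 <= kappa r)
  (kappa_noninc : forall r s, (r <= s)%N -> kappa s <= kappa r).
Hypothesis Wcov : forall i j, i != j ->
  `|E (fun w => W i w * W j w)| <= C * v i * v j * kappa (gap i j).
(** One coefficient sequence serves both groups: its zeros will cut out the gaps and the indices
    from N on, and its bound 1 / sqrt N turns [al ^+ 2] into 1 / N. *)
Hypothesis Wdec : forall (a : nat -> R) (al : R) (A B L r : nat) (x y : R),
  (forall i, `|a i| <= al) -> (A + r <= B)%N ->
  let F w := cos (\sum_(i < A) a i * W i w + x) in
  let G w := cos (\sum_(i < L) a (B + i)%N * W (B + i)%N w + y) in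
  `|E (fun w => F w * G w) - E F * E G| <=
  al ^+ 2 * C * (\sum_(i < A) v i) * (\sum_(i < L) v (B + i)%N) * kappa r.

Lemma mean_sqr_lincomb n (a : nat -> R) :
  E (fun w => (\sum_(i < n) a i * W i w) ^+ 2) =
  \sum_(i < n) \sum_(j < n) a i * a j * E (fun w => W i w * W j w).
Proof.
rewrite (mean_sqr_sum _ (F := fun i w => a i * W i w)); last first.
  by move=> i; exact: sqintZ.
apply: eq_bigr => i _; apply: eq_bigr => j _.
rewrite -meanZ; last exact: sqint_mul.
by apply: eq_mean => w; rewrite mulrACA.
Qed.

Lemma sqint_lincomb n (a : nat -> R) : sqint P (fun w => \sum_(i < n) a i * W i w).
Proof. by apply: sqint_sum => i; exact: sqintZ. Qed.

Section single_size.
Variables (N b q T : nat).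
Let c := (b + q)%N.
Hypotheses (N0 : (0 < N)%N) (c0 : (0 < c)%N).
(** The number of periods is rounded up, so that N < n; the coefficients [ab] and [asm] vanish from
    N on. The larger bound [T] is meant to be shared by all N of one scale. *)
Let K := (N %/ c).+1.
Let n := (K * c)%N.
Hypothesis nT : (n <= T)%N.
Let rN := (Num.sqrt N%:R : R)^-1.

Let Nn : (N < n)%N.
Proof. by rewrite /n /K mulSn {1}(divn_eq N c) addnC ltn_add2r ltn_mod. Qed.

Let rN0 : 0 <= rN. Proof. by rewrite invr_ge0 sqrtr_ge0. Qed.

Let rN2 : rN ^+ 2 = N%:R^-1.
Proof. by rewrite exprVn sqr_sqrtr. Qed.

(** Selects the gaps, which close each period of length b + q. *)
Definition small (i : nat) : bool := (b <= i %% (b + q))%N.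
Let ab (i : nat) : R := if (i < N)%N && ~~ small i then rN else 0.
Let asm (i : nat) : R := if (i < N)%N && small i then rN else 0.
Let X w := rN * \sum_(i < N) W i w.
Let S w := \sum_(i < n) ab i * W i w.
Let Rm w := \sum_(i < n) asm i * W i w.

Let X_split w : X w = S w + Rm w.
Proof.
rewrite /X /S /Rm -big_split/= (big_ord_widen n (fun i => W i w) (ltnW Nn)).
rewrite big_mkcond big_distrr; apply: eq_bigr => i _/=.
rewrite -mulrDl /ab /asm; case: ifP => _ /=; last by rewrite addr0 mulr0 mul0r.
by case: (small i) => /=; rewrite ?add0r ?addr0.
Qed.

Let ab_le i : `|ab i| <= rN.
Proof. by rewrite /ab; case: ifP => _; rewrite ?normr0// ger0_norm. Qed.

(* [hsum], [gsum] and [fsum], suitably normalized, control respectively the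
   covariances, the variance of the gaps and the Lindeberg remainders. *)
Definition hsum := \sum_(i < T) \sum_(j < T | j != i :> nat)
  (kappa q + (if small i then kappa (gap i j) else 0)) * v i * v j.
Definition gsum := \sum_(i < T | small i) E (fun w => W i w ^+ 2).
Definition fsum := c%:R `^ (1 + dlt) * \sum_(i < T) E (fun w => `|W i w| `^ (2 + dlt)).

Let h := N%:R^-1 * hsum.
Let g := N%:R^-1 * gsum.
Let f := (rN `^ (2 + dlt)) * fsum.
Let rho := g + C * h.

Let iN0 : 0 <= N%:R^-1 :> R. Proof. by rewrite invr_ge0. Qed.

Lemma widen_sum_le (F G : nat -> R) : (forall i, (i < n)%N -> F i <= G i) ->
  (forall i, 0 <= G i) -> \sum_(i < n) F i <= \sum_(i < T) G i.
Proof.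
move=> FG G0; apply: (@le_trans _ _ (\sum_(i < n) G i)).
  by apply: ler_sum => i _; exact: FG.
rewrite (big_ord_widen T G nT) big_mkcond.
by apply: ler_sum => i _; case: ifP.
Qed.

Lemma offdiag_le (F : nat -> nat -> R) (G : nat -> nat -> R) :
  (forall i j, 0 <= G i j) ->
  (forall i j, (i < n)%N -> (j < n)%N -> F i j <= if j != i then G i j else 0) ->
  \sum_(i < n) \sum_(j < n) F i j <= \sum_(i < T) \sum_(j < T | j != i :> nat) G i j.
Proof.
move=> G0 FG.
apply: (widen_sum_le (F := fun i => \sum_(j < n) F i j)
   (G := fun i => \sum_(j < T | j != i :> nat) G i j)) => [i iN|i]; last first.
  exact: sumr_ge0.
rewrite [leRHS]big_mkcond.
apply: (widen_sum_le (F := F i) (G := fun j => if j != i then G i j else 0)) => j //.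
  exact: FG.
by case: ifP.
Qed.

Let G2 i j := (kappa q + (if small i then kappa (gap i j) else 0)) * v i * v j.

Let G20 i j : 0 <= G2 i j.
Proof. by rewrite !mulr_ge0// addr_ge0//; case: ifP. Qed.

Lemma hsum_ge0 : 0 <= hsum.
Proof. by do 2 apply: sumr_ge0 => ? _; exact: G20. Qed.

(** The diagonal terms are the variances over the gaps, collected in [g]; the others are bounded by
    the terms of [hsum] with kappa (gap i j), present precisely when i lies in a gap. *)
Let mean_Rm : E (fun w => Rm w ^+ 2) <= rho.
Proof.
rewrite mean_sqr_lincomb.
have -> : \sum_(i < n) \sum_(j < n) asm i * asm j * E (fun w => W i w * W j w) =
  \sum_(i < n) asm i ^+ 2 * E (fun w => W i w ^+ 2) + \sum_(i < n) \sum_(j < n)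
    (if j != i :> nat then asm i * asm j * E (fun w => W i w * W j w) else 0).
  rewrite -big_split/=; apply: eq_bigr => i _.
  rewrite (bigD1 i)//= -expr2; congr (_ + _).
  rewrite [RHS](bigD1 i)//= eqxx add0r; apply: eq_bigr => j ji.
  by rewrite ifT.
apply: lerD.
  rewrite /g /gsum big_distrr/= [leRHS]big_mkcond.
  apply: (widen_sum_le (F := fun i => asm i ^+ 2 * E (fun w => W i w ^+ 2))
    (G := fun i => if small i then N%:R^-1 * E (fun w => W i w ^+ 2) else 0)).
    have W20 k : 0 <= E (fun w => W k w ^+ 2) by exact: mean_sqr_ge0.
    move=> i _; rewrite /asm; case: (small i) => /=; last by rewrite andbF expr0n mul0r.
    rewrite andbT; case: ifP => _; first by rewrite rN2.
    by rewrite expr0n mul0r mulr_ge0.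
  move=> i; case: ifP => // _; rewrite mulr_ge0//.
  by exact: mean_sqr_ge0.
have -> : C * h = \sum_(i < T) \sum_(j < T | j != i :> nat) (C / N%:R * G2 i j).
  rewrite /h /hsum mulrA big_distrr; apply: eq_bigr => i _.
  by rewrite big_distrr.
apply: (offdiag_le (F := fun i j => if j != i then
  asm i * asm j * E (fun w => W i w * W j w) else 0) (G := fun i j => C / N%:R * G2 i j)).
  by move=> i j; rewrite mulr_ge0// mulr_ge0.
move=> i j _ _; case: ifPn => // ji.
have hij : `|E (fun w => W i w * W j w)| <= C * v i * v j * kappa (gap i j).
  by apply: Wcov; rewrite eq_sym.
have G0 : 0 <= C / N%:R * G2 i j by rewrite mulr_ge0// mulr_ge0.
rewrite {1}/asm; case: ifPn => [/andP[_ si]|_]; last by rewrite !mul0r.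
have [sj|] := boolP ((j < N)%N && small j); last first.
  by rewrite /asm => /negbTE ->; rewrite mulr0 mul0r.
rewrite /asm sj -expr2 rN2 /G2 si mulrC.
apply: (@le_trans _ _ (C * v i * v j * kappa (gap i j) * N%:R^-1)).
  by rewrite ler_wpM2r// (le_trans _ hij)// ler_norm.
rewrite -subr_ge0.
have -> : C / N%:R * ((kappa q + kappa (gap i j)) * v i * v j) -
  C * v i * v j * kappa (gap i j) / N%:R = C / N%:R * (kappa q * v i * v j) by ring.
by rewrite mulr_ge0 ?mulr_ge0.
Qed.

(** The sum runs over a whole period, but the coefficients vanish on the gap, so that only the big
    block contributes. *)
Let U (k : nat) w := \sum_(i < c) ab (k * c + i)%N * W (k * c + i)%N w.
Let sg k := E (fun w => U k w ^+ 2).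

Let S_U w k : \sum_(i < k * c) ab i * W i w = \sum_(j < k) U j w.
Proof. exact: (sum_blocks (fun i => ab i * W i w)). Qed.

Let mean_U2 k : sg k = \sum_(i < c) \sum_(j < c)
  ab (k * c + i)%N * ab (k * c + j)%N * E (fun w => W (k * c + i)%N w * W (k * c + j)%N w).
Proof.
rewrite /sg /U (mean_sqr_sum _ (F := fun i w => ab (k * c + i)%N * W (k * c + i)%N w)); last first.
  by move=> i; exact: sqintZ.
apply: eq_bigr => i _; apply: eq_bigr => j _.
rewrite -meanZ; last exact: sqint_mul.
by apply: eq_mean => w; rewrite mulrACA.
Qed.

Let blockE k (i : 'I_c) : ((k * c + i) %/ c = k)%N.
Proof. by rewrite divnMDl// divn_small// addn0. Qed.

Let sum_sg : \sum_(k < K) sg k = \sum_(i < n) \sum_(j < n)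
   (if (i %/ c == j %/ c)%N then ab i * ab j * E (fun w => W i w * W j w) else 0).
Proof.
rewrite (sum_blocks (fun i => \sum_(j < n)
   (if (i %/ c == j %/ c)%N then ab i * ab j * E (fun w => W i w * W j w) else 0))).
apply: eq_bigr => k _; rewrite mean_U2; apply: eq_bigr => i _; rewrite blockE.
rewrite (sum_blocks (fun j => (if ((k : nat) == j %/ c)%N then
  ab (k * c + i)%N * ab j * E (fun w => W (k * c + i)%N w * W j w) else 0))).
rewrite [RHS](bigD1 k)//= [X in _ + X]big1 ?addr0; last first.
  move=> l lk; apply: big1 => j _; rewrite blockE ifF//.
  by apply/negbTE; rewrite eq_sym.
by apply: eq_bigr => j _; rewrite blockE eqxx.
Qed.

(** Only pairs in different big blocks distinguish the two sides, and [hsum] covers them through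
    kappa (q). *)
Let mean_S : `|\sum_(k < K) sg k - E (fun w => S w ^+ 2)| <= C * h.
Proof.
rewrite sum_sg /S mean_sqr_lincomb -sumrB.
apply: (le_trans (ler_norm_sum _ _ _)).
have -> : C * h = \sum_(i < T) \sum_(j < T | j != i :> nat) (C / N%:R * G2 i j).
  rewrite /h /hsum mulrA big_distrr; apply: eq_bigr => i _.
  by rewrite big_distrr.
apply: (@le_trans _ _ (\sum_(i < n) \sum_(j < n) `|
   (if (i %/ c == j %/ c)%N then 0 else ab i * ab j * E (fun w => W i w * W j w))|)).
  apply: ler_sum => i _; rewrite -sumrB; apply: (le_trans (ler_norm_sum _ _ _)).
  apply: ler_sum => j _; case: ifP => _; first by rewrite subrr normr0.
  by rewrite sub0r normrN.
apply: (offdiag_le (F := fun i j => `|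
   (if (i %/ c == j %/ c)%N then 0 else ab i * ab j * E (fun w => W i w * W j w))|)
   (G := fun i j => C / N%:R * G2 i j)).
  by move=> i j; rewrite mulr_ge0// mulr_ge0.
move=> i j _ _.
have [ij|ij] := eqVneq (i %/ c)%N (j %/ c)%N.
  by rewrite normr0; case: ifP => // _; rewrite mulr_ge0// mulr_ge0.
rewrite ifT; last by apply: contra ij => /eqP ->.
have G0 : 0 <= C / N%:R * G2 i j by rewrite mulr_ge0// mulr_ge0.
rewrite !normrM {1}/ab; case: ifPn => [/andP[_ si]|_]; last by rewrite normr0 !mul0r.
have [/andP[jN sj]|] := boolP ((j < N)%N && ~~ small j); last first.
  by rewrite /ab => /negbTE ->; rewrite normr0 mulr0 mul0r.
rewrite /ab jN sj/= (ger0_norm rN0) -expr2 rN2 mulrC.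
(* A whole gap lies between two distinct big blocks, so [gap i j] is at least q. *)
have hij : `|E (fun w => W i w * W j w)| <= C * v i * v j * kappa q.
  apply: (le_trans (Wcov _)); first by apply: contra ij => /eqP ->.
  rewrite ler_wpM2l ?mulr_ge0// kappa_noninc//.
  move: si sj ij; rewrite /small -!ltnNge => si sj ij.
  have ei := divn_eq i c; have ej := divn_eq j c; rewrite /gap.
  have hs : (b + q = c)%N by [].
  rewrite hs in si sj.
  move: ij; rewrite neq_ltn => /orP[] ij.
    have : ((i %/ c).+1 * c <= j %/ c * c)%N by rewrite leq_mul2r ij orbT.
    rewrite mulSn; lia.
  have : ((j %/ c).+1 * c <= i %/ c * c)%N by rewrite leq_mul2r ij orbT.
  rewrite mulSn; lia.
apply: (@le_trans _ _ (C * v i * v j * kappa q * N%:R^-1)); first by rewrite ler_wpM2r.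
rewrite -subr_ge0 /G2; set e := (if _ then _ else _).
have e0 : 0 <= e by rewrite /e; case: ifP.
have -> : C / N%:R * ((kappa q + e) * v i * v j) -
  C * v i * v j * kappa q / N%:R = C / N%:R * (e * v i * v j) by ring.
by rewrite mulr_ge0 ?mulr_ge0.
Qed.

Let U2 k : sqint P (U k).
Proof. by apply: sqint_sum => i; exact: sqintZ. Qed.

Let U0 k : E (U k) = 0.
Proof.
rewrite /U mean_sum; last by move=> i; apply/integZ/sqint_integ.
by apply: big1 => i _; rewrite meanZ ?W0 ?mulr0//; exact: sqint_integ.
Qed.

(** The power mean inequality over the c indices of the period costs c^(1 + dlt); this factor is
    what limits the block length. *)
Let Upow_le k w : `|U k w| `^ (2 + dlt) <=
  c%:R `^ (1 + dlt) * (rN `^ (2 + dlt) * \sum_(i < c) `|W (k * c + i)%N w| `^ (2 + dlt)).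
Proof.
have q1 : 1 < 2 + dlt by move: dlt0; lra.
apply: (@le_trans _ _ ((\sum_(i < c) rN * `|W (k * c + i)%N w|) `^ (2 + dlt))).
  apply: ge0_ler_powR.
  - by move: dlt0; lra.
  - by rewrite nnegrE.
  - by rewrite nnegrE sumr_ge0// => i _; rewrite mulr_ge0.
  apply: (le_trans (ler_norm_sum _ _ _)); apply: ler_sum => i _.
  by rewrite normrM ler_wpM2r.
apply: (le_trans (powR_sum_le q1 _)); first by move=> i; rewrite mulr_ge0.
have -> : 2 + dlt - 1 = 1 + dlt by ring.
rewrite ler_wpM2l ?powR_ge0// big_distrr/=; apply: ler_sum => i _.
by rewrite powRM.
Qed.

Let Uq k : integ P (fun w => `|U k w| `^ (2 + dlt)).
Proof.
apply: (le_integ (g := fun w => c%:R `^ (1 + dlt) * (rN `^ (2 + dlt) *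
  \sum_(i < c) `|W (k * c + i)%N w| `^ (2 + dlt)))).
- by apply: measurable_norm_powR; case: (U2 k).
- by apply/integZ/integZ/integ_sum.
- by move=> w; rewrite ger0_norm ?powR_ge0.
Qed.

Let mom_U : \sum_(k < K) E (fun w => `|U k w| `^ (2 + dlt)) <= f.
Proof.
pose m i := E (fun w => `|W i w| `^ (2 + dlt)).
have m0 i : 0 <= m i by exact: mean_powR_ge0.
apply: (@le_trans _ _ (\sum_(k < K) c%:R `^ (1 + dlt) *
   (rN `^ (2 + dlt) * \sum_(i < c) m (k * c + i)%N))).
  apply: ler_sum => k _; rewrite -mean_sum; last by [].
  rewrite -meanZ; last exact: integ_sum.
  rewrite -meanZ; last by apply/integZ/integ_sum.
  by apply: le_mean; [exact: Uq|apply/integZ/integZ/integ_sum|exact: Upow_le].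
rewrite -!big_distrr/= -(sum_blocks m) mulrCA ler_wpM2l ?powR_ge0//.
rewrite ler_wpM2l ?powR_ge0//.
by apply: (widen_sum_le (F := m) (G := m)).
Qed.

Let vprod k := (\sum_(i < k * c) v i) * (\sum_(i < c) v (k * c + i)%N).

(** The last q indices before k * c form the gap preceding block k, where the coefficients are 0;
    dropping them puts the past at the distance q from block k required in [Wdec]. *)
Let ab_gap k w : (0 < k)%N ->
  \sum_(i < k * c - q) ab i * W i w = \sum_(i < k * c) ab i * W i w.
Proof.
move=> k0; rewrite (big_ord_widen (k * c) (fun i => ab i * W i w) (leq_subr q _)).
rewrite big_mkcond; apply: eq_bigr => i _; case: ifPn => //.
rewrite -leqNgt => hi; rewrite /ab; case: ifPn => [/andP[_]|]; last by rewrite mul0r.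
rewrite /small -ltnNge => hm; exfalso.
have e := divn_eq i c; have ik : (i %/ c < k)%N by rewrite ltn_divLR.
have : ((i %/ c).+1 * c <= k * c)%N by rewrite leq_mul2r ik orbT.
rewrite mulSn; move: hm; rewrite -/c => hm.
have hc : c = (b + q)%N by []. lia.
Qed.

Let v_range k : (0 < k)%N -> \sum_(i < k * c - q) v i <= \sum_(i < k * c) v i.
Proof.
move=> k0; rewrite (big_ord_widen (k * c) v (leq_subr q _)).
by rewrite big_mkcond; apply: ler_sum => i _; case: ifP.
Qed.

Let decoupling k (x y : R) :
  `|E (fun w => cos (\sum_(j < k) U j w + x) * cos (U k w + y)) -
    E (fun w => cos (\sum_(j < k) U j w + x)) * E (fun w => cos (U k w + y))| <=
  N%:R^-1 * C * kappa q * vprod k.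
Proof.
have mUk : measurable_fun setT (U k) by case: (U2 k).
(* The first block has no gap before it: for k = 0 truncated subtraction would break [kq], but the
   sum over the past is empty. *)
have [->|k0] := posnP k.
  have -> : E (fun w => cos (\sum_(j < 0) U j w + x) * cos (U 0%N w + y)) =
      E (fun w => cos (\sum_(j < 0) U j w + x)) * E (fun w => cos (U 0%N w + y)).
    rewrite (eq_mean P (f := fun w => cos (\sum_(j < 0) U j w + x)) (g := fun=> cos x)); last by move=> w; rewrite big_ord0 add0r.
    rewrite mean_cst -meanZ; last by apply: integ_cos_shift; case: (U2 0%N).
    by apply: eq_mean => w; rewrite big_ord0 add0r.
  by rewrite subrr normr0 /vprod mul0n big_ord0 mul0r mulr0.
have kq : (k * c - q + q <= k * c)%N.
  rewrite subnK// (leq_trans (leq_addl b q))//.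
  by rewrite -[(b + q)%N]mul1n leq_mul2r k0 orbT.
have := Wdec c x y ab_le kq => /=.
have e1 w : \sum_(i < k * c - q) ab i * W i w = \sum_(j < k) U j w.
  by rewrite ab_gap// S_U.
rewrite (eq_mean P (g := fun w => cos (\sum_(j < k) U j w + x) * cos (U k w + y))); last first.
  by move=> w; rewrite e1.
rewrite (eq_mean P (f := fun w => cos (\sum_(i < k * c - q) ab i * W i w + x))
   (g := fun w => cos (\sum_(j < k) U j w + x))); last first.
  by move=> w; rewrite e1.
move=> /le_trans; apply; rewrite rN2 /vprod.
rewrite [leRHS](_ : _ = N%:R^-1 * C * ((\sum_(i < k * c) v i) *
  (\sum_(i < c) v (k * c + i)%N)) * kappa q); last by ring.
rewrite ler_wpM2r// -!mulrA ler_wpM2l// ler_wpM2l// ler_wpM2r ?v_range//.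
exact: sumr_ge0.
Qed.

(** Each pair of an index and an index of an earlier period is counted once, with weight kappa (q),
    so the total is dominated by [hsum]. *)
Let sum_vprod : \sum_(k < K) N%:R^-1 * C * kappa q * vprod k <= C * h.
Proof.
rewrite -big_distrr/= /h mulrA [C * _]mulrC -!mulrA ler_wpM2l// ler_wpM2l//.
rewrite /vprod.
have -> : \sum_(k < K) (\sum_(i < k * c) v i) * (\sum_(i < c) v (k * c + i)%N) =
   \sum_(j < n) v j * \sum_(i < (j %/ c) * c) v i.
  rewrite (sum_blocks (fun j => v j * \sum_(i < (j %/ c) * c) v i)).
  apply: eq_bigr => k _; rewrite mulrC big_distrl/=.
  by apply: eq_bigr => i _; rewrite blockE.
rewrite big_distrr/=.
apply: (@le_trans _ _ (\sum_(j < n) \sum_(i < n)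
    (if (i < j %/ c * c)%N then kappa q * v j * v i else 0))).
  apply: ler_sum => j _; rewrite mulrA big_distrr/=.
  have hj : (j %/ c * c <= n)%N by apply: (leq_trans (leq_divM _ _)); exact: ltnW.
  by rewrite (big_ord_widen n (fun i => kappa q * v j * v i) hj) big_mkcond.
apply: (offdiag_le (F := fun j i =>
    (if (i < j %/ c * c)%N then kappa q * v j * v i else 0)) (G := G2)) => //.
move=> j i _ _; case: ifPn => [ij|_]; last by case: ifP.
rewrite ifT; last first.
  by rewrite neq_ltn (leq_trans ij (leq_divM _ _)).
by rewrite /G2 ler_wpM2r// ler_wpM2r// lerDl; case: ifP.
Qed.

Lemma mean_X_sqr : sqint P X.
Proof. by apply/sqintZ/sqint_sum. Qed.

Let x2 := E (fun w => X w ^+ 2).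
Let Q := \sum_(k < K) sg k.

(** From S = X - Rm follows S^2 - X^2 = Rm^2 - 2 X Rm; the cross term is split into e X^2 + Rm^2 /
    e, so that only second moments occur. *)
Let mean_SX e : 0 < e ->
  `|E (fun w => S w ^+ 2) - x2| <= rho * (1 + e^-1) + e * x2.
Proof.
move=> e0; have R2 : sqint P Rm by exact: sqint_lincomb.
have X2 := mean_X_sqr.
have X2i : integ P (fun w => X w ^+ 2) by case: X2.
have R2i : integ P (fun w => Rm w ^+ 2) by case: R2.
apply: (@le_trans _ _ (E (fun w => (1 + e^-1) * Rm w ^+ 2 + e * X w ^+ 2))).
  apply: norm_meanB_le => //.
  - by case: (sqint_lincomb n ab).
  - by apply: integD; exact: integZ.
  move=> w; have -> : S w = X w - Rm w by rewrite X_split addrK.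
  set x := X w; set r := Rm w.
  have -> : (x - r) ^+ 2 - x ^+ 2 = r ^+ 2 - 2 * x * r by ring.
  apply: (le_trans (ler_normB _ _)); rewrite ger0_norm ?sqr_ge0//.
  have -> : (1 + e^-1) * r ^+ 2 + e * x ^+ 2 =
    r ^+ 2 + (e^-1 * r ^+ 2 + e * x ^+ 2) by ring.
  rewrite lerD2l.
  have h1 : 0 <= (r + e * x) ^+ 2 / e by rewrite divr_ge0 ?sqr_ge0// ltW.
  have h2 : 0 <= (r - e * x) ^+ 2 / e by rewrite divr_ge0 ?sqr_ge0// ltW.
  have e1 : (r + e * x) ^+ 2 / e = e^-1 * r ^+ 2 + e * x ^+ 2 + 2 * x * r.
    by field; rewrite gt_eqF.
  have e2 : (r - e * x) ^+ 2 / e = e^-1 * r ^+ 2 + e * x ^+ 2 - 2 * x * r.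
    by field; rewrite gt_eqF.
  by rewrite ler_norml; apply/andP; split; lra.
rewrite meanD; [|exact: integZ..].
rewrite !meanZ// lerD2r [leRHS]mulrC ler_wpM2l//.
by rewrite addr_ge0// invr_ge0 ltW.
Qed.

(** Three comparisons: [X] with the big blocks [S], the cosine mean of [S] with its Gaussian value
    for the summed block variances [Q], and [Q] with [sigma2]. The second moment [x2] is kept in the
    bound because its limit is known. *)
Lemma single_size_bound e th sigma2 : 0 < e -> 0 <= sigma2 ->
  let D := C * h + rho * (1 + e^-1) + e * x2 in
  `|E (fun w => cos (X w + th)) - expR (- (sigma2 / 2)) * cos th| <=
  e + rho / e + (2 * (C * h) + (4 * e + e ^+ 2 + (e `^ dlt)^-1 * f) * (x2 + D)
     + 4 * ((e `^ dlt)^-1 * f)) + (D + `|x2 - sigma2|).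
Proof.
move=> e0 s0; cbv zeta; set D := C * h + _ + e * x2.
have R2 : sqint P Rm by exact: sqint_lincomb.
have mX : measurable_fun setT X by case: mean_X_sqr.
have mS : measurable_fun setT S by case: (sqint_lincomb n ab).
have hcov : Q - x2 <= D /\ x2 - Q <= D.
  have := mean_SX e0; have := mean_S; rewrite -/Q !ler_norml /D.
  by move=> /andP[? ?] /andP[? ?]; lra.
have Q0 : 0 <= Q by apply: sumr_ge0 => k _; exact: mean_sqr_ge0.
have f0 : 0 <= f.
  rewrite mulr_ge0 ?powR_ge0// mulr_ge0 ?powR_ge0// sumr_ge0// => i _.
  by exact: mean_powR_ge0.
have ef0 : 0 <= (e `^ dlt)^-1 * f by rewrite mulr_ge0// invr_ge0 powR_ge0.
have step1 : `|E (fun w => cos (X w + th)) - E (fun w => cos (S w + th))| <= e + rho / e.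
  apply: (@le_trans _ _ (E (fun w => `|Rm w|))).
    apply: norm_meanB_le.
    - exact: integ_cos_shift.
    - exact: integ_cos_shift.
    - by apply/integ_norm/sqint_integ.
    move=> w; rewrite X_split [S w + _ + th]addrAC.
    exact: cos_lip.
  apply: (le_trans (mean_norm_le_sqr R2 e0)).
  by rewrite lerD2l mulrC ler_wpM2r// invr_ge0 ltW.
have step2 : `|E (fun w => cos (S w + th)) - expR (- (Q / 2)) * cos th| <=
    2 * (C * h) + (4 * e + e ^+ 2 + (e `^ dlt)^-1 * f) * Q + 4 * ((e `^ dlt)^-1 * f).
  have := mean_cos_block_sum U2 U0 Uq e0 dlt0 decoupling K th.
  cbv zeta; rewrite (eq_mean P (g := fun w => cos (S w + th))); last first.
    by move=> w; rewrite /S S_U.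
  rewrite -/Q => /le_trans; apply.
  (* One factor [sg k] is bounded by the small quantity e^2 + e^(-dlt) f, by splitting [U k] at
     level e; the other is kept and will be summed to [Q]. *)
  have sg4 k : (k < K)%N -> sg k ^+ 2 / 4 <= (e ^+ 2 + (e `^ dlt)^-1 * f) * sg k.
    move=> kK; have g0 : 0 <= sg k by exact: mean_sqr_ge0.
    have hs : sg k <= e ^+ 2 + (e `^ dlt)^-1 * f.
      apply: (@le_trans _ _ (e ^+ 2 + (e `^ dlt)^-1 * E (fun w => `|U k w| `^ (2 + dlt)))).
        rewrite -[X in _ <= X + _](mean_cst P) -meanZ; last exact: Uq.
        rewrite -meanD; [|exact: integ_cst|exact: integZ].
        apply: le_mean; first by case: (U2 k).
        - by apply: integD; [exact: integ_cst|exact: integZ].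
        - by move=> w; exact: sqr_le_powR.
      rewrite lerD2l ler_wpM2l ?invr_ge0 ?powR_ge0//.
      apply: le_trans mom_U; rewrite (bigD1 (Ordinal kK))//= lerDl.
      by apply: sumr_ge0 => j _; exact: mean_powR_ge0.
    have : sg k ^+ 2 <= (e ^+ 2 + (e `^ dlt)^-1 * f) * sg k by rewrite expr2 ler_wpM2r.
    by have := sqr_ge0 (sg k); lra.
  apply: (@le_trans _ _ (\sum_(k < K) (2 * (N%:R^-1 * C * kappa q * vprod k) +
     ((4 * e + e ^+ 2 + (e `^ dlt)^-1 * f) * sg k +
      4 * (e `^ dlt)^-1 * E (fun w => `|U k w| `^ (2 + dlt)))))).
    apply: ler_sum => k _; rewrite lerD2l.
    have := sg4 k (ltn_ord k); rewrite -/(sg k); lra.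
  rewrite !big_split/= -[leRHS]addrA; apply: lerD.
    by rewrite -mulr_sumr ler_wpM2l.
  apply: lerD; first by rewrite -mulr_sumr.
  rewrite -mulr_sumr mulrA ler_wpM2l// mulr_ge0// invr_ge0 powR_ge0//.
have step3 : `|expR (- (Q / 2)) * cos th - expR (- (sigma2 / 2)) * cos th| <=
    D + `|x2 - sigma2|.
  rewrite -mulrBl normrM; apply: (@le_trans _ _ `|Q - sigma2|).
    apply: (le_trans (ler_piMr _ (cos_max th))) => //.
    exact: expRN_lip.
  have := ler_normD (Q - x2) (x2 - sigma2).
  have : `|Q - x2| <= D by rewrite ler_norml; case: hcov => *; apply/andP; split; lra.
  have -> : Q - x2 + (x2 - sigma2) = Q - sigma2 by ring.
  lra.
have hQ : (4 * e + e ^+ 2 + (e `^ dlt)^-1 * f) * Q <=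
    (4 * e + e ^+ 2 + (e `^ dlt)^-1 * f) * (x2 + D).
  rewrite ler_wpM2l//; last by lra.
  by rewrite addr_ge0// addr_ge0 ?sqr_ge0// mulr_ge0// ltW.
set x := E _ in step1 *; set y := E _ in step1 step2.
have -> : x - expR (- (sigma2 / 2)) * cos th =
  (x - y) + (y - expR (- (Q / 2)) * cos th) +
  (expR (- (Q / 2)) * cos th - expR (- (sigma2 / 2)) * cos th) by ring.
apply: (le_trans (ler_normD _ _)); apply: lerD => //.
apply: (le_trans (ler_normD _ _)); apply: lerD => //.
apply: (le_trans step2); lra.
Qed.

End single_size.

(* The block sizes are constant on each range of N with the same scale lv N,
   so that the index sets involved do not depend on N within a range. *)
Lemma mean_cos_cvg (M b q T lv : nat -> nat)
    (M0 : forall l, (0 < M l)%N)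
    (bq : forall l, (0 < b l + q l)%N)
    (lvM : forall N, (0 < N)%N -> (M (lv N) <= N)%N)
    (lvT : forall N, (0 < N)%N -> (N + (b (lv N) + q (lv N)) <= T (lv N))%N)
    (lv_oo : lv @ \oo --> \oo)
    (hH : (fun l => (M l)%:R^-1 * hsum (b l) (q l) (T l)) @ \oo --> (0 : R))
    (hG : (fun l => (M l)%:R^-1 * gsum (b l) (q l) (T l)) @ \oo --> (0 : R))
    (hF : (fun l => ((Num.sqrt (M l)%:R)^-1 `^ (2 + dlt)) *
             fsum (b l) (q l) (T l)) @ \oo --> (0 : R))
    (sigma2 : R) (s0 : 0 <= sigma2)
    (hX : (fun N => E (fun w => ((Num.sqrt N%:R)^-1 * \sum_(i < N) W i w) ^+ 2))
       @ \oo --> sigma2) (th : R) :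
  (fun N => E (fun w => cos ((Num.sqrt N%:R)^-1 * \sum_(i < N) W i w + th))) @ \oo -->
    expR (- (sigma2 / 2)) * cos th.
Proof.
pose bN N := b (lv N); pose qN N := q (lv N); pose TN N := T (lv N).
have hsum0 l : 0 <= hsum (b l) (q l) (T l) by exact: hsum_ge0.
have gsum0 l : 0 <= gsum (b l) (q l) (T l).
  by apply: sumr_ge0 => i _; exact: mean_sqr_ge0.
have fsum0 l : 0 <= fsum (b l) (q l) (T l).
  rewrite mulr_ge0 ?powR_ge0// sumr_ge0// => i _.
  by exact: mean_powR_ge0.
have iM N : (0 < N)%N -> N%:R^-1 <= (M (lv N))%:R^-1 :> R.
  by move=> N0; rewrite lef_pV2 ?posrE ?ltr0n// ler_nat lvM.
have lim (F : nat -> R) : F @ \oo --> (0 : R) -> (fun N => F (lv N)) @ \oo --> (0 : R).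
  by move=> hF'; apply: (@cvg_comp _ _ _ lv F _ _ _ lv_oo hF').
(* The sums depend on N through its scale only, and M (lv N) <= N makes the normalization by [M] the
   larger one. *)
have sq (F G : nat -> R) : (forall N, (0 < N)%N -> 0 <= F N <= G (lv N)) ->
    G @ \oo --> (0 : R) -> F @ \oo --> (0 : R).
  move=> FG /lim hG'; apply: (squeeze_cvgr _ (cvg_cst 0) hG').
  by near=> N; apply: FG; near: N; exact: nbhs_infty_gt.
apply: (@cvg_of_bound _ _ (fun N => N%:R^-1 * hsum (bN N) (qN N) (TN N))
  (fun N => N%:R^-1 * gsum (bN N) (qN N) (TN N))
  (fun N => ((Num.sqrt N%:R)^-1 `^ (2 + dlt)) * fsum (bN N) (qN N) (TN N))
  (fun N => E (fun w => ((Num.sqrt N%:R)^-1 * \sum_(i < N) W i w) ^+ 2)) C _ sigma2 dlt)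
  => //.
- apply: sq hH => N N0; apply/andP; split.
    by apply: mulr_ge0; [rewrite invr_ge0|exact: hsum0].
  by apply: ler_wpM2r; [exact: hsum0|exact: iM].
- apply: sq hG => N N0; apply/andP; split.
    by apply: mulr_ge0; [rewrite invr_ge0|exact: gsum0].
  by apply: ler_wpM2r; [exact: gsum0|exact: iM].
- apply: sq hF => N N0; apply/andP; split.
    by apply: mulr_ge0; [exact: powR_ge0|exact: fsum0].
  apply: ler_wpM2r; first exact: fsum0.
  rewrite ge0_ler_powR ?nnegrE ?invr_ge0 ?sqrtr_ge0//; first by move: dlt0; lra.
  rewrite lef_pV2 ?posrE ?sqrtr_gt0 ?ltr0n//.
  by rewrite ler_sqrt ?ler0n// ler_nat lvM.
move=> e N e0 N0; apply: (single_size_bound N0 (bq (lv N)) _ th e0 s0).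
by apply: leq_trans (lvT N N0); rewrite mulSn [leqLHS]addnC leq_add2r leq_divM.
Unshelve. all: by end_near. Qed.

End quenched_clt.

(** * Consequences of weak dependence *)

Lemma cvgn_sum (R : realType) (I : Type) (r : seq I) (F : I -> nat -> R) (a : I -> R) :
  (forall i, F i @ \oo --> a i) ->
  (fun N => \sum_(i <- r) F i N) @ \oo --> \sum_(i <- r) a i.
Proof.
move=> h; elim: r => [|i r IH].
  by rewrite big_nil; under eq_fun do rewrite big_nil; exact: cvg_cst.
by rewrite big_cons; under eq_fun do rewrite big_cons; exact: cvgD.
Qed.

Section fixed_trajectory.
Context d (Om : measurableType d) (R : realType) (P : probability Om R).
Local Notation E := (mean P).

Lemma covariance_mean (F G : Om -> R) : integ P F -> integ P G ->
  integ P (fun w => F w * G w) ->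
  covariance P F G = (E (fun w => F w * G w) - E F * E G)%:E.
Proof.
move=> iF iG iFG; rewrite covarianceE; try exact/Lfun1_integrable.
by rewrite !expectation_mean.
Qed.

Lemma Lip_ge0 (k : nat) (f : 'rV[R]_k -> R) : 0 <= Lip f.
Proof.
(* For a function that is not Lipschitz, the infimum over the empty set is 0. *)
rewrite /Lip; have [->|/set0P ne] := eqVneq (lipschitz_const f) set0.
  by rewrite inf0.
by apply: lb_le_inf => // x [].
Qed.

Lemma Lip_le (k : nat) (f : 'rV[R]_k -> R) L : lipschitz_const f L -> Lip f <= L.
Proof. by move=> fL; apply: ge_inf => //; exists 0 => x []. Qed.

(** For the l^1 distance the Lipschitz constant of a linear form is its largest coefficient. No
    factor depends on the dimension, which grows with the number of components. *)
Lemma lipschitz_comp_lin (k : nat) (f0 : R -> R) (L K : R) (c : 'I_k -> R) :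
  0 <= L -> 0 <= K -> (forall x y, `|f0 x - f0 y| <= L * `|x - y|) ->
  (forall m, `|c m| <= K) ->
  lipschitz_const (fun z : 'rV[R]_k => f0 (\sum_m c m * z ord0 m)) (L * K).
Proof.
move=> L0 K0 fL cK; split=> [|z z']; first exact: mulr_ge0.
apply: (le_trans (fL _ _)); rewrite -mulrA ler_wpM2l// -sumrB.
apply: (le_trans (ler_norm_sum _ _ _)); rewrite big_distrr/=.
by apply: ler_sum => m _; rewrite -mulrBr normrM ler_wpM2r.
Qed.

Variables (s : nat) (eps : Om -> family_space nat (family_space int R))
  (Z : int -> s.-tuple R -> family_space int R -> R) (V : s.-tuple R -> R)
  (kappa : nat -> R) (y : family_space nat (s.-tuple R)) (Gamma : int -> R) (dlt : R).
Local Notation Zq i t := (quenched eps Z y i t).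
Hypotheses (mZ : forall i t, measurable_fun setT (Zq i t)) (dlt0 : 0 < dlt)
  (Zmom : forall i t, integ P (fun w => `|Zq i t w| `^ (2 + dlt)))
  (Zcent : forall i t, ('E_P[Zq i t] = 0)%E)
  (hcov : forall t tau, (fun N => aggregation_cov P eps Z N t tau y) @ \oo --> (Gamma tau)%:E).

Lemma sqint_quenched i t : sqint P (Zq i t).
Proof.
split; first exact: mZ.
apply: (le_integ _ (integD (integ_cst P (1 ^+ 2)) (integZ (1 `^ dlt)^-1 (Zmom i t)))).
  exact: measurable_funX.
by move=> w; rewrite ger0_norm ?sqr_ge0//; exact: sqr_le_powR.
Qed.

Lemma mean_quenched i t : E (Zq i t) = 0.
Proof.
have := Zcent i t; rewrite expectation_mean; last exact: sqint_integ (sqint_quenched i t).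
by move=> [].
Qed.

Local Notation XN N t := (partial_aggregation eps Z N y t).

Lemma sqint_aggregation N t : sqint P (XN N t).
Proof. by apply: sqintZ; apply: sqint_sum => i; exact: sqint_quenched. Qed.

Lemma aggregation_cov_cvg t u :
  (fun N => E (fun w => XN N t w * XN N u w)) @ \oo --> Gamma (u - t).
Proof.
have := @hcov t (u - t).
have -> : (fun N => aggregation_cov P eps Z N t (u - t) y) =
    (fun N => (E (fun w => XN N t w * XN N u w))%:E).
  apply/funext => N; rewrite /aggregation_cov addrCA subrr addr0 expectation_mean//.
  exact: sqint_mul (sqint_aggregation N t) (sqint_aggregation N u).
by move=> /fine_cvg.
Qed.

(** The same cross moment at the times t and 0 is read once with base time t and once with base time
    0. *)
Lemma Gamma_even t : Gamma (- t) = Gamma t.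
Proof.
have h1 := @aggregation_cov_cvg t 0; have h2 := @aggregation_cov_cvg 0 t.
rewrite sub0r subr0 in h1 h2.
have e : (fun N => E (fun w => XN N t w * XN N 0 w)) = (fun N => E (fun w => XN N 0 w * XN N t w)).
  by apply/funext => N; apply: eq_mean => w; rewrite mulrC.
by rewrite e in h1; exact: (cvg_unique _ h1 h2).
Qed.

Lemma quadratic_form_cvg n (t : 'I_n -> int) (lam : 'I_n -> R) :
  (fun N => E (fun w => (\sum_k lam k * XN N (t k) w) ^+ 2)) @ \oo -->
  \sum_k \sum_l lam k * lam l * Gamma (t l - t k).
Proof.
have -> : (fun N => E (fun w => (\sum_k lam k * XN N (t k) w) ^+ 2)) =
    (fun N => \sum_k \sum_l lam k * lam l * E (fun w => XN N (t k) w * XN N (t l) w)).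
  apply/funext => N.
  have iX k l : integ P (fun w => lam k * lam l * (XN N (t k) w * XN N (t l) w)).
    by apply: integZ; apply: sqint_mul; exact: sqint_aggregation.
  rewrite (eq_mean P (g := fun w => \sum_k \sum_l lam k * lam l * (XN N (t k) w * XN N (t l) w))).
    rewrite mean_sum => [|k]; last by apply: integ_sum.
    apply: eq_bigr => k _; rewrite mean_sum//; apply: eq_bigr => l _.
    by rewrite meanZ//; apply: sqint_mul; exact: sqint_aggregation.
  move=> w; rewrite expr2 mulr_suml; apply: eq_bigr => k _; rewrite mulr_sumr.
  by apply: eq_bigr => l _; ring.
apply: cvgn_sum => k; apply: cvgn_sum => l.
by apply: cvgM; [exact: cvg_cst|exact: aggregation_cov_cvg].
Qed.

Lemma Gamma_psd n (t : nat -> int) (c : nat -> R) :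
  0 <= \sum_(i < n) \sum_(j < n) c i * c j * Gamma (t j - t i).
Proof.
have h := @quadratic_form_cvg n (fun i => t i) (fun i => c i).
rewrite -(cvg_lim _ h)//; apply: limr_ge; first by apply/cvg_ex; eexists; exact: h.
by apply: nearW => N; exact: mean_sqr_ge0.
Qed.

Section combinations.
Variables (n : nat) (t : 'I_n.+1 -> int) (lam : 'I_n.+1 -> R).
Let Lam : R := \sum_k `|lam k|.
Let D : R := n.+1%:R `^ (1 + dlt) * Lam `^ (2 + dlt).

Definition comb (i : nat) (w : Om) : R := \sum_k lam k * Zq i (t k) w.

Let Lam0 : 0 <= Lam. Proof. exact: sumr_ge0. Qed.

Let lamL k : `|lam k| <= Lam.
Proof. by rewrite /Lam (bigD1 k)//= lerDl sumr_ge0. Qed.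

Let mcomb i : measurable_fun setT (comb i).
Proof. by apply: measurable_sum => k; apply: measurable_funM. Qed.

Let sqint_comb i : sqint P (comb i).
Proof. by apply: sqint_sum => k; apply: sqintZ; exact: sqint_quenched. Qed.

Let mean_comb i : E (comb i) = 0.
Proof.
rewrite /comb mean_sum => [|k]; last by apply/integZ/sqint_integ/sqint_quenched.
apply: big1 => k _; rewrite meanZ ?mean_quenched ?mulr0//.
exact/sqint_integ/sqint_quenched.
Qed.

Lemma powR_comb_le i w : `|comb i w| `^ (2 + dlt) <= D * \sum_k `|Zq i (t k) w| `^ (2 + dlt).
Proof.
have q0 : 0 <= 2 + dlt by rewrite addr_ge0// ltW.
apply: (@le_trans _ _ ((\sum_k `|lam k| * `|Zq i (t k) w|) `^ (2 + dlt))).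
  apply: ge0_ler_powR; rewrite ?nnegrE//.
    by apply: sumr_ge0 => k _; rewrite mulr_ge0.
  by apply: (le_trans (ler_norm_sum _ _ _)); apply: ler_sum => k _; rewrite normrM.
have q1 : 1 < 2 + dlt by move: dlt0; lra.
have x0 k : 0 <= `|lam k| * `|Zq i (t k) w| by rewrite mulr_ge0.
apply: (le_trans (powR_sum_le q1 x0)); rewrite /D -mulrA.
have -> : 2 + dlt - 1 = 1 + dlt by lra.
rewrite ler_wpM2l ?powR_ge0// mulr_sumr; apply: ler_sum => k _.
rewrite powRM// ler_wpM2r ?powR_ge0//.
by apply: ge0_ler_powR; rewrite ?nnegrE//; exact: lamL.
Qed.

Lemma integ_powR_comb i : integ P (fun w => `|comb i w| `^ (2 + dlt)).
Proof.
apply: (le_integ _ (integZ D (integ_sum _ predT (fun k : 'I_n.+1 => Zmom i (t k))))).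
  exact: measurable_norm_powR.
by move=> w; rewrite ger0_norm ?powR_ge0//; exact: powR_comb_le.
Qed.

Lemma mean_powR_comb_le i :
  E (fun w => `|comb i w| `^ (2 + dlt)) <= D * \sum_k E (fun w => `|Zq i (t k) w| `^ (2 + dlt)).
Proof.
have iS : integ P (fun w => \sum_k `|Zq i (t k) w| `^ (2 + dlt)) by exact: integ_sum.
rewrite -mean_sum// -meanZ//; apply: le_mean; first exact: integ_powR_comb.
  exact: integZ.
by move=> w; exact: powR_comb_le.
Qed.

(** Based on u^2 <= 1 + |u|^(2 + dlt): the moments on the right have bounded means over trajectories
    by [quenched_moment], whereas V^2 need not be integrable. *)
Lemma mean_sqr_comb_le i :
  E (fun w => comb i w ^+ 2) <= (1 + D) * \sum_k (1 + E (fun w => `|Zq i (t k) w| `^ (2 + dlt))).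
Proof.
have D0 : 0 <= D by rewrite mulr_ge0 ?powR_ge0.
apply: (@le_trans _ _ (1 + E (fun w => `|comb i w| `^ (2 + dlt)))).
  rewrite -[X in X + _](mean_cst P) -meanD; [|exact: integ_cst|exact: integ_powR_comb].
  apply: le_mean; first by have [] := sqint_comb i.
    by apply: integD; [exact: integ_cst|exact: integ_powR_comb].
  by move=> w; have := sqr_le_powR (comb i w) ltr01 dlt0; rewrite expr1n powR1 invr1 mul1r.
apply: (le_trans (lerD (lexx 1) (mean_powR_comb_le i))).
rewrite mulrDl mul1r; apply: lerD.
  rewrite big_ord_recl; apply: (@le_trans _ _ (1 + 0 + 0)); first by rewrite !addr0.
  apply: lerD; first by rewrite lerD2l; exact: mean_powR_ge0.
  by apply: sumr_ge0 => k _; rewrite addr_ge0//; exact: mean_powR_ge0.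
by rewrite ler_wpM2l//; apply: ler_sum => k _; rewrite lerDr.
Qed.

(** The almost sure clause of [weakly_dependent] at the given trajectory, kept in the same form so
    that it can be passed on as it is. *)
Definition decorrelated := forall (u v : nat) (i : 'I_u.+1 -> nat) (t : 'I_u.+1 -> int)
  (j : 'I_v.+1 -> nat) (t' : 'I_v.+1 -> int) (r : nat)
  (f : 'rV[R]_u.+1 -> R) (g : 'rV[R]_v.+1 -> R),
  {homo i : a b / (a <= b)%N} -> {homo j : a b / (a <= b)%N} ->
  (i ord_max + r < j ord0)%N -> Delta1 f -> Delta1 g ->
  (`| covariance P (fun w => f (\row_m quenched eps Z y (i m) (t m) w))
                   (fun w => g (\row_m quenched eps Z y (j m) (t' m) w)) | <=
   (Lip f * Lip g * (\sum_m V (y (i m))) * (\sum_m V (y (j m))) * kappa r)%:E)%E.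

Hypotheses (V0 : forall i, 0 <= V (y i)) (kappa0 : forall r, 0 <= kappa r)
  (kappa_noninc : forall r s, (r <= s)%N -> kappa s <= kappa r) (wd : decorrelated).

(* The pairs (component i, time t k) are enumerated as i * n.+1 + k, with
   nondecreasing component index as weak dependence requires. *)
Let row_comb (A A0 : nat) (c : nat -> R) w :
  let u := (A * n.+1 + n)%N in
  \sum_(m < u.+1) (c (A0 + m %/ n.+1)%N * lam (inord (m %% n.+1))) *
     (\row_(m < u.+1) quenched eps Z y (A0 + m %/ n.+1)%N (t (inord (m %% n.+1))) w) ord0 m
  = \sum_(i < A.+1) c (A0 + i)%N * comb (A0 + i)%N w.
Proof.
move=> u.
under eq_bigr do rewrite mxE.
pose F m := (c (A0 + m %/ n.+1)%N * lam (inord (m %% n.+1))) *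
  Zq (A0 + m %/ n.+1)%N (t (inord (m %% n.+1))) w.
have -> : u.+1 = (A.+1 * n.+1)%N by rewrite /u mulSn addnC addSn.
rewrite (sum_blocks F); apply: eq_bigr => i _; rewrite /comb big_distrr/=.
apply: eq_bigr => k _; rewrite /F divnMDl// divn_small// addn0 modnMDl modn_small//.
by rewrite inord_val mulrA.
Qed.

Let row_V (A A0 : nat) : let u := (A * n.+1 + n)%N in
  \sum_(m < u.+1) V (y (A0 + m %/ n.+1)%N) = n.+1%:R * \sum_(i < A.+1) V (y (A0 + i)%N).
Proof.
move=> u; have -> : u.+1 = (A.+1 * n.+1)%N by rewrite /u mulSn addnC addSn.
rewrite (sum_blocks (fun m => V (y (A0 + m %/ n.+1)%N))) big_distrr/=.
apply: eq_bigr => i _.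
rewrite (eq_bigr (fun=> V (y (A0 + i)%N))); last first.
  by move=> k _; rewrite divnMDl// divn_small// addn0.
by rewrite sumr_const card_ord mulr_natl.
Qed.

Let measurable_lin (A A0 : nat) (c : nat -> R) :
  measurable_fun setT (fun w => \sum_(i < A) c (A0 + i)%N * comb (A0 + i)%N w).
Proof.
by apply: measurable_sum => i; apply: measurable_funM => //; exact: measurable_cst.
Qed.

(** Weak dependence for functions of one linear combination per group. Each component occurs at n +
    1 times, so its weight is counted n + 1 times, and the coefficients of the linear form gain a
    factor at most [Lam]. The sizes A + 1 and B + 1 keep both groups nonempty, as the condition
    requires. *)
Lemma cov_blocks (f0 g0 : R -> R) (L1 L2 K1 K2 : R) (c c' : nat -> R)
    (A0 A B0 B r : nat) (F G : Om -> R) :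
  continuous f0 -> continuous g0 ->
  (forall x, `|f0 x| <= 1) -> (forall x, `|g0 x| <= 1) ->
  0 <= L1 -> 0 <= L2 ->
  (forall x y, `|f0 x - f0 y| <= L1 * `|x - y|) ->
  (forall x y, `|g0 x - g0 y| <= L2 * `|x - y|) ->
  (forall i, `|c i| <= K1) -> (forall i, `|c' i| <= K2) ->
  (A0 + A + r < B0)%N ->
  (forall w, F w = f0 (\sum_(i < A.+1) c (A0 + i)%N * comb (A0 + i)%N w)) ->
  (forall w, G w = g0 (\sum_(i < B.+1) c' (B0 + i)%N * comb (B0 + i)%N w)) ->
  `|E (fun w => F w * G w) - E F * E G| <=
  (L1 * K1) * (L2 * K2) * (Lam ^+ 2 * n.+1%:R ^+ 2) *
  (\sum_(i < A.+1) V (y (A0 + i)%N)) * (\sum_(i < B.+1) V (y (B0 + i)%N)) * kappa r.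
Proof.
move=> cf cg f1 g1 L10 L20 fL gL cK cK' AB FE GE.
have K10 : 0 <= K1 by apply: le_trans (cK 0%N).
have K20 : 0 <= K2 by apply: le_trans (cK' 0%N).
have mF : measurable_fun setT F.
  rewrite (funext FE); apply: (measurableT_comp (f := f0)); first exact: continuous_measurable_fun.
  exact: measurable_lin.
have mG : measurable_fun setT G.
  rewrite (funext GE); apply: (measurableT_comp (f := g0)); first exact: continuous_measurable_fun.
  exact: measurable_lin.
have iF : integ P F by apply: (@integ_bounded _ _ _ P F 1 mF) => w; rewrite FE; exact: f1.
have iG : integ P G by apply: (@integ_bounded _ _ _ P G 1 mG) => w; rewrite GE; exact: g1.
have iFG : integ P (fun w => F w * G w).
  apply: (@integ_bounded _ _ _ _ _ 1); first exact: measurable_funM.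
  by move=> w; rewrite normrM mulr_ile1// ?FE ?GE ?f1 ?g1.
pose u := (A * n.+1 + n)%N; pose v := (B * n.+1 + n)%N.
pose f (z : 'rV[R]_u.+1) :=
  f0 (\sum_(m < u.+1) (c (A0 + m %/ n.+1)%N * lam (inord (m %% n.+1))) * z ord0 m).
pose g (z : 'rV[R]_v.+1) :=
  g0 (\sum_(m < v.+1) (c' (B0 + m %/ n.+1)%N * lam (inord (m %% n.+1))) * z ord0 m).
have lf : lipschitz_const f (L1 * (K1 * Lam)).
  apply: lipschitz_comp_lin => //; first exact: mulr_ge0.
  by move=> m; rewrite normrM ler_pM.
have lg : lipschitz_const g (L2 * (K2 * Lam)).
  apply: lipschitz_comp_lin => //; first exact: mulr_ge0.
  by move=> m; rewrite normrM ler_pM.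
have := @wd u v (fun m => A0 + m %/ n.+1)%N (fun m => t (inord (m %% n.+1)))
  (fun m => B0 + m %/ n.+1)%N (fun m => t (inord (m %% n.+1))) r f g.
have -> : (fun w => f (\row_m quenched eps Z y (A0 + m %/ n.+1)%N
    (t (inord (m %% n.+1))) w)) = F.
  by apply/funext => w; rewrite FE /f /u row_comb.
have -> : (fun w => g (\row_m quenched eps Z y (B0 + m %/ n.+1)%N
    (t (inord (m %% n.+1))) w)) = G.
  by apply/funext => w; rewrite GE /g /v row_comb.
rewrite covariance_mean//= lee_fin row_V row_V => wd'.
apply: (le_trans (wd' _ _ _ _ _)).
- by move=> a b ab; rewrite leq_add2l leq_div2r.
- by move=> a b ab; rewrite leq_add2l leq_div2r.
- by rewrite div0n addn0 divnMDl// divn_small// addn0.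
- by split; [move=> z; exact: f1|exists (L1 * (K1 * Lam))].
- by split; [move=> z; exact: g1|exists (L2 * (K2 * Lam))].
have SA0 : 0 <= \sum_(i < A.+1) V (y (A0 + i)%N) by apply: sumr_ge0.
have SB0 : 0 <= \sum_(i < B.+1) V (y (B0 + i)%N) by apply: sumr_ge0.
set SA := \sum_(i < A.+1) _ in SA0 *; set SB := \sum_(i < B.+1) _ in SB0 *.
have -> : L1 * K1 * (L2 * K2) * (Lam ^+ 2 * n.+1%:R ^+ 2) * SA * SB * kappa r =
  (L1 * (K1 * Lam)) * (L2 * (K2 * Lam)) * (n.+1%:R * SA) * (n.+1%:R * SB) * kappa r.
  by ring.
rewrite ler_wpM2r// ler_wpM2r ?mulr_ge0// ler_wpM2r ?mulr_ge0//.
by apply: ler_pM; rewrite ?Lip_ge0 ?Lip_le.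
Qed.

Lemma comb_decoupling (a : nat -> R) (al : R) (A B L r : nat) (x x' : R) :
  (forall i, `|a i| <= al) -> (A + r <= B)%N ->
  let F w := cos (\sum_(i < A) a i * comb i w + x) in
  let G w := cos (\sum_(i < L) a (B + i)%N * comb (B + i)%N w + x') in
  `|E (fun w => F w * G w) - E F * E G| <=
  al ^+ 2 * (Lam ^+ 2 * n.+1%:R ^+ 2) * (\sum_(i < A) V (y i)) *
  (\sum_(i < L) V (y (B + i)%N)) * kappa r.
Proof.
move=> aal AB; cbv zeta.
pose F w := cos (\sum_(i < A) a i * comb i w + x).
pose G w := cos (\sum_(i < L) a (B + i)%N * comb (B + i)%N w + x').
change (`|E (fun w => F w * G w) - E F * E G| <=
  al ^+ 2 * (Lam ^+ 2 * n.+1%:R ^+ 2) * (\sum_(i < A) V (y i)) *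
  (\sum_(i < L) V (y (B + i)%N)) * kappa r).
have cosc z : continuous (fun x : R => cos (x + z)).
  move=> ?; apply: continuous_comp; last exact: continuous_cos.
  by apply: cvgD; [exact: cvg_id|exact: cvg_cst].
have cosl z (p q : R) : `|cos (p + z) - cos (q + z)| <= 1 * `|p - q|.
  rewrite mul1r; have -> : p + z = (q + z) + (p - q) by ring.
  exact: cos_lip.
have mF : measurable_fun setT F.
  by apply: measurable_cos_shift; exact: (measurable_lin A 0 a).
have mG : measurable_fun setT G by apply: measurable_cos_shift; exact: measurable_lin.
(* An empty group makes its cosine constant, hence the covariance 0. *)
case: A => [|A] in AB F mF *.
  have e1 w : F w = cos x by rewrite /F big_ord0 add0r.
  rewrite big_ord0 mulr0 !mul0r.
  rewrite (eq_mean P (f := F) (g := fun=> cos x))// mean_cst -meanZ; last first.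
    by apply: (@integ_bounded _ _ _ P G 1 mG) => w; exact: cos_max.
  rewrite (eq_mean P (g := fun w => cos x * G w)) ?subrr ?normr0//.
  by move=> w; rewrite e1.
case: L => [|L] in G mG *.
  have e1 w : G w = cos x' by rewrite /G big_ord0 add0r.
  rewrite big_ord0 mulr0 !mul0r.
  rewrite (eq_mean P (f := G) (g := fun=> cos x'))// mean_cst mulrC -meanZ; last first.
    by apply: (@integ_bounded _ _ _ P F 1 mF) => w; exact: cos_max.
  rewrite (eq_mean P (g := fun w => cos x' * F w)) ?subrr ?normr0//.
  by move=> w; rewrite e1 mulrC.
have := @cov_blocks (fun z => cos (z + x)) (fun z => cos (z + x')) 1 1 al al a a
  0 A B L r F G (cosc x) (cosc x') (fun z => cos_max _) (fun z => cos_max _) ler01 ler01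
  (cosl x) (cosl x') aal aal.
rewrite add0n !mul1r -expr2 ; apply => //.
Qed.

(* The weak dependence bound is insensitive to the truncation level. *)
Lemma comb_cov i j : i != j -> `|E (fun w => comb i w * comb j w)| <=
  (Lam ^+ 2 * n.+1%:R ^+ 2) * V (y i) * V (y j) * kappa (gap i j).
Proof.
wlog ij : i j / (i < j)%N.
  move=> H; rewrite neq_ltn => /orP[] ij; first by apply: H => //; rewrite ltn_eqF.
  rewrite (eq_mean P (g := fun w => comb j w * comb i w)); last first.
    by move=> w; rewrite mulrC.
  rewrite [X in X * kappa _]mulrAC (_ : gap i j = gap j i); last by rewrite /gap addnC.
  by apply: H => //; rewrite ltn_eqF.
move=> _; set B := (X in _ <= X).
pose tr (N : nat) i w := truncate N%:R (comb i w).
have mtr N k : measurable_fun setT (tr N k).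
  apply: (measurableT_comp (f := truncate N%:R)) => //.
  by apply: continuous_measurable_fun; exact: continuous_truncate.
have h N : (0 < N)%N ->
    `|E (fun w => tr N i w * tr N j w) - E (tr N i) * E (tr N j)| <= B.
  move=> N0; have N0' : 0 < N%:R :> R by rewrite ltr0n.
  (* Division by N brings the sup norm down to 1 and divides the Lipschitz constant as well, so both
     sides of the bound carry the same factor N^(-2), which cancels. *)
  pose f0 (x : R) := N%:R^-1 * truncate N%:R x.
  have cf : continuous f0.
    by move=> x; apply: cvgM; [exact: cvg_cst|exact: continuous_truncate].
  have f1 x : `|f0 x| <= 1.
    rewrite normrM gtr0_norm ?invr_gt0// ler_pdivrMl// mulr1.
    exact: truncate_le.
  have iN0 : 0 <= N%:R^-1 :> R by rewrite invr_ge0.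
  have fL p q : `|f0 p - f0 q| <= N%:R^-1 * `|p - q|.
    by rewrite -mulrBr normrM ger0_norm// ler_wpM2l// truncate_lip.
  have g1 (k : nat) : `|1 : R| <= 1 by rewrite normr1.
  have gij : (i + 0 + gap i j < j)%N.
    rewrite /gap addn0; move: ij; clear; lia.
  have itr k : integ P (tr N k).
    by apply: (@integ_bounded _ _ _ P (tr N k) N%:R (mtr N k)) => w; exact: truncate_le.
  have := @cov_blocks f0 f0 _ _ 1 1 (fun=> 1) (fun=> 1) i 0 j 0 _
    (fun w => N%:R^-1 * tr N i w) (fun w => N%:R^-1 * tr N j w)
    cf cf f1 f1 iN0 iN0 fL fL g1 g1 gij.
  rewrite !big_ord1 !addn0 !mulr1.
  have hsum k w : N%:R^-1 * tr N k w = f0 (\sum_(i0 < 1) 1 * comb (k + i0)%N w).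
    by rewrite big_ord1 addn0 mul1r.
  move=> /(_ (hsum i) (hsum j)).
  rewrite !meanZ// (eq_mean P (g := fun w => (N%:R^-1 * N%:R^-1) * (tr N i w * tr N j w))); last first.
    by move=> w; rewrite mulrACA.
  rewrite meanZ; last first.
    apply: (@integ_bounded _ _ _ _ _ (N%:R * N%:R)); first exact: measurable_funM.
    by move=> w; rewrite normrM ler_pM// truncate_le.
  set p := E _; set q := E _; set q' := E _.
  have -> : N%:R^-1 * N%:R^-1 * p - N%:R^-1 * q * (N%:R^-1 * q') =
    (N%:R^-1 * N%:R^-1) * (p - q * q') by ring.
  rewrite normrM ger0_norm ?mulr_ge0// -!mulrA !ler_pM2l ?invr_gt0//.
  by rewrite /B !mulrA.
have c2 k : (fun N => E (tr N k)) @ \oo --> E (comb k).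
  apply: (integ_dominated_cvg (g := fun w => `|comb k w|)) => //.
  - by apply/integ_norm/sqint_integ/sqint_comb.
  - by move=> w; exact: truncate_cvg.
  - by move=> N w; exact: truncate_norm.
have c1 : (fun N => E (fun w => tr N i w * tr N j w)) @ \oo -->
    E (fun w => comb i w * comb j w).
  apply: (integ_dominated_cvg (g := fun w => `|comb i w * comb j w|)).
  - by move=> N; exact: measurable_funM.
  - exact: measurable_funM.
  - by apply/integ_norm/sqint_mul; exact: sqint_comb.
  - by move=> w; apply: cvgM; exact: truncate_cvg.
  - by move=> N w; rewrite !normrM ler_pM// truncate_norm.
have c3 : (fun N => `|E (fun w => tr N i w * tr N j w) - E (tr N i) * E (tr N j)|) @ \oo -->
    `|E (fun w => comb i w * comb j w) - E (comb i) * E (comb j)|.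
  by apply: cvg_norm; apply: cvgB => //; apply: cvgM.
rewrite mean_comb mul0r subr0 in c3.
apply: (@closed_cvg _ _ \oo _ _ (fun x => x <= B) _ _ _ c3); first exact: closed_le.
by near=> N; apply: h; near: N; exact: nbhs_infty_gt.
Unshelve. all: by end_near. Qed.

Variables (M b q T lv : nat -> nat).
Hypotheses (M0 : forall l, (0 < M l)%N) (bq : forall l, (0 < b l + q l)%N)
  (lvM : forall N, (0 < N)%N -> (M (lv N) <= N)%N)
  (lvT : forall N, (0 < N)%N -> (N + (b (lv N) + q (lv N)) <= T (lv N))%N)
  (lv_oo : lv @ \oo --> \oo)
  (hH : (fun l => (M l)%:R^-1 * hsum (fun i => V (y i)) kappa (b l) (q l) (T l)) @ \oo --> (0 : R))
  (hG : forall t, (fun l => (M l)%:R^-1 * \sum_(i < T l | small (b l) (q l) i)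
     (1 + E (fun w => `|Zq i t w| `^ (2 + dlt)))) @ \oo --> (0 : R))
  (hF : forall t, (fun l => (Num.sqrt (M l)%:R)^-1 `^ (2 + dlt) * ((b l + q l)%:R `^ (1 + dlt) *
     \sum_(i < T l) E (fun w => `|Zq i t w| `^ (2 + dlt)))) @ \oo --> (0 : R)).

(** A linear combination in time of the aggregations is the aggregation of the variables [comb i],
    so the scalar limit theorem [mean_cos_cvg] applies to it. *)
Lemma mean_cos_aggregation_cvg th :
  (fun N => E (fun w => cos (\sum_k lam k * XN N (t k) w + th))) @ \oo -->
  expR (- ((\sum_k \sum_l lam k * lam l * Gamma (t l - t k)) / 2)) * cos th.
Proof.
have XW N w : \sum_k lam k * XN N (t k) w = (Num.sqrt N%:R)^-1 * \sum_(i < N) comb i w.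
  rewrite /comb exchange_big mulr_sumr; apply: eq_bigr => k _ /=.
  by rewrite /partial_aggregation -mulr_sumr mulrCA.
have hX := @quadratic_form_cvg n.+1 t lam.
have s0 : 0 <= \sum_k \sum_l lam k * lam l * Gamma (t l - t k).
  rewrite -(cvg_lim _ hX)//; apply: limr_ge; first by apply/cvg_ex; eexists; exact: hX.
  by apply: nearW => N; exact: mean_sqr_ge0.
rewrite (_ : (fun N => E (fun w => (\sum_k lam k * XN N (t k) w) ^+ 2)) =
  (fun N => E (fun w => ((Num.sqrt N%:R)^-1 * \sum_(i < N) comb i w) ^+ 2))) in hX; last first.
  by apply/funext => N; apply: eq_mean => w; rewrite XW.
rewrite (_ : (fun N => _) = (fun N => E (fun w => cos ((Num.sqrt N%:R)^-1 * \sum_(i < N) comb i w + th)))); last first.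
  by apply/funext => N; apply: eq_mean => w; rewrite XW.
have squeeze (u : nat -> R) (c : R) (h : 'I_n.+1 -> nat -> R) : (forall l, 0 <= u l) ->
    (forall l, u l <= c * \sum_k h k l) -> (forall k, h k @ \oo --> (0 : R)) -> u @ \oo --> (0 : R).
  move=> u0 uh hh; apply: (@squeeze_cvgr _ _ _ _ (fun=> 0) (fun l => c * \sum_k h k l)).
  - by apply: nearW => l; rewrite u0 uh.
  - exact: cvg_cst.
  have {2}-> : 0 = c * \sum_(k < n.+1) 0 :> R by rewrite big1 ?mulr0.
  by apply: cvgM; [exact: cvg_cst|exact: cvgn_sum].
apply: (@mean_cos_cvg _ _ _ P comb (fun i => V (y i)) kappa (Lam ^+ 2 * n.+1%:R ^+ 2) dlt
  _ _ _ _ _ _ _ _ _ _ M b q T lv) => //.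
- exact: integ_powR_comb.
- by rewrite mulr_ge0 ?sqr_ge0.
- exact: comb_cov.
- by move=> a al A B L r x x'; exact: comb_decoupling.
- apply: (squeeze _ (1 + D) _ _ _ (fun k => @hG (t k))).
    move=> l; rewrite mulr_ge0 ?invr_ge0//; apply: sumr_ge0 => i _.
    by exact: mean_sqr_ge0.
  move=> l /=; rewrite -mulr_sumr [leRHS]mulrCA ler_wpM2l ?invr_ge0// exchange_big mulr_sumr.
  by apply: ler_sum => i _; exact: mean_sqr_comb_le.
- apply: (squeeze _ D _ _ _ (fun k => @hF (t k))).
    move=> l; rewrite !mulr_ge0 ?powR_ge0//; apply: sumr_ge0 => i _.
    by exact: mean_powR_ge0.
  move=> l /=; rewrite -mulr_sumr [leRHS]mulrCA ler_wpM2l ?powR_ge0// -mulr_sumr [leRHS]mulrCA ler_wpM2l ?powR_ge0//.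
  rewrite exchange_big mulr_sumr.
  by apply: ler_sum => i _; exact: mean_powR_comb_le.
Qed.

End combinations.
End fixed_trajectory.

(** * Trigonometric approximation and the continuity theorem *)

Section bernstein_operator.
Context (R : realType) (n : nat) (y : 'I_n -> R).
Hypothesis y01 : forall k, 0 <= y k <= 1.

Definition incr (k : 'I_n) (j : 'I_n -> nat) : 'I_n -> nat :=
  fun i => ((i == k) + j i)%N.

(* Expectation of g at the endpoint of the random walk started at j which, for
   each k in s, moves one step in direction k with probability y k. *)
Fixpoint bern (s : seq 'I_n) (g : ('I_n -> nat) -> R) (j : 'I_n -> nat) : R :=
  if s is k :: s' then y k * bern s' g (incr k j) + (1 - y k) * bern s' g j
  else g j.

Lemma bern_le s g h j : (forall j, g j <= h j) -> bern s g j <= bern s h j.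
Proof.
move=> gh; elim: s j => [|k s IH] j //=; have /andP[y0 y1] := y01 k.
by rewrite lerD// ler_wpM2l// subr_ge0.
Qed.

Lemma bern_cst s c j : bern s (fun=> c) j = c.
Proof. by elim: s j => [|k s IH] j //=; rewrite !IH; ring. Qed.

Lemma bernD s g h j : bern s (fun j => g j + h j) j = bern s g j + bern s h j.
Proof. by elim: s j => [|k s IH] j //=; rewrite !IH; ring. Qed.

Lemma bernZ s a g j : bern s (fun j => a * g j) j = a * bern s g j.
Proof. by elim: s j => [|k s IH] j //=; rewrite !IH; ring. Qed.

Lemma bernB_cst s g c j : bern s (fun j => g j - c) j = bern s g j - c.
Proof. by elim: s j => [|k s IH] j //=; rewrite !IH; ring. Qed.

Lemma bern_sum (I : Type) (r : seq I) s (g : I -> ('I_n -> nat) -> R) j :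
  bern s (fun j => \sum_(i <- r) g i j) j = \sum_(i <- r) bern s (g i) j.
Proof.
elim: s j => [|k s IH] j //=; rewrite !IH !big_distrr/= -big_split/=.
by [].
Qed.

(** The l-th coordinate of the endpoint is j l plus a binomial variable with parameters
    [count_mem l s] and [y l]; the two terms are its variance and its squared bias with respect to
    a. *)
Lemma bern_sqr s l a j : bern s (fun j => ((j l)%:R - a) ^+ 2) j =
  (count_mem l s)%:R * (y l * (1 - y l)) +
  ((j l)%:R + (count_mem l s)%:R * y l - a) ^+ 2.
Proof.
elim: s j => [|k s IH] j /=; first by rewrite !mul0r add0r addr0.
rewrite !IH /incr; have [<-|kl] := eqVneq k l; first by rewrite !natrD /=; ring.
by rewrite /= !add0n; ring.
Qed.

Lemma bern_norm s g B j : (forall j, `|g j| <= B) -> `|bern s g j| <= B.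
Proof.
move=> gB; rewrite ler_norml -{1}(bern_cst s (- B) j) -{2}(bern_cst s B j).
by rewrite !bern_le// => i; have := gB i; rewrite ler_norml => /andP[].
Qed.

(** Bernstein's argument. Each direction occurs m times, so the rescaled endpoint has mean y and
    coordinatewise variance at most 1 / m; where some coordinate deviates by at least rho, the bound
    2 B is paid by the quadratic term of [D], as in Chebyshev's inequality. *)
Lemma bern_approx (F : ('I_n -> R) -> R) (B rho eps : R) (m : nat) :
  0 < rho -> 0 <= eps -> (0 < m)%N -> (forall z, `|F z| <= B) ->
  (forall z z', (forall k, `|z k - z' k| < rho) -> `|F z - F z'| <= eps) ->
  `|bern (flatten (nseq m (enum 'I_n))) (fun j => F (fun k => (j k)%:R / m%:R)) (fun=> 0%N)
    - F y| <= eps + 2 * B * n%:R / (rho ^+ 2 * m%:R).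
Proof.
move=> rho0 eps0 m0 FB Fmod; set s := flatten _.
have B0 : 0 <= B by exact: le_trans (FB y).
have m0' : 0 < m%:R :> R by rewrite ltr0n.
have cs l : count_mem l s = m.
  rewrite /s count_flatten map_nseq sumn_nseq.
  by rewrite (count_uniq_mem _ (enum_uniq _)) mem_enum mul1n.
pose K := 2 * B / rho ^+ 2.
have K0 : 0 <= K by rewrite divr_ge0 ?sqr_ge0// mulr_ge0.
pose D (j : 'I_n -> nat) := eps + \sum_(k < n) K / m%:R ^+ 2 * ((j k)%:R - m%:R * y k) ^+ 2.
have hD j : `|F (fun k => (j k)%:R / m%:R) - F y| <= D j.
  have [/forallP h|] := boolP [forall k, `|(j k)%:R / m%:R - y k| < rho].
    apply: (le_trans (Fmod _ _ h)); rewrite /D lerDl; apply: sumr_ge0 => k _.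
    by rewrite mulr_ge0 ?sqr_ge0// divr_ge0// sqr_ge0.
  rewrite negb_forall => /existsP[k]; rewrite -leNgt => hk.
  apply: (@le_trans _ _ (2 * B)).
    apply: (le_trans (ler_normB _ _)).
    by have := FB (fun k => (j k)%:R / m%:R); have := FB y; lra.
  rewrite /D (bigD1 k)//= addrCA -[leLHS]addr0 lerD//; last first.
    rewrite addr_ge0// sumr_ge0// => i _.
    by rewrite mulr_ge0 ?sqr_ge0// divr_ge0// sqr_ge0.
  have -> : K / m%:R ^+ 2 * ((j k)%:R - m%:R * y k) ^+ 2 =
      K * `|(j k)%:R / m%:R - y k| ^+ 2.
    by rewrite real_normK ?num_real//; field; rewrite gt_eqF.
  have -> : 2 * B = K * rho ^+ 2 by rewrite /K divfK// sqrf_eq0 gt_eqF.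
  by rewrite ler_wpM2l// lerXn2r// nnegrE// ltW.
rewrite -bernB_cst.
have hB : bern s D (fun=> 0%N) <= eps + 2 * B * n%:R / (rho ^+ 2 * m%:R).
  rewrite /D bernD bern_cst lerD2l bern_sum.
  apply: (@le_trans _ _ (\sum_(k < n) K / m%:R)).
    apply: ler_sum => k _; rewrite bernZ bern_sqr cs add0r subrr expr0n addr0.
    have /andP[y0 y1] := y01 k.
    rewrite (_ : K / m%:R ^+ 2 * (m%:R * (y k * (1 - y k))) =
      K / m%:R * (y k * (1 - y k))); last by field; rewrite gt_eqF.
    apply: ler_piMr; [by rewrite divr_ge0|nra].
  rewrite sumr_const card_ord -mulr_natl le_eqVlt; apply/orP; left; apply/eqP.
  by rewrite /K; field; rewrite !gt_eqF.
apply: le_trans hB; rewrite ler_norml -mulN1r -bernZ; apply/andP; split.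
  by apply: bern_le => j; have := hD j; rewrite ler_norml mulN1r => /andP[].
by apply: bern_le => j; have := hD j; rewrite ler_norml => /andP[].
Qed.

End bernstein_operator.

Section trigonometric_polynomials.
Context (R : realType) (n : nat).
Implicit Types (h : 'rV[R]_n -> R) (l : 'rV[R]_n).

Definition trig_eval (T : seq (R * 'rV[R]_n * R)) (x : 'rV[R]_n) : R :=
  \sum_(p <- T) p.1.1 * cos (\sum_k p.1.2 ord0 k * x ord0 k + p.2).

Definition trigpoly h : Prop := exists T, forall x, h x = trig_eval T x.

Lemma trigpoly_cst (c : R) : trigpoly (fun=> c).
Proof.
exists [:: (c, 0, 0)] => x; rewrite /trig_eval big_seq1/= big1 ?addr0 ?cos0 ?mulr1//.
by move=> k _; rewrite mxE mul0r.
Qed.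

Lemma trigpolyD h h' : trigpoly h -> trigpoly h' -> trigpoly (fun x => h x + h' x).
Proof.
move=> [T hT] [T' hT']; exists (T ++ T') => x.
by rewrite /trig_eval big_cat/= hT hT'.
Qed.

Lemma trigpoly_term (c : R) l th :
  trigpoly (fun x => c * cos (\sum_k l ord0 k * x ord0 k + th)).
Proof. by exists [:: (c, l, th)] => x; rewrite /trig_eval big_seq1. Qed.

Lemma eq_trigpoly h h' : (forall x, h x = h' x) -> trigpoly h -> trigpoly h'.
Proof. by move=> e [T hT]; exists T => x; rewrite -e. Qed.

Lemma trigpoly_sum (I : Type) (r : seq I) (F : I -> 'rV[R]_n -> R) :
  (forall i, trigpoly (F i)) -> trigpoly (fun x => \sum_(i <- r) F i x).
Proof.
move=> hF; elim: r => [|i r IH].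
  by apply: eq_trigpoly (trigpoly_cst 0) => x; rewrite big_nil.
by apply: eq_trigpoly (trigpolyD (hF i) IH) => x; rewrite big_cons.
Qed.

Lemma trigpolyM h h' : trigpoly h -> trigpoly h' -> trigpoly (fun x => h x * h' x).
Proof.
move=> [T hT] [T' hT'].
suff H : trigpoly (fun x => \sum_(p <- T) \sum_(q <- T')
  (p.1.1 * cos (\sum_k p.1.2 ord0 k * x ord0 k + p.2)) *
  (q.1.1 * cos (\sum_k q.1.2 ord0 k * x ord0 k + q.2))).
  apply: eq_trigpoly H => x; rewrite hT hT' /trig_eval big_distrl/=.
  by apply: eq_bigr => p _; rewrite big_distrr.
apply: trigpoly_sum => p; apply: trigpoly_sum => q.
have := trigpolyD (trigpoly_term (p.1.1 * q.1.1 / 2) (p.1.2 + q.1.2) (p.2 + q.2))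
  (trigpoly_term (p.1.1 * q.1.1 / 2) (p.1.2 - q.1.2) (p.2 - q.2)).
apply: eq_trigpoly => x.
set a := \sum_k p.1.2 ord0 k * _; set b := \sum_k q.1.2 ord0 k * _.
have -> : \sum_k (p.1.2 + q.1.2) ord0 k * x ord0 k = a + b.
  by rewrite -big_split/=; apply: eq_bigr => k _; rewrite mxE mulrDl.
have -> : \sum_k (p.1.2 - q.1.2) ord0 k * x ord0 k = a - b.
  by rewrite -sumrB; apply: eq_bigr => k _; rewrite !mxE mulrBl.
have -> : a + b + (p.2 + q.2) = (a + p.2) + (b + q.2) by ring.
have -> : a - b + (p.2 - q.2) = (a + p.2) - (b + q.2) by ring.
by rewrite cosD cosB; field.
Qed.

Lemma trigpoly_sin (c : R) (k : 'I_n) : trigpoly (fun x => sin (c * x ord0 k)).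
Proof.
have := trigpoly_term 1 (c *: delta_mx ord0 k) (- (pi / 2)).
apply: eq_trigpoly => x; rewrite mul1r cosBpihalf (bigD1 k)//= big1 ?addr0.
  by rewrite !mxE !eqxx mulr1.
by move=> i ik; rewrite !mxE (negbTE ik) andbF mulr0 mul0r.
Qed.

Lemma trigpoly_bern (c : R) s g j :
  trigpoly (fun x => bern (fun k => (1 + sin (c * x ord0 k)) / 2) s g j).
Proof.
elim: s j => [|k s IH] j /=; first exact: trigpoly_cst.
have hs : trigpoly (fun x => (1 + sin (c * x ord0 k)) / 2).
  apply: trigpolyM; last exact: trigpoly_cst.
  by apply: trigpolyD; [exact: trigpoly_cst|exact: trigpoly_sin].
apply: trigpolyD; first exact: trigpolyM.
apply: trigpolyM => //.
have := trigpolyD (trigpoly_cst 1) (trigpolyM (trigpoly_cst (-1)) hs).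
by apply: eq_trigpoly => x; rewrite mulN1r.
Qed.

Lemma compact_modulus (f : 'rV[R]_n -> R) (K eps : R) : continuous f -> 0 < eps ->
  exists2 rho, 0 < rho & forall z z' : 'rV[R]_n, (forall k, `|z ord0 k| <= K) ->
    (forall k, `|z ord0 k - z' ord0 k| < rho) -> `|f z - f z'| <= eps.
Proof.
move=> cf eps0.
have cK : compact [set v : 'rV[R]_n | forall i, `[- K, K]%classic (v ord0 i)].
  by apply: (rV_compact (A := fun=> `[- K, K]%classic)) => i; exact: segment_compact.
have /compact_near_coveringP/(_ R (0 : R)^'+ (fun rho x => forall z' : 'rV[R]_n,
   (forall k, `|x ord0 k - z' ord0 k| < rho) -> `|f x - f z'| <= eps)) H := cK.
have {}H := H _.
have [|rho0 [/= r0 Hr]] := H.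
  move=> x Kx.
  have /cvgrPdist_lt/(_ (eps / 2)) := cf x.
  rewrite divr_gt0// => /(_ isT) /nbhs_ballP[e /= e0 he].
  have e20 : 0 < e / 2 by rewrite divr_gt0.
  exists (ball x (e / 2), [set rho | rho < e / 2]).
    split => /=; first exact: nbhsx_ballx.
    exact: nbhs_right_lt.
  move=> [x' rho] /= [[_ xx'] rhoe] z' hz'.
  have h1 : `|f x - f x'| < eps / 2.
    apply: he; split => // i k; rewrite (ord1 i).
    by apply: (lt_le_trans (xx' ord0 k)); lra.
  have h2 : `|f x - f z'| < eps / 2.
    apply: he; split => // i k; rewrite (ord1 i).
    have := xx' ord0 k; have := hz' k; rewrite /ball/= => a1 a2.
    have -> : x ord0 k - z' ord0 k = (x ord0 k - x' ord0 k) + (x' ord0 k - z' ord0 k) by ring.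
    by apply: (le_lt_trans (ler_normD _ _)); lra.
  have -> : f x' - f z' = (f x - f z') - (f x - f x') by ring.
  by apply: (le_trans (ler_normB _ _)); lra.
exists (rho0 / 2); first by rewrite divr_gt0.
move=> z z' zK; apply: (Hr (rho0 / 2)) => //=.
- by rewrite sub0r normrN gtr0_norm ?divr_gt0//; lra.
- by rewrite divr_gt0.
- by move=> k; rewrite in_itv/= -ler_norml.
Qed.

End trigonometric_polynomials.

Section trigonometric_approximation.
Context (R : realType) (n : nat).

(** The numbers (1 + sin (c x_k)) / 2 lie in [0, 1] for every x, so a Bernstein average of values of
    f keeps the bound B on the whole space and not only on the cube. *)
Lemma trig_approx (f : 'rV[R]_n -> R) (B M eps : R) : continuous f ->
  (forall x, `|f x| <= B) -> 0 < M -> 0 < eps ->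
  exists T : 'rV[R]_n -> R, [/\ trigpoly T, (forall x, `|T x| <= B) &
    forall x : 'rV[R]_n, (forall k, `|x ord0 k| <= M) -> `|T x - f x| <= eps].
Proof.
move=> cf fB M0 eps0.
have e2 : 0 < eps / 3 by rewrite divr_gt0.
have [rho0 r00 hmod] := compact_modulus (M + 1) cf e2.
pose mu := Num.min rho0 1; have mu0 : 0 < mu by rewrite lt_min r00 ltr01.
(* Decoding returns sin (c x) / c, which differs from x by at most c^2 |x|^3; this c makes the error
   less than [mu] on the cube. *)
pose c := Num.min 1 (mu / (2 * (M ^+ 3 + 1))).
have M3 : 0 < M ^+ 3 + 1 by rewrite addr_gt0// exprn_gt0.
have c0 : 0 < c by rewrite lt_min ltr01/= divr_gt0// mulr_gt0.
have cM : c ^+ 2 * M ^+ 3 < mu.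
  have c1 : c <= 1 by rewrite ge_min lexx.
  have : c <= mu / (2 * (M ^+ 3 + 1)) by rewrite ge_min lexx orbT.
  rewrite ler_pdivlMr ?mulr_gt0// => h.
  have h2 : c ^+ 2 * M ^+ 3 <= c * M ^+ 3.
    apply: ler_wpM2r; first exact/exprn_ge0/ltW.
    by rewrite expr2 ler_piMr// ltW.
  have : 0 <= c * M ^+ 3 by rewrite mulr_ge0 ?exprn_ge0// ltW.
  by lra.
(* [psi] decodes (1 + sin (c x)) / 2 into sin (c x) / c. The truncation confines the arguments of f
   to a compact cube, and mu <= 1 makes it the identity on the decoded points of the cube of size
   M. *)
pose psi (z : R) := truncate (M + 1) ((2 * z - 1) / c).
pose F (z : 'I_n -> R) := f (\row_k psi (z k)).
pose rho := rho0 * c / 2.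
have rho_gt0 : 0 < rho by rewrite divr_gt0// mulr_gt0.
have FB z : `|F z| <= B by exact: fB.
have Fmod z z' : (forall k, `|z k - z' k| < rho) -> `|F z - F z'| <= eps / 3.
  move=> zz'; apply: hmod => k; rewrite !mxE.
    by apply: truncate_le; rewrite addr_ge0// ltW.
  apply: (le_lt_trans (truncate_lip _ _ _)).
  have -> : (2 * z k - 1) / c - (2 * z' k - 1) / c = 2 / c * (z k - z' k).
    by field; rewrite gt_eqF.
  rewrite normrM gtr0_norm ?divr_gt0//.
  have -> : rho0 = 2 / c * rho by rewrite /rho; field; rewrite gt_eqF.
  by rewrite ltr_pM2l ?divr_gt0.
have B0 : 0 <= B by exact: le_trans (fB 0).
pose m := (Num.truncn (2 * B * n%:R / (rho ^+ 2 * (eps / 3)))).+1.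
have hm : 2 * B * n%:R / (rho ^+ 2 * m%:R) <= eps / 3.
  have m0 : 0 < m%:R :> R by rewrite ltr0n.
  have rr : 0 < rho ^+ 2 by rewrite exprn_gt0.
  rewrite ler_pdivrMr ?mulr_gt0//.
  have : 2 * B * n%:R / (rho ^+ 2 * (eps / 3)) < m%:R.
    by apply: truncnS_gt.
  rewrite ltr_pdivrMr ?mulr_gt0// => /ltW /le_trans; apply.
  by rewrite le_eqVlt; apply/orP; left; apply/eqP; ring.
pose y (x : 'rV[R]_n) k := (1 + sin (c * x ord0 k)) / 2.
have y01 x k : 0 <= y x k <= 1.
  rewrite /y; have := sin_geN1 (c * x ord0 k); have := sin_le1 (c * x ord0 k).
  by move=> h1 h2; apply/andP; split; lra.
pose T x := bern (y x) (flatten (nseq m (enum 'I_n)))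
  (fun j => F (fun k => (j k)%:R / m%:R)) (fun=> 0%N).
exists T; split; first exact: trigpoly_bern.
  by move=> x; apply: bern_norm.
move=> x xM.
have h1 : `|T x - F (y x)| <= eps / 3 + eps / 3.
  by apply: (le_trans (bern_approx (y01 x) rho_gt0 (ltW e2) _ FB Fmod)) => //; rewrite lerD2l.
have h2 : `|f x - F (y x)| <= eps / 3.
  apply: hmod => k; first by rewrite (le_trans (xM k))// lerDl.
  rewrite mxE; set u := c * x ord0 k.
  have hy : (2 * y x k - 1) / c = sin u / c.
    by rewrite /y -/u; field; rewrite gt_eqF.
  have hs : `|x ord0 k - sin u / c| < mu.
    have -> : x ord0 k - sin u / c = - ((sin u - u) / c).
      by rewrite /u; field; rewrite gt_eqF.
    rewrite normrN normrM (gtr0_norm (x := c^-1)) ?invr_gt0//.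
    rewrite ltr_pdivrMr//; have [_ h3] := sin_sub_id u.
    apply: (le_lt_trans h3).
    rewrite /u normrM (gtr0_norm c0) exprMn.
    apply: (@le_lt_trans _ _ (c ^+ 3 * M ^+ 3)).
      apply: ler_wpM2l; first exact/exprn_ge0/ltW.
      by apply: lerXn2r => //; rewrite nnegrE; exact: ltW.
    rewrite exprSr mulrAC ltr_pM2r//.
  rewrite /psi hy truncate_id.
    by apply: (lt_le_trans hs); rewrite ge_min lexx.
  have -> : sin u / c = x ord0 k - (x ord0 k - sin u / c) by ring.
  apply: (le_trans (ler_normB _ _)); apply: lerD; first exact: xM.
  by apply: (le_trans (ltW hs)); rewrite ge_min lexx orbT.
have -> : T x - f x = (T x - F (y x)) - (f x - F (y x)) by ring.
by apply: (le_trans (ler_normB _ _)); lra.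
Qed.

Lemma measurable_trigpoly d (Om : measurableType d) (X : 'I_n -> Om -> R)
    (T : 'rV[R]_n -> R) : (forall k, measurable_fun setT (X k)) -> trigpoly T ->
  measurable_fun setT (fun w => T (\row_k X k w)).
Proof.
move=> mX [s hs]; under eq_fun do rewrite hs; rewrite /trig_eval.
apply: measurable_sum => p; apply: measurable_funM; first exact: measurable_cst.
under eq_fun do under eq_bigr do rewrite mxE.
apply: measurable_cos_shift; apply: measurable_sum => k.
by apply: measurable_funM => //; exact: measurable_cst.
Qed.

(** A pointwise limit of trigonometric polynomials in the coordinates, which are measurable term by
    term. *)
Lemma measurable_continuous_row d (Om : measurableType d) (X : 'I_n -> Om -> R)
    (f : 'rV[R]_n -> R) (B : R) : (forall k, measurable_fun setT (X k)) ->
  continuous f -> (forall x, `|f x| <= B) ->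
  measurable_fun setT (fun w => f (\row_k X k w)).
Proof.
move=> mX cf fB.
have /choice[T hT] : forall m : nat, exists T : 'rV[R]_n -> R, [/\ trigpoly T, (forall x, `|T x| <= B) &
    forall x : 'rV[R]_n, (forall k, `|x ord0 k| <= m.+1%:R) -> `|T x - f x| <= m.+1%:R^-1].
  by move=> m; apply: trig_approx => //; rewrite invr_gt0.
apply: (@measurable_fun_cvg _ _ _ _ (fun m w => T m (\row_k X k w))).
  by move=> m; apply: measurable_trigpoly => //; case: (hT m).
move=> w _; set x := \row_k _.
have ev : \forall m \near \oo, forall k, `|x ord0 k| <= m.+1%:R.
  exists (\max_(k < n) (Num.truncn `|x ord0 k|).+1)%N => // m /= hm k.
  apply: ltW; apply: (lt_le_trans (truncnS_gt _)).
  rewrite ler_nat ltnW// ltnS; apply: leq_trans hm.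
  exact: (leq_bigmax (F := fun k : 'I_n => (Num.truncn `|x ord0 k|).+1) k).
apply/cvgrPdist_le => e e0; near=> m.
rewrite distrC; have [_ _ h] := hT m; apply: (le_trans (h _ _)).
  by near: m.
near: m.
have /cvgrPdist_le/(_ e e0) := @cvg_harmonic R.
by apply: filterS => m; rewrite sub0r normrN ger0_norm /harmonic//= invr_ge0.
Unshelve. all: by end_near. Qed.

End trigonometric_approximation.

Section continuity_theorem.
Context d (Om : measurableType d) d' (Om' : measurableType d') (R : realType)
  (P : probability Om R) (P' : probability Om' R) (n : nat).

(** On the cube the difference is at most eps; outside, some (X_k / M)^2 exceeds 1 and pays for the
    bound 2 B. *)
Lemma tail_mean d0 (O : measurableType d0) (Q : probability O R)
    (X : 'I_n -> O -> R) (f T : 'rV[R]_n -> R) (B M C eps : R) :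
  (forall k, sqint Q (X k)) -> (forall k, mean Q (fun w => X k w ^+ 2) <= C) ->
  continuous f -> (forall x, `|f x| <= B) -> (forall x, `|T x| <= B) -> trigpoly T ->
  0 < M -> 0 <= eps ->
  (forall x : 'rV[R]_n, (forall k, `|x ord0 k| <= M) -> `|T x - f x| <= eps) ->
  `|mean Q (fun w => T (\row_k X k w)) - mean Q (fun w => f (\row_k X k w))| <=
  eps + 2 * B * n%:R * C / M ^+ 2.
Proof.
move=> X2 XC cf fB TB tT M0 eps0 hT.
have B0 : 0 <= B by exact: le_trans (fB 0).
have mX k : measurable_fun setT (X k) by case: (X2 k).
have iX k : integ Q (fun w => X k w ^+ 2) by case: (X2 k).
have hM : 0 < M ^+ 2 by rewrite exprn_gt0.
have iS : integ Q (fun w => \sum_(k < n) 2 * B / M ^+ 2 * X k w ^+ 2).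
  by apply: integ_sum => k; exact: integZ.
apply: (@le_trans _ _ (mean Q (fun w => eps + \sum_(k < n) 2 * B / M ^+ 2 * X k w ^+ 2))).
  apply: norm_meanB_le.
  - by apply: (@integ_bounded _ _ _ _ _ B) => //; exact: measurable_trigpoly.
  - by apply: (@integ_bounded _ _ _ _ _ B) => //; exact: measurable_continuous_row fB.
  - by apply: integD => //; exact: integ_cst.
  move=> w; have [/forallP h|] := boolP [forall k, `|X k w| <= M].
    apply: (le_trans (hT _ _)); first by move=> k; rewrite mxE.
    rewrite lerDl; apply: sumr_ge0 => k _; rewrite mulr_ge0 ?sqr_ge0//.
    by rewrite divr_ge0 ?mulr_ge0// ltW.
  rewrite negb_forall => /existsP[k]; rewrite -ltNge => hk.
  apply: (@le_trans _ _ (2 * B)).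
    apply: (le_trans (ler_normB _ _)).
    by have := TB (\row_k X k w); have := fB (\row_k X k w); lra.
  rewrite (bigD1 k)//= addrCA -[leLHS]addr0 lerD//; last first.
    rewrite addr_ge0// sumr_ge0// => i _; rewrite mulr_ge0 ?sqr_ge0//.
    by rewrite divr_ge0 ?mulr_ge0// ltW.
  rewrite -mulrA ler_peMr ?mulr_ge0// mulrC ler_pdivlMr// mul1r.
  rewrite -(real_normK (num_real (X k w))).
  by apply: lerXn2r; rewrite ?nnegrE//; exact: ltW.
rewrite meanD//; last exact: integ_cst.
rewrite mean_cst lerD2l mean_sum; last by move=> k; exact: integZ.
apply: (@le_trans _ _ (\sum_(k < n) 2 * B / M ^+ 2 * C)).
  apply: ler_sum => k _; rewrite meanZ// ler_wpM2l//.
  by rewrite divr_ge0 ?mulr_ge0// ltW.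
rewrite sumr_const card_ord -mulr_natl le_eqVlt; apply/orP; left; apply/eqP.
by field; rewrite gt_eqF.
Qed.

(** The common bound on second moments supplies tightness, so that a single trigonometric polynomial
    replaces f both for all large N and for the limit. *)
Theorem cvg_of_cvg_cos (XN : nat -> 'I_n -> Om -> R) (X : 'I_n -> Om' -> R) (C : R)
    (f : 'rV[R]_n -> R) (B : R) :
  (forall N k, sqint P (XN N k)) -> (forall k, sqint P' (X k)) ->
  (\forall N \near \oo, forall k, mean P (fun w => XN N k w ^+ 2) <= C) ->
  (forall (l : 'I_n -> R) th,
    (fun N => mean P (fun w => cos (\sum_k l k * XN N k w + th))) @ \oo -->
    mean P' (fun w => cos (\sum_k l k * X k w + th))) ->
  continuous f -> (forall x, `|f x| <= B) ->
  (fun N => mean P (fun w => f (\row_k XN N k w))) @ \oo -->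
  mean P' (fun w => f (\row_k X k w)).
Proof.
move=> XN2 X2 XNC hcos cf fB.
have B0 : 0 <= B by exact: le_trans (fB 0).
pose C1 := Num.max 0 C + \sum_k mean P' (fun w => X k w ^+ 2).
have X20 k : 0 <= mean P' (fun w => X k w ^+ 2).
  by exact: mean_sqr_ge0.
have C10 : 0 <= C1 by rewrite addr_ge0 ?sumr_ge0// le_max lexx.
have XC k : mean P' (fun w => X k w ^+ 2) <= C1.
  rewrite /C1 (bigD1 k)//= addrCA lerDl addr_ge0 ?sumr_ge0//.
  by rewrite le_max lexx.
apply/cvgrPdist_le => eps eps0.
have e8 : 0 < eps / 8 by rewrite divr_gt0.
pose K := 2 * B * n%:R * C1.
have K0 : 0 <= K by rewrite !mulr_ge0.
(* Since M >= 1, this gives K <= (eps / 8) M <= (eps / 8) M^2. *)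
pose M := 1 + K / (eps / 8).
have M1 : 1 <= M by rewrite lerDl divr_ge0// ltW.
have M0 : 0 < M by exact: lt_le_trans M1.
have hM : K / M ^+ 2 <= eps / 8.
  rewrite ler_pdivrMr ?exprn_gt0//.
  apply: (@le_trans _ _ (eps / 8 * M)).
    by rewrite mulrDr mulr1 (mulrC _ (K / _)) divfK ?gt_eqF// lerDr ltW.
  apply: ler_wpM2l; first exact: ltW.
  by rewrite expr2 ler_peMl// ltW.
have [T [tT TB hT]] := trig_approx cf fB M0 e8.
have cT : (fun N => mean P (fun w => T (\row_k XN N k w))) @ \oo -->
    mean P' (fun w => T (\row_k X k w)).
  have [s hs] := tT.
  have e0 d0 (O : measurableType d0) (Q : probability O R) (Y : 'I_n -> O -> R) :
      (forall k, measurable_fun setT (Y k)) ->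
      mean Q (fun w => T (\row_k Y k w)) =
      \sum_(p <- s) p.1.1 * mean Q (fun w => cos (\sum_k p.1.2 ord0 k * Y k w + p.2)).
    move=> mY.
    have ic (p : R * 'rV[R]_n * R) :
        integ Q (fun w => cos (\sum_k p.1.2 ord0 k * Y k w + p.2)).
      apply: integ_cos_shift; apply: measurable_sum => k.
      by apply: measurable_funM => //; exact: measurable_cst.
    rewrite (eq_mean Q (g := fun w => \sum_(p <- s)
      p.1.1 * cos (\sum_k p.1.2 ord0 k * Y k w + p.2))); last first.
      move=> w; rewrite hs; apply: eq_bigr => p _.
      by congr (_ * cos (_ + _)); apply: eq_bigr => k _; rewrite mxE.
    rewrite mean_sum; last by move=> p; exact: integZ.
    by apply: eq_bigr => p _; rewrite meanZ.
  rewrite e0; last by move=> k; case: (X2 k).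
  have e1 N := e0 _ _ P (XN N) (fun k => (XN2 N k).1).
  under eq_fun do rewrite e1.
  pose F (p : R * 'rV[R]_n * R) N :=
    p.1.1 * mean P (fun w => cos (\sum_k p.1.2 ord0 k * XN N k w + p.2)).
  change ((fun N => \sum_(p <- s) F p N) @ \oo --> \sum_(p <- s)
    p.1.1 * mean P' (fun w => cos (\sum_k p.1.2 ord0 k * X k w + p.2))).
  elim: s {hs e0 e1} => [|p s IH].
    by rewrite big_nil; under eq_fun do rewrite big_nil; exact: cvg_cst.
  have -> : (fun N => \sum_(p <- p :: s) F p N) = (fun N => F p N + \sum_(p <- s) F p N).
    by apply/funext => N; rewrite big_cons.
  by rewrite big_cons; apply: cvgD => //; apply: cvgM; [exact: cvg_cst|exact: hcos].
have /cvgrPdist_le/(_ (eps / 2)) := cT.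
rewrite divr_gt0// => /(_ isT) cT'.
near=> N.
have hN : forall k, mean P (fun w => XN N k w ^+ 2) <= C1.
  have h : forall k, mean P (fun w => XN N k w ^+ 2) <= C by near: N.
  move=> k; rewrite (le_trans (h k))// /C1 (@le_trans _ _ (Num.max 0 C))//.
    by rewrite le_max lexx orbT.
  by rewrite lerDl sumr_ge0.
have h1 := tail_mean X2 XC cf fB TB tT M0 (ltW e8) hT.
have h2 := tail_mean (XN2 N) hN cf fB TB tT M0 (ltW e8) hT.
have h3 : `|mean P' (fun w => T (\row_k X k w)) -
  mean P (fun w => T (\row_k XN N k w))| <= eps / 2 by near: N.
rewrite -/K in h1 h2.
move: h1 h2 h3; set a := mean P' _; set b := mean P' _; set a' := mean P _; set b' := mean P _.
move=> h1 h2 h3; have -> : b - b' = (a' - b') - (a - b) + (a - a') by ring.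
apply: (le_trans (ler_normD _ _)).
have := ler_normB (a' - b') (a - b).
by lra.
Unshelve. all: by end_near. Qed.

End continuity_theorem.

(** * Laws on the real line and their cosine means *)

Section laws_on_the_line.
Context (R : realType).
Local Notation RR := (measurableTypeR R).

Lemma measure_eq_rays (m1 m2 : {measure set RR -> \bar R}) :
  (m1 setT < +oo)%E -> (forall x : R, m1 `]x, +oo[%classic = m2 `]x, +oo[%classic) ->
  forall B, measurable B -> m1 B = m2 B.
Proof.
move=> m1oo m12 B mB.
apply: (@measure_unique _ R RR (@RGenOInfty.G R) (fun k => `]- k%:R, +oo[%classic)) => //.
- exact: RGenOInfty.measurableE.
- move=> _ _ [x ->] [y ->]; exists (Num.max x y).
  apply/seteqP; split => z /=; rewrite !in_itv/= !andbT gt_max.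
    by move=> [-> ->].
  by move=> /andP[].
- by move=> k; exists (- k%:R).
- apply/seteqP; split => // x _; exists (Num.truncn `|x|).+1 => //=.
  rewrite in_itv/= andbT ltrNl (le_lt_trans (ler_norm (- x)))// normrN.
  exact: truncnS_gt.
- by move=> _ [x ->]; exact: m12.
- by move=> k; apply: le_lt_trans m1oo; apply: le_measure; rewrite ?inE.
Qed.

(** Continuous functions with values in [0, 1] that converge pointwise to the indicator of the open
    ray ]r, +oo[, the point r included. *)
Definition ramp (r : R) (k : nat) (x : R) : R :=
  Num.max 0 (Num.min 1 (k%:R * (x - r))).

Lemma ramp_ge0 r k x : 0 <= ramp r k x.
Proof. by rewrite /ramp le_max lexx. Qed.

Lemma ramp_le1 r k x : ramp r k x <= 1.
Proof. by rewrite /ramp ge_max ler01/= ge_min lexx. Qed.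

Lemma ramp_norm r k x : `|ramp r k x| <= 1.
Proof. by rewrite ger0_norm ?ramp_ge0// ramp_le1. Qed.

Lemma continuous_ramp r k : continuous (ramp r k).
Proof.
move=> x; apply: (@continuous_comp _ _ _ (fun x : R => k%:R * (x - r))
  (fun u => Num.max 0 (Num.min 1 u))).
  by apply: cvgM; [exact: cvg_cst|apply: cvgB; [exact: cvg_id|exact: cvg_cst]].
have -> : (fun u : R => Num.max 0 (Num.min 1 u)) =
    (fun u => (truncate 1 (2 * u - 1) + 1) / 2).
  apply/funext => u; rewrite /truncate; case: (leP 1 u) => h1.
    have -> : Num.min (2 * u - 1) 1 = 1 by apply/min_idPr; lra.
    have -> : Num.max (- 1) (1 : R) = 1 by apply/max_idPr; lra.
    rewrite (max_idPr _) ?ler01//; lra.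
  have -> : Num.min (2 * u - 1) 1 = 2 * u - 1 by apply/min_idPl; lra.
  case: (leP 0 u) => h2.
    by have -> : Num.max (- 1) (2 * u - 1) = 2 * u - 1 by [apply/max_idPr; lra]; lra.
  by have -> : Num.max (- 1) (2 * u - 1) = - 1 by [apply/max_idPl; lra]; lra.
apply: cvgM; last exact: cvg_cst.
apply: cvgD; last exact: cvg_cst.
apply: (@continuous_comp _ _ _ (fun u : R => 2 * u - 1) (truncate 1)).
  by apply: cvgB; [apply: cvgM; [exact: cvg_cst|exact: cvg_id]|exact: cvg_cst].
exact: continuous_truncate.
Qed.

Lemma ramp_cvg r x : (fun k => ramp r k x) @ \oo --> (\1_(`]r, +oo[%classic) x : R).
Proof.
apply/cvgrPdist_lt => e e0; rewrite indicE; have [xr|rx] := ltP r x; last first.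
  rewrite memNset /=; last by rewrite in_itv/= andbT; apply/negP; rewrite -leNgt.
  near=> k; rewrite /ramp; have h : k%:R * (x - r) <= 0.
    by rewrite mulr_ge0_le0// subr_le0.
  rewrite (max_idPl _) ?subrr ?normr0//.
  by rewrite ge_min h orbT.
rewrite mem_set/=; last by rewrite in_itv/= andbT.
near=> k; rewrite /ramp; have h : 1 <= k%:R * (x - r).
  rewrite -ler_pdivrMr ?subr_gt0// mul1r; near: k.
  exact: nbhs_infty_ger.
by rewrite (min_idPl h) (max_idPr ler01) subrr normr0.
Unshelve. all: by end_near. Qed.

Lemma mean_ramp_cvg d (T : measurableType d) (P : probability T R) (X : T -> R)
    (f : T -> R) (c r : R) :
  measurable_fun setT X -> measurable_fun setT f -> (forall w, `|f w| <= c) ->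
  (fun k => mean P (fun w => ramp r k (X w) * f w)) @ \oo -->
  mean P (fun w => \1_(`]r, +oo[%classic) (X w) * f w).
Proof.
move=> mX mf fc; apply: (integ_dominated_cvg (g := fun=> c)).
- move=> k; apply: measurable_funM => //; apply: (measurableT_comp (f := ramp r k)) => //.
  by apply: continuous_measurable_fun; exact: continuous_ramp.
- apply: measurable_funM => //.
  have -> : (fun w => \1_(`]r, +oo[%classic) (X w)) = \1_(X @^-1` `]r, +oo[%classic) :> (T -> R).
    by apply/funext => w; rewrite !indicE.
  by apply: measurable_indic; rewrite -[X in measurable X]setTI; exact: mX.
- exact: integ_cst.
- by move=> w; apply: cvgM; [exact: ramp_cvg|exact: cvg_cst].
- move=> k w; rewrite normrM (le_trans _ (fc w))// ler_piMl//.
  exact: ramp_norm.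
Qed.

Lemma mean_indic d (T : measurableType d) (P : probability T R) (A : set T) :
  measurable A -> (mean P (\1_A) )%:E = P A.
Proof.
move=> mA; rewrite /mean /Rintegral integral_indic// setIT fineK//.
by rewrite ge0_fin_numE// (le_lt_trans (probability_le1 P mA))// ltry.
Qed.

(** Uniqueness is the continuity theorem for a constant sequence: the mean of a ramp under [P1],
    seen as a constant sequence, converges to its mean under [P2]. Ramps then tend to indicators of
    rays. *)
Lemma law_eq_cos (P1 P2 : probability RR R) :
  sqint P1 (@idfun R) -> sqint P2 (@idfun R) ->
  (forall a th, mean P1 (fun x => cos (a * x + th)) = mean P2 (fun x => cos (a * x + th))) ->
  forall B, measurable B -> P1 B = P2 B.
Proof.
move=> h1 h2 hcos; apply: measure_eq_rays.
  by apply: le_lt_trans (probability_le1 P1 measurableT) _; exact: ltry.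
move=> r.
have cr k : mean P1 (fun x => ramp r k x * 1) = mean P2 (fun x => ramp r k x * 1).
  have H := @cvg_of_cvg_cos _ _ _ _ _ P1 P2 1 (fun _ _ => idfun) (fun _ => idfun)
    (mean P1 (fun x => x ^+ 2)) (fun v : 'rV[R]_1 => ramp r k (v ord0 ord0)) 1.
  have : (fun=> mean P1 (fun x => ramp r k x * 1)) @ \oo --> mean P2 (fun x => ramp r k x * 1).
    rewrite (eq_mean P1 (g := fun w => ramp r k ((\row_(_ < 1) w) ord0 ord0))); last first.
      by move=> w; rewrite mulr1 mxE.
    rewrite (eq_mean P2 (g := fun w => ramp r k ((\row_(_ < 1) w) ord0 ord0))); last first.
      by move=> w; rewrite mulr1 mxE.
    apply: H => //.
    - by apply: nearW => N k'.
    - move=> l th.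
      rewrite (eq_mean P1 (g := fun x => cos (l ord0 * x + th))); last first.
        by move=> w; rewrite big_ord1.
      rewrite (eq_mean P2 (g := fun x => cos (l ord0 * x + th))); last first.
        by move=> w; rewrite big_ord1.
      by rewrite hcos; exact: cvg_cst.
    - move=> v; apply: (@continuous_comp _ _ _ (fun v : 'rV[R]_1 => v ord0 ord0) (ramp r k)).
        exact: coord_continuous.
      exact: continuous_ramp.
    - by move=> v; exact: ramp_norm.
  move=> /(cvg_unique _ (cvg_cst _)) <- //.
have n1 (x : R) : `|1 : R| <= 1 by rewrite normr1.
have c1 := @mean_ramp_cvg _ _ P1 (@idfun R) (fun=> 1) 1 r (@measurable_id _ _ _) (measurable_cst _) n1.
have c2 := @mean_ramp_cvg _ _ P2 (@idfun R) (fun=> 1) 1 r (@measurable_id _ _ _) (measurable_cst _) n1.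
have : mean P1 (fun w => \1_(`]r, +oo[%classic) w * 1) = mean P2 (fun w => \1_(`]r, +oo[%classic) w * 1).
  by move: c1; rewrite (funext cr) => /cvg_unique; apply.
rewrite (eq_mean P1 (g := \1_(`]r, +oo[%classic))); last by move=> w; rewrite mulr1.
rewrite (eq_mean P2 (g := \1_(`]r, +oo[%classic))); last by move=> w; rewrite mulr1.
move=> e; transitivity (mean P1 (\1_(`]r, +oo[%classic)))%:E.
  by apply/esym/mean_indic; exact: measurable_itv.
by rewrite e; apply: mean_indic; exact: measurable_itv.
Qed.

End laws_on_the_line.

(** * The normal law *)

Section normal_law.
Context (R : realType) (s : R).
Hypothesis s0 : s != 0.
Local Notation RR := (measurableTypeR R).
Local Notation mu := (@lebesgue_measure R).
Let N : probability RR R := normal_prob 0 s.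
Let p := normal_pdf 0 s : R -> R.

Let p0 x : 0 <= p x. Proof. exact: normal_pdf_ge0. Qed.
Let mp : measurable_fun setT p. Proof. exact: measurable_normal_pdf. Qed.
Let s2 : 0 < s ^+ 2. Proof. by rewrite exprn_even_gt0. Qed.

Let pE x : p x = normal_peak s * expR (- (x ^+ 2 / (2 * s ^+ 2))).
Proof.
by rewrite /p normal_pdfE// /normal_fun subr0 -mulr_natl mulNr.
Qed.

(** The Radon-Nikodym density agrees almost everywhere with [normal_pdf], since both have the same
    integral over every measurable set. *)
Lemma integral_normal_ge0 (f : R -> R) : measurable_fun setT f -> (forall x, 0 <= f x) ->
  (\int[N]_x (f x)%:E = \int[mu]_x (f x * p x)%:E)%E.
Proof.
move=> mf f0.
have dom : N `<< mu by exact: normal_prob_dominates.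
rewrite -(Radon_Nikodym_SigmaFinite.change_of_variables dom)//; last exact/measurable_EFinP.
have e : ae_eq mu setT (Radon_Nikodym_SigmaFinite.f N mu) (EFin \o p).
  apply: integral_ae_eq => //.
  - exact: Radon_Nikodym_SigmaFinite.f_integrable.
  - exact/measurable_EFinP.
  - by move=> A _ mA; rewrite -Radon_Nikodym_SigmaFinite.f_integral.
apply: ae_eq_integral => //.
- apply: emeasurable_funM; first exact/measurable_EFinP.
  by apply: measurable_int; exact: Radon_Nikodym_SigmaFinite.f_integrable dom.
- by apply/measurable_EFinP/measurable_funM.
- by apply: filterS e => x ex _; rewrite ex// EFinM.
Qed.

(* x^2 exp(-x^2/2s^2) <= 4s^2 exp(-x^2/4s^2), a multiple of the density with
   variance 2s^2 *)
Let s' := Num.sqrt 2 * s.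
Let s'0 : s' != 0.
Proof. by rewrite mulf_neq0// sqrtr_eq0 -ltNge. Qed.

Let p_tail x : (1 + x ^+ 2) * p x <= (1 + 4 * s ^+ 2) * normal_peak s * normal_fun 0 s' x.
Proof.
rewrite pE.
have e1 (a b c : R) : a * (b * c) = b * (a * c) by ring.
have e2 (a b c : R) : a * b * c = b * (a * c) by ring.
rewrite e1 e2; apply: ler_wpM2l; first exact: normal_peak_ge0.
have -> : normal_fun 0 s' x = expR (- (x ^+ 2 / (4 * s ^+ 2))).
  rewrite /normal_fun subr0 /s' exprMn sqr_sqrtr// -mulr_natl mulrA -natrM.
  by rewrite mulNr.
set u := x ^+ 2 / (4 * s ^+ 2).
have u0 : 0 <= u by rewrite divr_ge0 ?sqr_ge0// mulr_ge0// ltW.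
have -> : x ^+ 2 / (2 * s ^+ 2) = u + u by rewrite /u; field; exact: s0.
have xu : x ^+ 2 = 4 * s ^+ 2 * u by rewrite /u; field; exact: s0.
rewrite opprD expRD mulrA ler_wpM2r ?expR_ge0//.
rewrite xu expRN ler_pdivrMr ?expR_gt0//.
have h := expR_ge1Dx u.
have : 0 <= 4 * s ^+ 2 by rewrite mulr_ge0// ltW.
by nra.
Qed.

Let integrable_tail : mu.-integrable setT (EFin \o (fun x => (1 + x ^+ 2) * p x)).
Proof.
pose c := (1 + 4 * s ^+ 2) * normal_peak s / normal_peak s'.
have i1 : mu.-integrable setT (fun x => (c%:E * (normal_pdf 0 s' x)%:E)%E).
  by apply: integrableZl => //; exact: integrable_normal_pdf.
apply: (le_integrable _ _ _ i1) => //.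
  apply/measurable_EFinP/measurable_funM => //.
  by apply: measurable_funD => //; exact: measurable_funX.
move=> x _; rewrite /= lee_fin ger0_norm ?mulr_ge0 ?addr_ge0 ?sqr_ge0//.
apply: (le_trans (p_tail x)); apply: (le_trans _ (ler_norm _)).
rewrite normal_pdfE// /c [leRHS]mulrA divfK// gt_eqF//.
exact: normal_peak_gt0.
Qed.

Let qbound (f : R -> R) := exists C, forall x, `|f x| <= C * (1 + x ^+ 2).

Let integrable_qbound (f : R -> R) : measurable_fun setT f -> qbound f ->
  mu.-integrable setT (EFin \o (fun x => f x * p x)).
Proof.
move=> mf [C fC].
have i1 : mu.-integrable setT (fun x => (C%:E * ((1 + x ^+ 2) * p x)%:E)%E).
  by apply: integrableZl => //; exact: integrable_tail.
apply: (le_integrable _ _ _ i1) => //.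
  exact/measurable_EFinP/measurable_funM.
move=> x _; rewrite /= lee_fin normrM (ger0_norm (p0 x)) mulrA.
by apply: (le_trans _ (ler_norm _)); rewrite ler_wpM2r.
Qed.

Lemma integ_normal (f : R -> R) : measurable_fun setT f -> qbound f -> integ N f.
Proof.
move=> mf [C fC]; apply/integrableP; split; first exact/measurable_EFinP.
under eq_integral do rewrite /= .
rewrite integral_normal_ge0; [|exact: measurableT_comp|by []].
have := integrable_qbound (f := fun x => `|f x|).
move=> /(_ _ _)/integrableP[]; first exact: measurableT_comp.
  by exists C => x; rewrite normr_id.
move=> _; under eq_integral do rewrite /= ger0_norm ?mulr_ge0//.
by [].
Qed.

(** Adding C (1 + x^2) makes f nonnegative, so that [integral_normal_ge0] applies; the added
    function is removed by linearity. *)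
Lemma mean_normal (f : R -> R) : measurable_fun setT f -> qbound f ->
  mean N f = \int[mu]_x (f x * p x).
Proof.
move=> mf [C fC].
have C0 : 0 <= C by have := fC 0; rewrite expr0n/= addr0 mulr1; exact: le_trans.
pose g x := C * (1 + x ^+ 2).
have mg : measurable_fun setT g.
  by apply: measurable_funM => //; apply: measurable_funD => //; exact: measurable_funX.
have g0 x : 0 <= g x by rewrite mulr_ge0// addr_ge0// sqr_ge0.
have qg : qbound g by exists C => x; rewrite ger0_norm.
have qf : qbound f by exists C.
have pos (h : R -> R) : measurable_fun setT h -> (forall x, 0 <= h x) -> mean N h = \int[mu]_x (h x * p x).
  by move=> mh h0; rewrite /mean /Rintegral integral_normal_ge0.
have -> : mean N f = mean N (fun x => f x + g x) - mean N g.
  by rewrite meanD ?addrK//; exact: integ_normal.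
rewrite pos//; last 2 first.
- exact: measurable_funD.
- by move=> x; have := fC x; rewrite ler_norml -/(g x) => /andP[]; lra.
rewrite pos//.
under eq_Rintegral do rewrite mulrDl.
by rewrite RintegralD ?addrK//; exact: integrable_qbound.
Qed.

Let is_derive_p (x : R) : is_derive x 1 p (- (x / s ^+ 2) * p x).
Proof.
have -> : p = (fun x => normal_peak s * expR ((- (2 * s ^+ 2)^-1) * x ^+ 2)).
  by apply/funext => z; rewrite pE mulrC [in RHS]mulrC; congr (expR _ * _); ring.
have h := is_derive_scaled_exp 1 (- (2 * s ^+ 2)^-1) x.
have h2 := is_derive1_comp (f := expR) (g := fun x => (- (2 * s ^+ 2)^-1) * x ^+ 2) (is_derive_expR _) h.
have h3 := is_deriveZ (normal_peak s) h2.
refine (is_derive_eq h3 _).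
by rewrite /GRing.scale/=; field; exact: s0.
Qed.

(** Integration by parts on growing intervals: (h p)' = k p with k = h' - x h / s^2, and the
    boundary terms tend to 0, so k has mean 0. *)
Lemma stein (h dh : R -> R) : (forall x : R, is_derive x 1 h (dh x)) -> continuous dh ->
  qbound h -> qbound dh -> qbound (fun x : R => x * h x) ->
  mean N (fun x : R => x * h x) = s ^+ 2 * mean N dh.
Proof.
move=> hh cdh [C hC] qdh qxh.
have ch : continuous h.
  move=> x; have [dx _] := hh x.
  exact/differentiable_continuous/derivable1_diffP.
have cp : continuous p by exact: continuous_normal_pdf.
have mh : measurable_fun setT h by exact: continuous_measurable_fun.
have mdh : measurable_fun setT dh by exact: continuous_measurable_fun.
have mxh : measurable_fun setT (fun x : R => x * h x) by exact: measurable_funM.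
pose k x := dh x - (s ^+ 2)^-1 * (x * h x).
have mk : measurable_fun setT k.
  by apply: measurable_funB => //; apply: measurable_funM => //.
have [C1 hC1] := qdh; have [C2 hC2] := qxh.
have k_le x : `|k x| <= (C1 + (s ^+ 2)^-1 * C2) * (1 + x ^+ 2).
  apply: (le_trans (ler_normB _ _)); rewrite mulrDl; apply: lerD => //.
  by rewrite normrM gtr0_norm ?invr_gt0// -mulrA ler_wpM2l// invr_ge0 ltW.
have qk : qbound k by exists (C1 + (s ^+ 2)^-1 * C2).
have ck : continuous k.
  move=> x; apply: cvgB; first exact: cdh.
  by apply: cvgM; [exact: cvg_cst|apply: cvgM; [exact: cvg_id|exact: ch]].
pose I (n : nat) : set R := `[- n.+1%:R, n.+1%:R]%classic.
have FTC n : mean N (fun x => k x * \1_(I n) x) =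
    h n.+1%:R * p n.+1%:R - h (- n.+1%:R) * p (- n.+1%:R).
  have q1 : qbound (fun x => k x * \1_(I n) x).
    exists (C1 + (s ^+ 2)^-1 * C2) => x; apply: le_trans (k_le x).
    rewrite normrM ler_piMr// indicE; case: (_ \in _) => /=.
      by rewrite normr1.
    by rewrite normr0.
  have mI : measurable_fun setT (\1_(I n) : R -> R).
    by apply: measurable_indic; exact: measurable_itv.
  rewrite mean_normal//; last exact: measurable_funM.
  have -> : \int[mu]_x (k x * \1_(I n) x * p x) = \int[mu]_(x in I n) (k x * p x).
    rewrite [RHS]Rintegral_mkcond; apply: eq_Rintegral => x _.
    rewrite patchE indicE; case: (_ \in _) => /=; first by rewrite mulr1.
    by rewrite mulr0 mul0r.
  have hg (x : R) : is_derive x 1 (fun x => h x * p x) (k x * p x).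
    refine (is_derive_eq (is_deriveM (hh x) (is_derive_p x)) _).
    rewrite /GRing.scale/= /k; ring.
  have cg : continuous (fun x => h x * p x).
    by move=> x; apply: cvgM; [exact: ch|exact: cp].
  rewrite /Rintegral (@continuous_FTC2 _ _ (fun x => h x * p x)).
  - by [].
  - by rewrite -subr_gt0 opprK addr_gt0.
  - apply: continuous_subspaceT => x.
    by apply: cvgM; [exact: ck|exact: cp].
  - split.
    + by move=> x _; have [] := hg x.
    + exact/cvg_at_right_filter/cg.
    + exact/cvg_at_left_filter/cg.
  - by move=> x _; rewrite derive1E; have [_] := hg x.
have lim1 : (fun n => mean N (fun x => k x * \1_(I n) x)) @ \oo --> mean N k.
  apply: (@integ_dominated_cvg _ RR R N (fun n x => k x * \1_(I n) x) k (fun x => `|k x|)).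
  - move=> n; apply: measurable_funM => //.
    by apply: measurable_indic; exact: measurable_itv.
  - exact: mk.
  - by apply: integ_norm; exact: integ_normal.
  - move=> x; apply/cvgrPdist_lt => e e0; near=> n.
    rewrite indicE mem_set ?mulr1 ?subrr ?normr0//.
    rewrite /I/= in_itv/= -ler_norml.
    apply: (@le_trans _ _ n%:R); last by rewrite ler_nat.
    by near: n; exact: nbhs_infty_ger.
  - move=> n x; rewrite normrM ler_piMr// indicE; case: (_ \in _) => /=.
      by rewrite normr1.
    by rewrite normr0.
have hp x : 1 <= `|x| -> `|h x * p x| <=
    (C * ((1 + 4 * s ^+ 2) * normal_peak s) * (2 * s' ^+ 2)) * `|x|^-1.
  move=> x1; have x0 : 0 < `|x| by exact: lt_le_trans x1.
  rewrite normrM (ger0_norm (p0 x)).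
  have C0 : 0 <= C by have := hC 0; rewrite expr0n/= addr0 mulr1; exact: le_trans.
  apply: (@le_trans _ _ (C * ((1 + x ^+ 2) * p x))); first by rewrite mulrA ler_wpM2r.
  rewrite -!mulrA ler_wpM2l// (le_trans (p_tail x))// -!mulrA.
  have s40 : 0 <= 1 + 4 * s ^+ 2 by rewrite addr_ge0// mulr_ge0// ltW.
  rewrite ler_wpM2l// ler_wpM2l ?normal_peak_ge0//.
  have s'2 : 0 < s' ^+ 2 by rewrite exprn_even_gt0.
  rewrite /normal_fun subr0 -mulr_natl mulNr expRN.
  set u := x ^+ 2 / (2 * s' ^+ 2).
  have xu : `|x| <= 2 * s' ^+ 2 * u.
    have -> : 2 * s' ^+ 2 * u = `|x| ^+ 2.
      by rewrite real_normK ?num_real// /u; field; exact: s'0.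
    by rewrite expr2 ler_peMl// ltW.
  have u0 : 0 <= u by rewrite divr_ge0 ?sqr_ge0// mulr_ge0// ltW.
  have hu : (expR u)^-1 <= 2 * s' ^+ 2 / `|x|.
    rewrite ler_pdivlMr// mulrC ler_pdivrMr ?expR_gt0//.
    apply: (le_trans xu); apply: ler_wpM2l; first by rewrite mulr_ge0// ltW.
    by apply: le_trans (expR_ge1Dx u); rewrite lerDr.
  by apply: (le_trans hu); rewrite -!mulrA.
have lim2 (g : nat -> R) : (forall n, `|g n| = n.+1%:R) ->
    (fun n => h (g n) * p (g n)) @ \oo --> (0 : R).
  move=> hg; apply/norm_cvg0P.
  apply: (@squeeze_cvgr _ _ _ _ (fun=> 0) (fun n =>
    (C * ((1 + 4 * s ^+ 2) * normal_peak s) * (2 * s' ^+ 2)) * n.+1%:R^-1)).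
  - apply: nearW => n; rewrite normr_ge0/=.
    by have := hp (g n); rewrite hg ler1n => /(_ isT).
  - exact: cvg_cst.
  rewrite -[X in _ --> X](mulr0 (C * ((1 + 4 * s ^+ 2) * normal_peak s) * (2 * s' ^+ 2))).
  by apply: cvgM; [exact: cvg_cst|exact: cvg_harmonic].
have lim3 : (fun n => mean N (fun x => k x * \1_(I n) x)) @ \oo --> (0 : R).
  rewrite (funext FTC) -[X in _ --> X](subr0 (0 : R)); apply: cvgB.
    by apply: lim2 => n; rewrite ger0_norm.
  by apply: lim2 => n; rewrite normrN ger0_norm.
have k0 : mean N k = 0 by exact: (cvg_unique _ lim1 lim3).
have := k0; rewrite /k meanB; last 2 first.
- exact: integ_normal.
- by apply: integZ; exact: integ_normal.
rewrite meanZ; last exact: integ_normal.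
move=> /eqP; rewrite subr_eq0 => /eqP ->.
by rewrite mulrA mulfV ?gt_eqF// mul1r.
Unshelve. all: by end_near. Qed.

End normal_law.

Section normal_cos_transform.
Context (R : realType).
Local Notation RR := (measurableTypeR R).

Lemma cos_taylor1 (u v : R) : `|cos (u + v) - cos u + v * sin u| <= 4 * v ^+ 2.
Proof.
have -> : cos (u + v) - cos u + v * sin u =
  cos u * (cos v - 1) - sin u * (sin v - v) by rewrite cosD; ring.
have [h1 _] := cos_sub_quadratic v; have [h2 _] := sin_sub_id v.
have h3 : `|cos v - 1| <= 2 * v ^+ 2.
  have -> : cos v - 1 = (cos v - (1 - v ^+ 2 / 2)) - v ^+ 2 / 2 by ring.
  apply: (le_trans (ler_normB _ _)).
  have -> : `|v ^+ 2 / 2| = v ^+ 2 / 2 by rewrite ger0_norm// divr_ge0// sqr_ge0.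
  by have := sqr_ge0 v; lra.
apply: (le_trans (ler_normB _ _)); rewrite !normrM.
have a1 : `|cos u| * `|cos v - 1| <= `|cos v - 1| by rewrite ler_piMl// cos_max.
have a2 : `|sin u| * `|sin v - v| <= `|sin v - v| by rewrite ler_piMl// sin_max.
by lra.
Qed.

(** Replaces differentiation under the integral sign: a pointwise second order bound, once averaged,
    is a quadratic remainder for the mean. *)
Lemma is_derive_of_quadratic (f : R -> R) (a m C : R) :
  (forall h, `|f (a + h) - f a - h * m| <= C * h ^+ 2) -> is_derive a 1 f m.
Proof.
move=> H.
have C0 : 0 <= C by have := H 1; rewrite expr1n mulr1; exact: le_trans.
have lim : (fun h : R => h^-1 *: (f (h *: (1 : R) + a) - f a)) @ (0 : R)^' --> m.
  apply/cvgrPdist_le => e e0; near=> h.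
  have h0 : h != 0 by near: h; exact: nbhs_dnbhs_neq.
  rewrite /GRing.scale/= mulr1 distrC.
  have -> : h^-1 * (f (h + a) - f a) - m = (f (a + h) - f a - h * m) / h.
    by rewrite (addrC h a); field.
  rewrite normrM normfV ler_pdivrMr ?normr_gt0//.
  apply: (le_trans (H h)); rewrite -real_normK ?num_real// expr2 mulrA ler_wpM2r//.
  rewrite (@le_trans _ _ (C * (e / (C + 1))))//.
    rewrite ler_wpM2l//; near: h; apply: dnbhs0_le; rewrite divr_gt0//; lra.
  rewrite mulrA ler_pdivrMr; last lra.
  by rewrite mulrC ler_wpM2l//; [exact: ltW|lra].
by split; [apply/cvg_ex; exists m|apply: cvg_lim].
Unshelve. all: by end_near. Qed.

Section nondegenerate.
Variable s : R.
Hypothesis s0 : s != 0.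
Let N : probability RR R := normal_prob 0 s.

Let qbound1 (f : R -> R) : (forall x, `|f x| <= 1 + `|x|) ->
  exists C, forall x, `|f x| <= C * (1 + x ^+ 2).
Proof.
move=> h; exists 2 => x; apply: (le_trans (h x)).
by rewrite -real_normK ?num_real//; have := sqr_ge0 (`|x| - 1); have := sqr_ge0 `|x|; lra.
Qed.

Lemma sqint_normal : sqint N (@idfun R).
Proof.
split; first exact: measurable_id.
apply: integ_normal; [exact: s0|apply: measurable_funX; exact: measurable_id|].
by exists 1 => x; rewrite ger0_norm ?sqr_ge0//=; lra.
Qed.

Lemma mean_normal_id : mean N (@idfun R) = 0.
Proof.
have := @stein R s s0 (cst 1) (cst 0) (fun x => is_derive_cst _ _ _).
rewrite mean_cst mulr0 => <-.
- by apply: eq_mean => x; rewrite /= mulr1.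
- by move=> x; exact: cvg_cst.
- by apply: qbound1 => x; rewrite normr1 lerDl.
- by apply: qbound1 => x; rewrite normr0 addr_ge0.
- by apply: qbound1 => x; rewrite /= mulr1 lerDr.
Qed.

Lemma mean_normal_sqr : mean N (fun x : R => x ^+ 2) = s ^+ 2.
Proof.
have := @stein R s s0 (@idfun R) (cst 1) (fun x => is_derive_id _ _).
rewrite mean_cst mulr1 => <-.
- by apply: eq_mean => x; rewrite /= expr2.
- by move=> x; exact: cvg_cst.
- by apply: qbound1 => x; rewrite lerDr.
- by apply: qbound1 => x; rewrite normr1 lerDl.
- by exists 1 => x; rewrite mul1r -expr2 ger0_norm ?sqr_ge0//; lra.
Qed.

(** The identity [stein] for sin (b x + th) shows that the cosine mean satisfies psi' (b) = - s^2 b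
    psi (b), so psi (b) exp (s^2 b^2 / 2) is constant. *)
Lemma mean_normal_cos (a th : R) :
  mean N (fun x => cos (a * x + th)) = expR (- (s ^+ 2 * a ^+ 2 / 2)) * cos th.
Proof.
pose psi a := mean N (fun x => cos (a * x + th)).
have mlin b : measurable_fun setT (fun x : R => b * x).
  by apply: measurable_funM => //; exact: measurable_cst.
have msin b : measurable_fun setT (fun x : R => sin (b * x + th)).
  apply: (measurable_sin_comp (X := fun x : R => b * x + th)).
  by apply: measurable_funD => //; exact: measurable_cst.
have ic b : integ N (fun x : R => cos (b * x + th)) by exact: integ_cos_shift.
have ix2 : integ N (fun x : R => x ^+ 2) by case: sqint_normal.
have isx b : integ N (fun x : R => x * sin (b * x + th)).
  apply: (@le_integ _ RR R N (fun x : R => x * sin (b * x + th)) (fun x : R => `|x|)).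
  - by apply: measurable_funM; [exact: measurable_id|exact: msin].
  - exact/integ_norm/sqint_integ/sqint_normal.
  - by move=> x; rewrite normrM ler_piMr// sin_max.
have hst b : mean N (fun x : R => x * sin (b * x + th)) = s ^+ 2 * (b * psi b).
  have hd (x : R) : is_derive x (1 : R) (fun x : R => sin (b * x + th)) (b * cos (b * x + th)).
    have h1 : is_derive x (1 : R) (fun x : R => b * x + th) b.
      have h2 := is_derive_scaled_exp 0 b x.
      have e : (fun x : R => b * x + th) = (fun y => b * y ^+ 1 + (cst th) y).
        by apply/funext => y; rewrite expr1.
      rewrite e; refine (is_derive_eq (is_deriveD h2 (is_derive_cst _ _ _)) _).
      by rewrite expr0 !mulr1 addr0.
    refine (is_derive_eq (is_derive1_comp (f := sin) (is_derive_sin _) h1) _).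
    by rewrite [LHS]mulrC.
  rewrite (stein s0 hd).
  - by rewrite (meanZ b (ic b)).
  - move=> x; apply: cvgM; first exact: cvg_cst.
    apply: (continuous_comp (f := fun x => b * x + th)); last exact: continuous_cos.
    apply: cvgD; last exact: cvg_cst.
    by apply: cvgM; [exact: cvg_cst|exact: cvg_id].
  - by apply: qbound1 => x; rewrite (le_trans (sin_max _))// lerDl.
  - exists `|b| => x; rewrite normrM ler_wpM2l// (le_trans (cos_max _))//.
    by rewrite lerDl sqr_ge0.
  - by apply: qbound1 => x; rewrite normrM (@le_trans _ _ `|x|)// ?lerDr// ler_piMr// sin_max.
have dpsi b : is_derive b (1 : R) psi (- (s ^+ 2 * (b * psi b))).
  apply: (@is_derive_of_quadratic _ _ _ (4 * s ^+ 2)) => h.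
  rewrite mulrN opprK -hst /psi -meanB// -meanZ// -meanD; last 2 first.
  - exact: integB.
  - exact: integZ.
  rewrite -mean_normal_sqr -mulrA [_ * h ^+ 2]mulrC mulrA -meanZ//.
  apply: norm_mean_le.
  - apply: integ_meas; apply: integD; [exact: integB|exact: integZ].
  - exact: integZ.
  move=> x; have := cos_taylor1 (b * x + th) (h * x).
  have -> : b * x + th + h * x = (b + h) * x + th by ring.
  by rewrite exprMn !mulrA.
pose chi b := psi b * expR (s ^+ 2 / 2 * b ^+ 2).
have dchi (b : R) : is_derive b (1 : R) chi 0.
  have h := is_derive_scaled_exp 1 (s ^+ 2 / 2) b.
  have h2 := is_derive1_comp (f := expR) (g := fun x => (s ^+ 2 / 2) * x ^+ 2) (is_derive_expR _) h.
  refine (is_derive_eq (is_deriveM (dpsi b) h2) _).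
  by rewrite /GRing.scale/=; field.
have := @is_derive_0_is_cst R chi a 0 dchi.
rewrite /chi expr0n/= mulr0 expR0 mulr1.
have -> : psi 0 = cos th.
  rewrite /psi -[RHS](mean_cst N); apply: eq_mean => x.
  by rewrite mul0r add0r.
move=> <-; rewrite mulrCA -expRD -/(psi a).
have -> : - (s ^+ 2 * a ^+ 2 / 2) + s ^+ 2 / 2 * a ^+ 2 = 0 by ring.
by rewrite expR0 mulr1.
Qed.

End nondegenerate.

Section gaussian_laws.
Context d (T : measurableType d) (P : probability T R).

Lemma mean_distribution (X : {RV P >-> RR}) (f : R -> R) : measurable_fun setT f ->
  integ P (fun w => f (X w)) ->
  integ (distribution P X) f /\ mean (distribution P X) f = mean P (fun w => f (X w)).
Proof.
move=> mf iX; have mX : measurable_fun setT X by [].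
have mEf : measurable_fun setT (EFin \o f) by exact/measurable_EFinP.
split; first by apply: integrable_pushforward.
by rewrite /mean /Rintegral (integral_pushforward mX mEf iX).
Qed.

(** The law is identified first, by [law_eq_cos], and the moments are read off the identified law.
    For s = 0 the comparison is with the Dirac mass. *)
Lemma gaussian_law_of_cos (X : T -> R) (s : R) : sqint P X ->
  (forall a th, mean P (fun w => cos (a * X w + th)) =
    expR (- (s ^+ 2 * a ^+ 2 / 2)) * cos th) ->
  (forall B : set R, measurable B -> P [set w | B (X w)] = gaussian_law 0 s B) /\
  (mean P X = 0 /\ mean P (fun w => X w ^+ 2) = s ^+ 2).
Proof.
move=> X2 hcos; have mX : measurable_fun setT X by case: X2.
pose MF := isMeasurableFun.Build _ _ T RR X mX.
pose J : {mfun T >-> RR} := HB.pack X MF.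
pose Q : probability RR R := distribution P J.
have [i2 m2] : integ (Q) (fun x : R => x ^+ 2) /\
    mean (Q) (fun x : R => x ^+ 2) = mean P (fun w => X w ^+ 2).
  by apply: mean_distribution; [exact: measurable_funX|case: X2].
have [i1 m1] : integ (Q) (@idfun R) /\
    mean (Q) (@idfun R) = mean P X.
  by apply: mean_distribution; [exact: measurable_id|exact: sqint_integ].
have sJ : sqint (Q) (@idfun R) by split; [exact: measurable_id|].
have cJ a th : mean (Q) (fun x : R => cos (a * x + th)) =
    mean P (fun w => cos (a * X w + th)).
  have mc : measurable_fun setT (fun x : R => cos (a * x + th)).
    by apply: measurable_cos_shift; apply: measurable_funM => //; exact: measurable_cst.
  apply: (proj2 (mean_distribution (X := J) mc _)).
  by apply: integ_cos_shift; apply: measurable_funM => //; exact: measurable_cst.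
have [z|s0] := eqVneq s 0.
  pose D : probability RR R := @dirac _ RR (0 : R) R.
  have emD (f : R -> R) : measurable_fun setT f -> integ D f /\ mean D f = f 0.
    move=> mf; have h : (\int[D]_x (f x)%:E = (f 0)%:E)%E.
      by rewrite integral_dirac ?diracT ?mul1e//; exact/measurable_EFinP.
    split; last by rewrite /mean /Rintegral h.
    apply/integrableP; split; first exact/measurable_EFinP.
    rewrite integral_dirac ?diracT ?mul1e ?ltry//.
    by apply: measurableT_comp => //; exact/measurable_EFinP.
  have law : forall B, measurable B -> Q B = D B.
    apply: (@law_eq_cos R (Q) D) => //.
      by split; [exact: measurable_id|apply: (proj1 (emD _ _)); apply: measurable_funX; exact: measurable_id].
    move=> a th; rewrite cJ hcos (proj2 (emD _ _)).
      by rewrite z mulr0 add0r expr0n/= mul0r mul0r oppr0 expR0 mul1r.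
    by apply: measurable_cos_shift; apply: measurable_funM => //; exact: measurable_cst.
  have emean (f : R -> R) : mean (Q) f = mean D f.
    rewrite /mean /Rintegral; congr fine; apply: eq_measure_integral => A mA _.
    exact: law.
  split; last first.
    rewrite -m1 -m2 z !emean; split; first exact: (proj2 (emD _ (@measurable_id _ _ _))).
    by rewrite (proj2 (emD _ (measurable_funX _ (@measurable_id _ _ _)))).
  by move=> B mB; rewrite /gaussian_law z eqxx -(law B).
have law : forall B, measurable B -> Q B = normal_prob 0 s B.
  apply: (@law_eq_cos R (Q) (normal_prob 0 s)) => //; first exact: sqint_normal.
  by move=> a th; rewrite cJ hcos mean_normal_cos.
have emean (f : R -> R) : mean (Q) f = mean (normal_prob 0 s : probability RR R) f.
  rewrite /mean /Rintegral; congr fine; apply: eq_measure_integral => A mA _.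
  exact: law.
split; last by rewrite -m1 -m2 !emean mean_normal_id// mean_normal_sqr.
by move=> B mB; rewrite /gaussian_law (negbTE s0) -(law B).
Qed.

End gaussian_laws.

End normal_cos_transform.

(** * Independent uniform variables on the unit interval *)

Section digit_splitting.
Context (R : realType).
Local Notation RR := (measurableTypeR R).

(* A base 4 digit 2 a + b contributes the bit a to [odig] and b to [edig]. *)
Fixpoint odig (n m : nat) : nat :=
  if n is n'.+1 then ((odig n' (m %/ 4)).*2 + (m %% 4) %/ 2)%N else 0%N.
Fixpoint edig (n m : nat) : nat :=
  if n is n'.+1 then ((edig n' (m %/ 4)).*2 + (m %% 4) %% 2)%N else 0%N.

Lemma odig_lt n m : (odig n m < 2 ^ n)%N.
Proof.
elim: n m => [|n IH] m //=.
have h := IH (m %/ 4)%N; have h2 : (m %% 4 < 4)%N by rewrite ltn_mod.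
rewrite expnS; set a := odig _ _ in h *; set b := (2 ^ n)%N in h *.
by set r := (m %% 4)%N in h2 *; lia.
Qed.

Lemma edig_lt n m : (edig n m < 2 ^ n)%N.
Proof.
elim: n m => [|n IH] m //=.
have h := IH (m %/ 4)%N; have h2 : (m %% 4 < 4)%N by rewrite ltn_mod.
rewrite expnS; set a := edig _ _ in h *; set b := (2 ^ n)%N in h *.
by set r := (m %% 4)%N in h2 *; lia.
Qed.

Lemma digits_block (n k i : nat) : (i < 4)%N ->
  odig n.+1 (k * 4 + i) = (odig n k * 2 + i %/ 2)%N /\
  edig n.+1 (k * 4 + i) = (edig n k * 2 + i %% 2)%N.
Proof.
by move=> i4 /=; rewrite divnMDl// divn_small// addn0 modnMDl modn_small// !muln2.
Qed.

(** Expresses that the two digit maps together are a bijection from the numbers below 4^n onto the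
    pairs of numbers below 2^n; the induction splits off the last base 4 digit. *)
Lemma sum_digits (n : nat) (h : nat -> nat -> R) :
  \sum_(m < 4 ^ n) h (odig n m) (edig n m) =
  \sum_(i < 2 ^ n) \sum_(j < 2 ^ n) h i j.
Proof.
elim: n h => [|n IH] h; first by rewrite !expn0 !big_ord1.
rewrite !expnS [(4 * _)%N]mulnC [(2 * _)%N]mulnC.
rewrite (sum_blocks (fun m => h (odig n.+1 m) (edig n.+1 m))).
pose h' i j := \sum_(r < 2) \sum_(q < 2) h (i * 2 + r)%N (j * 2 + q)%N.
transitivity (\sum_(k < 4 ^ n) h' (odig n k) (edig n k)).
  apply: eq_bigr => k _.
  rewrite (eq_bigr (fun i : 'I_4 => h (odig n k * 2 + i %/ 2)%N (edig n k * 2 + i %% 2)%N)).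
    by rewrite /h' !big_ord_recr !big_ord0/= !add0r !addrA.
  by move=> i _; have [-> ->] := digits_block n k (ltn_ord i).
rewrite IH (sum_blocks (fun i => \sum_(j < 2 ^ n * 2) h i j)).
apply: eq_bigr => i _; rewrite [RHS]big_ord_recr [X in _ = X + _]big_ord_recr big_ord0/= add0r.
rewrite !(sum_blocks (fun j => h _ j)) -big_split/=; apply: eq_bigr => j _.
by rewrite /h' big_ord_recr [X in X + _ = _]big_ord_recr big_ord0/= add0r.
Qed.

Lemma truncn_eqP (x : R) (m : nat) : 0 <= x ->
  (Num.truncn x == m) = (m%:R <= x < m.+1%:R).
Proof. exact: truncn_eq. Qed.

(** Refining the expansion by one digit leaves the previous digits unchanged, hence the dyadic
    approximations below are nondecreasing in n. *)
Lemma truncn_div4 (x : R) : 0 <= x -> (Num.truncn (4 * x) %/ 4 = Num.truncn x)%N.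
Proof.
move=> x0; have x4 : 0 <= 4 * x by rewrite mulr_ge0.
apply/esym/eqP; rewrite truncn_eqP//.
have : (Num.truncn (4 * x) == Num.truncn (4 * x)) by [].
rewrite truncn_eqP//; set m := Num.truncn _ => /andP[h1 h2].
have e := divn_eq m 4; have r := ltn_pmod m (isT : (0 < 4)%N).
have e1 : (4 * (m %/ 4) <= m)%N by lia.
have e2 : (m.+1 <= 4 * (m %/ 4).+1)%N by lia.
move: e1 e2; rewrite -!(ler_nat R) !natrM => e1 e2.
apply/andP; split; lra.
Qed.

Definition odyad (n : nat) (x : R) : R := (odig n (Num.truncn (4 ^+ n * x)))%:R / 2 ^+ n.
Definition edyad (n : nat) (x : R) : R := (edig n (Num.truncn (4 ^+ n * x)))%:R / 2 ^+ n.

Lemma dyad_bound (n k : nat) : (k < 2 ^ n)%N -> 0 <= (k%:R / 2 ^+ n : R) <= 1.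
Proof.
move=> kn; have p2 : 0 < 2 ^+ n :> R by rewrite exprn_gt0.
by rewrite divr_ge0 ?(ltW p2)//= ler_pdivrMr// mul1r -natrX ler_nat ltnW.
Qed.

Lemma odyad_step n x : 0 <= x -> odyad n x <= odyad n.+1 x.
Proof.
move=> x0; rewrite /odyad /= exprS -mulrA truncn_div4; last first.
  by rewrite mulr_ge0// exprn_ge0.
set a := odig _ _; rewrite [2 ^+ n.+1]exprS invfM [leRHS]mulrA ler_wpM2r ?invr_ge0 ?exprn_ge0//.
rewrite ler_pdivlMr// -natrM ler_nat; lia.
Qed.

Lemma edyad_step n x : 0 <= x -> edyad n x <= edyad n.+1 x.
Proof.
move=> x0; rewrite /edyad /= exprS -mulrA truncn_div4; last first.
  by rewrite mulr_ge0// exprn_ge0.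
set a := edig _ _; rewrite [2 ^+ n.+1]exprS invfM [leRHS]mulrA ler_wpM2r ?invr_ge0 ?exprn_ge0//.
rewrite ler_pdivlMr// -natrM ler_nat; lia.
Qed.

(** The absolute value makes the approximations monotone, hence convergent, on the whole line; under
    [unif] it changes nothing. *)
Definition osplit (x : R) : R := limn (fun n => odyad n `|x|).
Definition esplit (x : R) : R := limn (fun n => edyad n `|x|).

Lemma osplit_cvg x : (fun n => odyad n `|x|) @ \oo --> osplit x.
Proof.
apply: nondecreasing_is_cvgn.
  by apply/nondecreasing_seqP => n; exact: odyad_step.
by exists 1 => _ [n _ <-]; have /andP[] := dyad_bound (odig_lt n (Num.truncn (4 ^+ n * `|x|))).
Qed.

Lemma esplit_cvg x : (fun n => edyad n `|x|) @ \oo --> esplit x.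
Proof.
apply: nondecreasing_is_cvgn.
  by apply/nondecreasing_seqP => n; exact: edyad_step.
by exists 1 => _ [n _ <-]; have /andP[] := dyad_bound (edig_lt n (Num.truncn (4 ^+ n * `|x|))).
Qed.

Lemma measurable_truncn (c : R) (h : nat -> R) : 0 < c ->
  measurable_fun setT (fun x : R => h (Num.truncn (c * `|x|))).
Proof.
move=> c0 _ B mB; rewrite setTI.
have -> : (fun x : R => h (Num.truncn (c * `|x|))) @^-1` B =
    \bigcup_(m in [set m | B (h m)])
      ((fun x : R => c * `|x|) @^-1` `[m%:R, m.+1%:R[%classic).
  apply/seteqP; split => x /=.
    move=> Bx; exists (Num.truncn (c * `|x|)) => //=; rewrite in_itv/=.
    by rewrite -truncn_eqP// mulr_ge0// ltW.
  move=> [m /= Bm]; rewrite in_itv/= -truncn_eqP; first by move=> /eqP ->.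
  by rewrite mulr_ge0// ltW.
apply: bigcup_measurable => m _.
have mf : measurable_fun setT (fun x : R => c * `|x|).
  by apply: measurable_funM => //; exact: measurable_cst.
by rewrite -[X in measurable X]setTI; apply: mf => //; exact: measurable_itv.
Qed.

Lemma measurable_osplit : measurable_fun setT osplit.
Proof.
apply: (@measurable_fun_cvg _ RR R setT (fun n (x : R) => odyad n `|x|)).
  move=> n; apply: (measurable_truncn (fun m => (odig n m)%:R / 2 ^+ n)).
  by rewrite exprn_gt0.
by move=> x _; exact: osplit_cvg.
Qed.

Lemma measurable_esplit : measurable_fun setT esplit.
Proof.
apply: (@measurable_fun_cvg _ RR R setT (fun n (x : R) => edyad n `|x|)).
  move=> n; apply: (measurable_truncn (fun m => (edig n m)%:R / 2 ^+ n)).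
  by rewrite exprn_gt0.
by move=> x _; exact: esplit_cvg.
Qed.

Definition unif : probability RR R := uniform_prob (@ltr01 R).

Lemma unifE (A : set R) : measurable A ->
  unif A = lebesgue_measure (A `&` `[0, 1]%classic).
Proof.
move=> mA.
have := integral_indic unif measurableT mA; rewrite setIT => <-.
rewrite integral_uniform; last by move=> x; rewrite lee_fin.
  by rewrite subr0 invr1 mul1e integral_indic.
exact/measurable_EFinP/measurable_indic.
Qed.

Lemma unif_itv (a b : R) : 0 <= a -> a <= b -> b <= 1 ->
  unif `[a, b[%classic = (b - a)%:E.
Proof.
move=> a0 ab b1; rewrite unifE; last exact: measurable_itv.
have -> : `[a, b[%classic `&` `[0, 1]%classic = `[a, b[%classic :> set R.
  apply/setIidPl => x /=; rewrite !in_itv/= => /andP[h1 h2].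
  by rewrite (le_trans a0 h1) (le_trans (ltW h2) b1).
by rewrite lebesgue_measure_itv/= lte_fin; case: ltgtP ab => // -> _; rewrite subrr.
Qed.

Lemma mean_unif_eq (f g : R -> R) : measurable_fun setT f -> measurable_fun setT g ->
  (forall x, 0 <= x -> x < 1 -> f x = g x) -> mean unif f = mean unif g.
Proof.
move=> mf mg fg; rewrite /mean /Rintegral; congr fine.
apply: ae_eq_integral => //; try exact/measurable_EFinP.
have z : unif (~` `[0, 1[%classic) = 0%E.
  rewrite probability_setC; last exact: measurable_itv.
  by rewrite unif_itv// subr0 subee.
exists (~` `[0, 1[%classic); split; [by apply: measurableC; exact: measurable_itv|exact: z|].
move=> x /= h; rewrite in_itv/= => /andP[x0 x1]; apply: h => _.
by rewrite fg.
Qed.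

Lemma mean_unif_truncn (K : nat) (h : nat -> R) : (0 < K)%N ->
  mean unif (fun x : R => h (Num.truncn (K%:R * `|x|))) = K%:R^-1 * \sum_(m < K) h m.
Proof.
move=> K0; have K0' : 0 < K%:R :> R by rewrite ltr0n.
pose I (m : nat) : set R := `[m%:R / K%:R, m.+1%:R / K%:R[%classic.
have mI m : measurable (I m) by exact: measurable_itv.
have iI (m : nat) : integ unif (\1_(I m) : R -> R).
  apply: (@integ_bounded _ RR R unif _ 1); first by apply: measurable_indic; exact: mI.
  by move=> x; rewrite indicE; case: (_ \in _); rewrite ?normr1 ?normr0.
rewrite (@mean_unif_eq _ (fun x => \sum_(m < K) h m * \1_(I m) x)); first last.
- move=> x x0 x1; rewrite ger0_norm//.
  have Kx0 : 0 <= K%:R * x by rewrite mulr_ge0// ltW.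
  have mK : (Num.truncn (K%:R * x) < K)%N.
    have := truncn_le (K%:R * x); rewrite Kx0 => h1.
    by rewrite -(ltr_nat R) (le_lt_trans h1)// gtr_pMr.
  rewrite (bigD1 (Ordinal mK))//= big1 ?addr0.
    rewrite indicE mem_set ?mulr1// /I/= in_itv/= ler_pdivrMr// ltr_pdivlMr//.
    by rewrite [x * _]mulrC -truncn_eqP.
  move=> i im; rewrite indicE memNset ?mulr0// /I/= in_itv/= ler_pdivrMr// ltr_pdivlMr//.
  rewrite [x * _]mulrC -truncn_eqP// => /eqP e.
  by move: im; rewrite -val_eqE/= e eqxx.
- apply: measurable_sum => m; apply: measurable_funM; first exact: measurable_cst.
  by apply: measurable_indic; exact: mI.
- exact: measurable_truncn.
rewrite mean_sum; last by move=> m; exact: integZ.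
rewrite big_distrr; apply: eq_bigr => m _ /=.
rewrite meanZ// mulrC; congr (_ * _).
have := mean_indic unif (mI m); rewrite unif_itv.
- by move=> [->]; rewrite -mulrBl -natr1 addrAC subrr add0r mul1r.
- by rewrite divr_ge0.
- by rewrite ler_wpM2r ?invr_ge0// ler_nat.
- by rewrite ler_pdivrMr// mul1r ler_nat.
Qed.

Lemma truncn_cvg (x : R) : 0 <= x ->
  (fun n => (Num.truncn (2 ^+ n * x))%:R / 2 ^+ n) @ \oo --> x.
Proof.
move=> x0; apply/cvgrPdist_le => e e0; near=> n.
have p2 : 0 < 2 ^+ n :> R by rewrite exprn_gt0.
have y0 : 0 <= 2 ^+ n * x by rewrite mulr_ge0// ltW.
have : (Num.truncn (2 ^+ n * x) == Num.truncn (2 ^+ n * x)) by [].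
rewrite truncn_eqP//; set m := Num.truncn _ => /andP[h1 h2].
have e1 : x - m%:R / 2 ^+ n = (2 ^+ n * x - m%:R) / 2 ^+ n.
  by field; rewrite gt_eqF.
rewrite e1 ger0_norm; last by rewrite divr_ge0 ?subr_ge0// ltW.
apply: (@le_trans _ _ (2 ^- n)).
  rewrite -[leRHS]mul1r ler_wpM2r ?invr_ge0 ?(ltW p2)//.
  by move: h2; rewrite -natr1; lra.
near: n.
have /cvgrPdist_le/(_ e e0) : (fun n => (2^-1 : R) ^+ n) @ \oo --> (0 : R).
  by apply: cvg_expr; rewrite ger0_norm ?invr_ge0// invf_lt1// ltr1n.
by apply: filterS => n; rewrite sub0r normrN -exprVn ger0_norm// exprn_ge0// invr_ge0.
Unshelve. all: by end_near. Qed.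

(** At level n the product formula is exact by [sum_digits]; continuity and boundedness of h1 and h2
    let n tend to infinity under the means. *)
Lemma mean_split_continuous (h1 h2 : R -> R) : continuous h1 -> continuous h2 ->
  (forall x, `|h1 x| <= 1) -> (forall x, `|h2 x| <= 1) ->
  mean unif (fun x => h1 (osplit x) * h2 (esplit x)) = mean unif h1 * mean unif h2.
Proof.
move=> c1 c2 b1 b2.
have mh1 : measurable_fun setT h1 by exact: continuous_measurable_fun.
have mh2 : measurable_fun setT h2 by exact: continuous_measurable_fun.
have cm (f : R -> R) (g : R -> R) : continuous f -> measurable_fun setT g ->
    measurable_fun setT (fun x => f (g x)).
  by move=> cf mg; apply: (measurableT_comp (f := f)) => //; exact: continuous_measurable_fun.
have p4 n : (0 < 4 ^ n)%N by rewrite expn_gt0.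
have p2 n : (0 < 2 ^ n)%N by rewrite expn_gt0.
have L n : mean unif (fun x => h1 (odyad n `|x|) * h2 (edyad n `|x|)) =
    mean unif (fun x => h1 ((Num.truncn (2 ^+ n * `|x|))%:R / 2 ^+ n)) *
    mean unif (fun x => h2 ((Num.truncn (2 ^+ n * `|x|))%:R / 2 ^+ n)).
  have := mean_unif_truncn (fun m => h1 ((odig n m)%:R / 2 ^+ n) * h2 ((edig n m)%:R / 2 ^+ n)) (p4 n).
  rewrite natrX => ->.
  rewrite (sum_digits n (fun i j => h1 (i%:R / 2 ^+ n) * h2 (j%:R / 2 ^+ n))).
  have := mean_unif_truncn (fun m => h1 (m%:R / 2 ^+ n)) (p2 n); rewrite natrX => ->.
  have := mean_unif_truncn (fun m => h2 (m%:R / 2 ^+ n)) (p2 n); rewrite natrX => ->.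
  rewrite mulrACA -invfM -exprMn_comm; last by exact: mulrC.
  rewrite -natrM; congr (_ * _); rewrite big_distrl/=.
  by apply: eq_bigr => i _; rewrite big_distrr.
have l1 : (fun n => mean unif (fun x => h1 (odyad n `|x|) * h2 (edyad n `|x|))) @ \oo -->
    mean unif (fun x => h1 (osplit x) * h2 (esplit x)).
  apply: (@integ_dominated_cvg _ RR R unif _ _ (fun=> 1)).
  - move=> n; apply: measurable_funM.
      apply: (measurable_truncn (fun m => h1 ((odig n m)%:R / 2 ^+ n))).
      by rewrite exprn_gt0.
    apply: (measurable_truncn (fun m => h2 ((edig n m)%:R / 2 ^+ n))).
    by rewrite exprn_gt0.
  - by apply: measurable_funM; apply: cm => //; [exact: measurable_osplit|exact: measurable_esplit].
  - exact: integ_cst.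
  - move=> x; apply: cvgM.
      by apply: continuous_cvg; [exact: c1|exact: osplit_cvg].
    by apply: continuous_cvg; [exact: c2|exact: esplit_cvg].
  - by move=> n x; rewrite normrM mulr_ile1.
have l2 (h : R -> R) : continuous h -> (forall x, `|h x| <= 1) ->
    (fun n => mean unif (fun x => h ((Num.truncn (2 ^+ n * `|x|))%:R / 2 ^+ n))) @ \oo -->
    mean unif h.
  move=> ch hb; have mh : measurable_fun setT h by exact: continuous_measurable_fun.
  rewrite (@mean_unif_eq h (fun x => h `|x|)) //; last 2 first.
  - exact: cm.
  - by move=> x x0 _; rewrite ger0_norm.
  apply: (@integ_dominated_cvg _ RR R unif _ _ (fun=> 1)).
  - move=> n; apply: (measurable_truncn (fun m => h (m%:R / 2 ^+ n))).
    by rewrite exprn_gt0.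
  - exact: cm.
  - exact: integ_cst.
  - by move=> x; apply: continuous_cvg; [exact: ch|exact: truncn_cvg].
  - by move=> n x.
move: l1; rewrite (funext L) => /cvg_unique; apply => //.
by apply: cvgM; exact: l2.
Qed.

End digit_splitting.

Section independent_copies.
Context (R : realType).
Local Notation RR := (measurableTypeR R).
Local Notation unif := (unif R).
Local Notation osplit := (@osplit R).
Local Notation esplit := (@esplit R).

Let oRV : {mfun RR >-> RR} :=
  HB.pack osplit (isMeasurableFun.Build _ _ RR RR osplit (@measurable_osplit R)).
Let eRV : {mfun RR >-> RR} :=
  HB.pack esplit (isMeasurableFun.Build _ _ RR RR esplit (@measurable_esplit R)).

Let pre_meas (f : {mfun RR >-> RR}) (A : set R) : measurable A -> measurable (f @^-1` A).
Proof. by move=> mA; rewrite -[X in measurable X]setTI; exact: (@measurable_funPT _ _ _ _ f). Qed.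

(** Ramps are replaced by indicators one factor at a time, so that each passage to the limit has a
    fixed bounded second factor. *)
Let split_rays (r q : R) :
  unif (osplit @^-1` `]r, +oo[%classic `&` esplit @^-1` `]q, +oo[%classic) =
  (unif `]r, +oo[%classic * unif `]q, +oo[%classic)%E.
Proof.
have mr (s : R) : measurable (`]s, +oo[%classic : set R) by exact: measurable_itv.
have mR (s : R) k : measurable_fun setT (ramp s k : R -> R).
  by apply: continuous_measurable_fun; exact: continuous_ramp.
have m1 (s : R) : measurable_fun setT (\1_(`]s, +oo[%classic) : R -> R).
  exact: measurable_indic.
have mo := @measurable_osplit R; have me := @measurable_esplit R.
have n1 (s : R) x : `|\1_(`]s, +oo[%classic) x : R| <= 1.
  by rewrite indicE; case: (_ \in _); rewrite ?normr1 ?normr0.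
have mi s (f : R -> R) : measurable_fun setT f ->
    measurable_fun setT (fun x => \1_(`]s, +oo[%classic) (f x) : R).
  move=> mf.
  have -> : (fun w => \1_(`]s, +oo[%classic) (f w)) = \1_(f @^-1` `]s, +oo[%classic) :> (R -> R).
    by apply/funext => w; rewrite !indicE.
  by apply: measurable_indic; rewrite -[X in measurable X]setTI; exact: mf.
have lim (s : R) : (fun k => mean unif (ramp s k)) @ \oo --> mean unif (\1_(`]s, +oo[%classic) : R -> R).
  have nn (x : R) : `|1 : R| <= 1 by rewrite normr1.
  have := @mean_ramp_cvg R _ _ unif (@idfun R) (fun=> 1) 1 s (@measurable_id _ _ _) (measurable_cst _) nn.
  rewrite (eq_mean unif (g := \1_(`]s, +oo[%classic))) => [|x]; last by rewrite mulr1.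
  have -> // : (fun k => mean unif (fun w => ramp s k (idfun w) * 1)) = (fun k => mean unif (ramp s k)).
  by apply/funext => k; apply: eq_mean => x; rewrite mulr1.
have step1 l : mean unif (fun x => \1_(`]r, +oo[%classic) (osplit x) * ramp q l (esplit x)) =
    mean unif (\1_(`]r, +oo[%classic) : R -> R) * mean unif (ramp q l).
  have mre : measurable_fun setT (fun x => ramp q l (esplit x)).
    by apply: (measurableT_comp (f := ramp q l)).
  have := @mean_ramp_cvg R _ _ unif osplit (fun x => ramp q l (esplit x)) 1 r mo mre (fun x => ramp_norm _ _ _).
  rewrite (funext (fun k => mean_split_continuous (@continuous_ramp R r k) (@continuous_ramp R q l)
    (ramp_norm r k) (ramp_norm q l))).
  move=> /cvg_unique; apply => //.
  by apply: cvgM; [exact: lim|exact: cvg_cst].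
have step2 : mean unif (fun x => \1_(`]r, +oo[%classic) (osplit x) * \1_(`]q, +oo[%classic) (esplit x)) =
    mean unif (\1_(`]r, +oo[%classic) : R -> R) * mean unif (\1_(`]q, +oo[%classic) : R -> R).
  have := @mean_ramp_cvg R _ _ unif esplit (fun x => \1_(`]r, +oo[%classic) (osplit x)) 1 q me (mi r _ mo) (fun x => n1 _ _).
  have -> : (fun k => mean unif (fun w => ramp q k (esplit w) * \1_(`]r, +oo[%classic) (osplit w))) =
      (fun k => mean unif (\1_(`]r, +oo[%classic) : R -> R) * mean unif (ramp q k)).
    by apply/funext => k; rewrite -step1; apply: eq_mean => x; rewrite mulrC.
  rewrite (eq_mean unif (f := fun w => \1_(`]q, +oo[%classic) (esplit w) * \1_(`]r, +oo[%classic) (osplit w))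
    (g := fun x => \1_(`]r, +oo[%classic) (osplit x) * \1_(`]q, +oo[%classic) (esplit x))); last first.
    by move=> x; rewrite mulrC.
  move=> /cvg_unique; apply => //.
  by apply: cvgM; [exact: cvg_cst|exact: lim].
have mint : measurable (osplit @^-1` `]r, +oo[%classic `&` esplit @^-1` `]q, +oo[%classic).
  apply: measurableI; first exact: (@pre_meas oRV).
  exact: (@pre_meas eRV).
rewrite -(mean_indic unif mint) -(mean_indic unif (mr r)) -(mean_indic unif (mr q)) -EFinM.
rewrite -step2; congr (_%:E); apply: eq_mean => x.
by rewrite indicI.
Qed.

Let fu (A : set R) : measurable A -> unif A \is a fin_num.
Proof.
by move=> mA; rewrite ge0_fin_numE// (le_lt_trans (probability_le1 unif mA))// ltry.
Qed.

(** For a fixed ray both sides are finite measures in A that agree on rays. The same argument in the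
    other variable, with A fixed, then gives [split_sets]. *)
Let split_set_ray (A : set R) (q : R) : measurable A ->
  unif (osplit @^-1` A `&` esplit @^-1` `]q, +oo[%classic) =
  (unif A * unif `]q, +oo[%classic)%E.
Proof.
move=> mA; have mq : measurable (`]q, +oo[%classic : set R) by exact: measurable_itv.
have mC : measurable (esplit @^-1` `]q, +oo[%classic) by exact: (@pre_meas eRV).
pose m1' := (pushforward (mrestr unif mC) oRV : {measure set RR -> \bar R}).
pose m1 := m1' (@measurable_osplit R).
have c0 : 0 <= fine (unif `]q, +oo[%classic) by rewrite fine_ge0.
pose m2 : {measure set RR -> \bar R} := mscale (NngNum c0) unif.
have h := @measure_eq_rays R m1 m2 _ _ A mA.
have -> : unif (osplit @^-1` A `&` esplit @^-1` `]q, +oo[%classic) = m1 A by [].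
rewrite h /m2 /= /mscale /= ?fineK ?fu//; first by rewrite muleC.
  apply: le_lt_trans (probability_le1 unif _) _; last exact: ltry.
  by rewrite preimage_setT; exact: measurableI.
by move=> r; rewrite [LHS]split_rays muleC.
Qed.

Let split_sets (A B : set R) : measurable A -> measurable B ->
  unif (osplit @^-1` A `&` esplit @^-1` B) = (unif A * unif B)%E.
Proof.
move=> mA mB.
have mC : measurable (osplit @^-1` A) by exact: (@pre_meas oRV).
pose m1' := (pushforward (mrestr unif mC) eRV : {measure set RR -> \bar R}).
pose m1 := m1' (@measurable_esplit R).
have c0 : 0 <= fine (unif A) by rewrite fine_ge0.
pose m2 : {measure set RR -> \bar R} := mscale (NngNum c0) unif.
have h := @measure_eq_rays R m1 m2 _ _ B mB.
have -> : unif (osplit @^-1` A `&` esplit @^-1` B) = m1 B by rewrite setIC.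
rewrite h /m2 /= /mscale /= ?fineK ?fu//.
  apply: le_lt_trans (probability_le1 unif _) _; last exact: ltry.
  by rewrite preimage_setT; exact: measurableI.
by move=> r; rewrite -split_set_ray// setIC.
Qed.

Let osplit_law (A : set R) : measurable A -> unif (osplit @^-1` A) = unif A.
Proof.
move=> mA; rewrite -[LHS](congr1 unif (setIT _)) -(preimage_setT esplit) split_sets//.
by rewrite [X in (_ * X)%E](@probability_setT _ _ _ unif) mule1.
Qed.

Let esplit_law (A : set R) : measurable A -> unif (esplit @^-1` A) = unif A.
Proof.
move=> mA; rewrite -[LHS](congr1 unif (setTI _)) -(preimage_setT osplit) split_sets//.
by rewrite [X in (X * _)%E](@probability_setT _ _ _ unif) mul1e.
Qed.

Let mean_comp (f : {mfun RR >-> RR}) (h : R -> R) :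
  (forall A, measurable A -> unif (f @^-1` A) = unif A) ->
  measurable_fun setT h -> (forall x, `|h x| <= 1) ->
  mean unif (fun x => h (f x)) = mean unif h.
Proof.
move=> fl mh hb.
have ih : integ unif (fun x => h (f x)).
  apply: (@integ_bounded _ RR R unif _ 1) => //.
  by apply: (measurableT_comp (f := h)) => //; exact: (@measurable_funPT _ _ _ _ f).
have [_ <-] := @mean_distribution R _ RR unif f h mh ih.
rewrite /mean /Rintegral; congr fine; apply: eq_measure_integral => A mA _.
exact: fl.
Qed.

Lemma mean_esplit (h : R -> R) : measurable_fun setT h -> (forall x, `|h x| <= 1) ->
  mean unif (fun x => h (esplit x)) = mean unif h.
Proof. exact: (@mean_comp eRV). Qed.

Lemma mean_osplit (h : R -> R) : measurable_fun setT h -> (forall x, `|h x| <= 1) ->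
  mean unif (fun x => h (osplit x)) = mean unif h.
Proof. exact: (@mean_comp oRV). Qed.

Lemma osplit_pushforward (A : set R) : measurable A -> unif (osplit @^-1` A) = unif A.
Proof. exact: osplit_law. Qed.

Lemma esplit_pushforward (A : set R) : measurable A -> unif (esplit @^-1` A) = unif A.
Proof. exact: esplit_law. Qed.

(** [freezing] concerns nonnegative integrands, so it is applied to (1 + f1) (1 + f2); the terms
    with a single factor cancel afterwards. *)
Lemma mean_split (f1 f2 : R -> R) : measurable_fun setT f1 -> measurable_fun setT f2 ->
  (forall x, `|f1 x| <= 1) -> (forall x, `|f2 x| <= 1) ->
  mean unif (fun x => f1 (osplit x) * f2 (esplit x)) = mean unif f1 * mean unif f2.
Proof.
move=> mf1 mf2 b1 b2.
have mo := @measurable_osplit R; have me := @measurable_esplit R.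
have i1 (f : R -> R) : measurable_fun setT f -> (forall x, `|f x| <= 1) -> integ unif f.
  by move=> mf bf; exact: (@integ_bounded _ RR R unif _ 1).
have mf1o : measurable_fun setT (fun x => f1 (osplit x)) by exact: (measurableT_comp (f := f1)).
have mf2e : measurable_fun setT (fun x => f2 (esplit x)) by exact: (measurableT_comp (f := f2)).
pose G (q : RR * RR) : \bar R := ((1 + f1 q.1) * (1 + f2 q.2))%:E.
have G0 q : (0 <= G q)%E.
  rewrite lee_fin; have := b1 q.1; have := b2 q.2; rewrite !ler_norml.
  by move=> /andP[? ?] /andP[? ?]; apply: mulr_ge0; lra.
have mG : measurable_fun setT G.
  apply/measurable_EFinP/measurable_funM; apply: measurable_funD => //.
    by apply: (measurableT_comp (f := f1)).
  by apply: (measurableT_comp (f := f2)).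
have ind : independent2 unif oRV eRV.
  move=> A B mA mB; rewrite [LHS](split_sets mA mB).
  by rewrite [X in (_ = X * _)%E](osplit_law mA) [X in (_ = _ * X)%E](esplit_law mB).
have key : mean unif (fun x => (1 + f1 (osplit x)) * (1 + f2 (esplit x))) =
    (1 + mean unif f1) * (1 + mean unif f2).
  rewrite /mean /Rintegral.
  have -> : (\int[unif]_x ((1 + f1 (osplit x)) * (1 + f2 (esplit x)))%:E =
     \int[unif]_y ((1 + f1 y) * (1 + mean unif f2))%:E)%E.
    transitivity (\int[distribution unif oRV]_y ((1 + f1 y) * (1 + mean unif f2))%:E)%E; last first.
      by apply: eq_measure_integral => A mA _; exact: osplit_law.
    rewrite [LHS](freezing ind measurableT mG G0).
    apply: eq_integral => y _; rewrite /G /=.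
    have e : mean unif (fun w => (1 + f1 y) * (1 + f2 (esplit w))) = (1 + f1 y) * (1 + mean unif f2).
      rewrite meanZ; last by apply: integD; [exact: integ_cst|exact: i1].
      by rewrite meanD ?mean_cst ?mean_esplit//; [exact: integ_cst|exact: i1].
    rewrite -e /mean /Rintegral fineK//.
    apply: integrable_fin_num => //; apply: integZ; apply: integD; [exact: integ_cst|exact: i1].
  rewrite -/(mean unif f2).
  rewrite -[LHS]/(mean unif (fun y => (1 + f1 y) * (1 + mean unif f2))).
  rewrite (eq_mean unif (g := fun y => (1 + mean unif f2) * (1 + f1 y))); last first.
    by move=> y; rewrite mulrC.
  rewrite meanZ; last by apply: integD; [exact: integ_cst|exact: i1].
  rewrite meanD; [|exact: integ_cst|exact: i1].
  by rewrite mean_cst mulrC.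
move: key.
have ip : integ unif (fun x => f1 (osplit x) * f2 (esplit x)).
  by apply: i1 => [|x]; [exact: measurable_funM|rewrite normrM mulr_ile1].
rewrite (eq_mean unif (g := fun x => (1 + f1 (osplit x)) + (f2 (esplit x) + f1 (osplit x) * f2 (esplit x)))); last first.
  by move=> x; ring.
have io : integ unif (fun x => f1 (osplit x)) by exact: i1.
have ie : integ unif (fun x => f2 (esplit x)) by exact: i1.
rewrite (meanD (integD (integ_cst unif 1) io) (integD ie ip)).
rewrite (meanD (integ_cst unif 1) io) (meanD ie ip) mean_cst mean_osplit// mean_esplit//.
by move=> e; lra.
Qed.

End independent_copies.

(** * Existence of Gaussian processes *)

Section quantile.
Context (R : realType).
Local Notation RR := (measurableTypeR R).
Local Notation unif := (unif R).

(** The generalized inverse of the distribution function. By right continuity x < g u is equivalent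
    to F x < u, so within ]0, 1[ the preimage of an open ray is again a ray. *)
Lemma exists_quantile (Q : probability RR R) :
  exists g : R -> R, measurable_fun setT g /\
    forall A : set R, measurable A -> unif (g @^-1` A) = Q A.
Proof.
pose X : {RV Q >-> R} := HB.pack (idfun : RR -> R)
  (isMeasurableFun.Build _ _ RR R (idfun : RR -> R) (@measurable_id _ RR setT)).
pose F x := fine (cdf X x).
have Ffin x : cdf X x = (F x)%:E.
  by rewrite /F fineK// ge0_fin_numE ?cdf_ge0// (le_lt_trans (cdf_le1 X x))// ltry.
have F0 x : 0 <= F x by rewrite -lee_fin -Ffin cdf_ge0.
have F1 x : F x <= 1 by rewrite -lee_fin -Ffin cdf_le1.
have Fmono x y : x <= y -> F x <= F y.
  by move=> xy; rewrite -lee_fin -!Ffin; exact: cdf_nondecreasing.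
have near_lt (G : set_system R) (FG : Filter G) (l u : R) :
    cdf X @ G --> l%:E -> l < u -> \forall x \near G, F x < u.
  move=> cX lu.
  have : nbhs l%:E [set z | (z < u%:E)%E].
    by apply: open_ereal_lt'; rewrite lte_fin.
  by move=> /cX h; apply: (@filterS _ G _ _ _ _ h) => x; rewrite /= Ffin lte_fin.
have Slow u : 0 < u -> exists x, F x < u.
  move=> u0; have := near_lt (-oo) _ 0 u (cvg_cdfNy0 X) u0.
  by move=> [M [_ h]]; exists (M - 1); apply: h; rewrite gtrBl.
have Shigh u : u < 1 -> exists x, u < F x.
  move=> u1; have : nbhs (1%E : \bar R) [set z | (u%:E < z)%E].
    by apply: open_ereal_gt'; rewrite lte_fin.
  move=> /(cvg_cdfy1 X)[M [_ h]]; exists (M + 1).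
  have : (u%:E < cdf X (M + 1)%R)%E by apply: h; rewrite ltrDl.
  by rewrite Ffin lte_fin.
have Srig u x : F x < u -> exists2 y, x < y & F y < u.
  move=> xu; have h : \forall y \near x^'+, F y < u.
    apply: (near_lt _ _ (F x)) => //; rewrite -Ffin; exact: cdf_right_continuous.
  have h2 : \forall y \near x^'+, x < y by exact: nbhs_right_gt.
  have [y [? ?]] := @filter_ex _ (x^'+) _ _ (filterI h h2).
  by exists y.
pose S u : set R := [set x | F x < u].
(* The default value 0 outside ]0, 1[ is accounted for by the last set in [gpre]. *)
pose g u : R := if (0 < u) && (u < 1) then sup (S u) else 0.
have gP u x : 0 < u -> u < 1 -> (x < g u) = (F x < u).
  move=> u0 u1; rewrite /g u0 u1/=.
  have nS : S u !=set0 by have [y ?] := Slow _ u0; exists y.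
  apply/idP/idP => [/(sup_gt nS)[y Sy xy]|/Srig[y xy Fy]].
    by apply: le_lt_trans Sy; exact: Fmono (ltW xy).
  apply: lt_le_trans xy _; apply: ub_le_sup => //.
  have [M hM] := Shigh _ u1; exists M => z; rewrite /S/= => Fz.
  by rewrite leNgt; apply/negP => /ltW/Fmono; rewrite leNgt (lt_trans Fz).
have gpre x : g @^-1` `]x, +oo[%classic =
    (`]F x, +oo[%classic `&` `]0, 1[%classic) `|`
    (if x < 0 then ~` `]0, 1[%classic else set0).
  apply/seteqP; split => u /=.
    rewrite !in_itv/= !andbT; case: (boolP ((0 < u) && (u < 1))) => [/andP[u0 u1]|nu].
      by rewrite gP// => h; left; rewrite h.
    by rewrite {1}/g (negbTE nu) => -> /=; right => /=; rewrite in_itv/= (negbTE nu).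
  case=> [[]|].
    by rewrite !in_itv/= !andbT => h /andP[u0 u1]; rewrite gP.
  case: ifPn => // x0; rewrite /= !in_itv/= andbT => /negP nu.
  by rewrite /g (negbTE nu).
have mI : measurable (`]0, 1[%classic : set R) by exact: measurable_itv.
have mI2 x : measurable (if x < 0 then ~` `]0, 1[%classic else set0 : set R).
  by case: ifP => // _; exact: measurableC.
have mg : measurable_fun setT g.
  apply: (measurability _ (RGenOInfty.measurableE R)) => _ [_ [x ->] <-].
  rewrite setTI gpre; apply: measurableU; last exact: mI2.
  by apply: measurableI => //; exact: measurable_itv.
exists g; split => // A mA.
pose gR : {mfun RR >-> RR} := HB.pack g (isMeasurableFun.Build _ _ RR RR g mg).
pose m1' := (pushforward unif gR : {measure set RR -> \bar R}).
pose m1 := m1' mg.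
apply: (@measure_eq_rays R m1 Q _ _ A mA) => [|x].
  apply: (@le_lt_trans _ _ 1%E); last exact: ltry.
  apply: (probability_le1 unif); rewrite preimage_setT; exact: measurableT.
have -> : m1 `]x, +oo[%classic = unif (g @^-1` `]x, +oo[%classic) by [].
have mx : measurable (`]x, +oo[%classic : set R) by exact: measurable_itv.
have eQ : Q `]x, +oo[%classic = (1 - F x)%:E.
  have -> : `]x, +oo[%classic = ~` `]-oo, x]%classic :> set R by rewrite setCitvl.
  rewrite probability_setC; last exact: measurable_itv.
  by rewrite -[Q _]/(cdf X x) Ffin.
rewrite [RHS]eQ unifE; last by rewrite -[X in measurable X]setTI; apply: (@measurable_funPT _ _ _ _ gR).
have mFx : measurable (`]F x, 1[%classic : set R) by exact: measurable_itv.
transitivity (lebesgue_measure (`]F x, 1[%classic : set R)); last first.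
  by rewrite lebesgue_measure_itv/= lte_fin; case: ltgtP (F1 x) => // ->; rewrite subrr.
have m2 : measurable ([set 0; 1] : set R) by apply: measurableU; exact: measurable_set1.
have m3 : measurable (g @^-1` `]x, +oo[%classic `&` [set 0; 1]).
  by apply: measurableI m2; rewrite -[X in measurable X]setTI; exact: (@measurable_funPT _ _ _ _ gR).
(* [unif] lives on the closed interval, whose endpoints may or may not belong to the preimage; they
   form a null set. *)
have -> : g @^-1` `]x, +oo[%classic `&` `[0, 1]%classic =
    `]F x, 1[%classic `|` (g @^-1` `]x, +oo[%classic `&` [set 0; 1]).
  apply/seteqP; split => u; rewrite gpre /=.
    rewrite !in_itv/= !andbT => -[[[h1 /andP[_ h2]]|h1]] h3; first by left; rewrite h1 h2.
    move: h1; case: ifPn => // _ /= /negP h1; right; split.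
      by right => /=; rewrite in_itv/=; exact/negP.
    case/andP: h3; rewrite !le_eqVlt => /orP[/eqP <- _|u0]; first by left.
    by case/orP => [/eqP ->|u1]; [right|by exfalso; apply: (negP (h1 : ~~ (u \in `]0, 1[))); rewrite in_itv/= u0 u1].
  rewrite !in_itv/= !andbT => -[/andP[h1 h2]|[h1 h2]].
    have u0 := le_lt_trans (F0 x) h1.
    by split; [left; rewrite h1 u0 h2|rewrite (ltW u0) (ltW h2)].
  by split => //; case: h2 => ->; rewrite lexx ler01.
apply: measureU0 => //.
apply: countable_lebesgue_measure0.
apply: (@sub_countable _ _ _ [set 0; 1]); last exact: finite_set_countable.
by apply: subset_card_le => u [].
Qed.

End quantile.

Section iid_normal.
Context (R : realType).
Local Notation RR := (measurableTypeR R).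
Local Notation unif := (unif R).
Local Notation osplit := (@osplit R).
Local Notation esplit := (@esplit R).

Lemma measurable_iter_esplit k : measurable_fun setT (iter k esplit : R -> R).
Proof.
elim: k => [|k IH]; first exact: measurable_id.
by apply: (measurableT_comp (f := esplit)) IH; exact: measurable_esplit.
Qed.

Lemma iter_esplit_pushforward k (A : set R) : measurable A ->
  unif (iter k esplit @^-1` A) = unif A.
Proof.
elim: k A => [|k IH] A mA //.
have -> : iter k.+1 esplit @^-1` A = iter k esplit @^-1` (esplit @^-1` A) by [].
rewrite IH; first exact: esplit_pushforward.
rewrite -[X in measurable X]setTI; exact: (@measurable_esplit R).
Qed.

(** Independence is recorded through cosine means, the form used later. As G (k + 1) is G k composed
    with [esplit], a sum is one term in [osplit] plus a shorter sum evaluated at [esplit], and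
    [mean_split] carries the induction. *)
Lemma exists_iid_normal : exists G : nat -> R -> R,
  (forall k, sqint unif (G k)) /\
  forall n (a : nat -> R) th,
    mean unif (fun x => cos (\sum_(k < n) a k * G k x + th)) =
    expR (- ((\sum_(k < n) a k ^+ 2) / 2)) * cos th.
Proof.
pose N : probability RR R := normal_prob 0 1.
have [g [mg lg]] := exists_quantile N.
pose G k x := g (osplit (iter k esplit x)).
have mG k : measurable_fun setT (G k).
  apply: (measurableT_comp (f := g)) => //; apply: (measurableT_comp (f := osplit)).
    exact: measurable_osplit.
  exact: measurable_iter_esplit.
have lG k (A : set R) : measurable A -> unif (G k @^-1` A) = N A.
  move=> mA; have -> : G k @^-1` A = iter k esplit @^-1` (osplit @^-1` (g @^-1` A)) by [].
  have m1 : measurable (g @^-1` A) by rewrite -[X in measurable X]setTI; exact: mg.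
  have m2 : measurable (osplit @^-1` (g @^-1` A)).
    by rewrite -[X in measurable X]setTI; exact: (@measurable_osplit R).
  by rewrite iter_esplit_pushforward// osplit_pushforward// lg.
have one0 : (1 : R) != 0 by [].
have sG k : sqint unif (G k).
  split; first exact: mG.
  apply/integrableP; split.
    by apply/measurable_EFinP; apply: measurable_funX; exact: mG.
  pose gR : {mfun RR >-> RR} := HB.pack (G k) (isMeasurableFun.Build _ _ RR RR (G k) (mG k)).
  have [_ /integrableP[_]] := sqint_normal one0; apply: le_lt_trans.
  rewrite le_eqVlt; apply/orP; left; apply/eqP.
  transitivity (\int[distribution unif gR]_y `|(y ^+ 2)%:E|)%E; last first.
    by apply: eq_measure_integral => A mA _; exact: lG.
  rewrite ge0_integral_pushforward//.
  by apply: measurableT_comp => //; apply/measurable_EFinP; apply: measurable_funX; exact: measurable_id.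
have cG a th : mean unif (fun x => cos (a * g x + th)) = expR (- (a ^+ 2 / 2)) * cos th.
  pose gR : {mfun RR >-> RR} := HB.pack g (isMeasurableFun.Build _ _ RR RR g mg).
  have mc : measurable_fun setT (fun x : R => cos (a * x + th)).
    by apply: measurable_cos_shift; apply: measurable_funM => //; exact: measurable_cst.
  have ic : integ unif (fun x => cos (a * g x + th)).
    apply: (@integ_bounded _ RR R unif _ 1).
      by apply: (measurableT_comp (f := fun x : R => cos (a * x + th))).
    by move=> x; exact: cos_max.
  have [_ <-] := @mean_distribution R _ RR unif gR _ mc ic.
  have := mean_normal_cos one0 a th; rewrite expr1n mul1r => <-.
  by rewrite /mean /Rintegral; congr fine; apply: eq_measure_integral => A mA _; exact: lg.
exists G; split => //.
elim=> [|n IH] a th.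
  under eq_mean do rewrite big_ord0 add0r.
  by rewrite mean_cst big_ord0 mul0r oppr0 expR0 mul1r.
pose S x := \sum_(k < n) a k.+1 * G k x.
pose E := expR (- ((\sum_(k < n) a k.+1 ^+ 2) / 2)).
have mS : measurable_fun setT S.
  by apply: measurable_sum => k; apply: measurable_funM => //; exact: measurable_cst.
have mag : measurable_fun setT (fun x => a 0%N * g x).
  by apply: measurable_funM => //; exact: measurable_cst.
have sin_cos u : sin u = cos (u - pi / 2) :> R.
  by rewrite cosB cos_pihalf sin_pihalf mulr0 add0r mulr1.
(* The phase - pi / 2 turns the cosine formula into the vanishing of the sine mean, which removes
   the second product of the addition formula. *)
have msin : mean unif (fun x => sin (a 0%N * g x)) = 0.
  rewrite (eq_mean unif (g := fun x => cos (a 0%N * g x + - (pi / 2)))) => [|x]; last exact: sin_cos.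
  by rewrite cG cosN cos_pihalf mulr0.
have mcos : mean unif (fun x => cos (a 0%N * g x)) = expR (- (a 0%N ^+ 2 / 2)).
  rewrite (eq_mean unif (g := fun x => cos (a 0%N * g x + 0))) => [|x]; last by rewrite addr0.
  by rewrite cG cos0 mulr1.
have mf1 : measurable_fun setT (fun x => cos (a 0%N * g x)).
  rewrite (_ : (fun _ => _) = (fun x => cos (a 0%N * g x + 0))); first exact: measurable_cos_shift.
  by apply/funext => x; rewrite addr0.
have mf2 : measurable_fun setT (fun x => sin (a 0%N * g x)) by exact: measurable_sin_comp.
have mf3 : measurable_fun setT (fun x => cos (S x + th)) by exact: measurable_cos_shift.
have mf4 : measurable_fun setT (fun x => sin (S x + th)).
  by apply: measurable_sin_comp; apply: measurable_funD => //; exact: measurable_cst.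
rewrite (eq_mean unif (g := fun x => cos (a 0%N * g (osplit x)) * cos (S (esplit x) + th) -
    sin (a 0%N * g (osplit x)) * sin (S (esplit x) + th))); last first.
  move=> x; rewrite -cosD addrA big_ord_recl /S; congr (cos (_ + _ + _)).
  by apply: eq_bigr => k _; rewrite /G -iterSr.
have ib (f : R -> R) : measurable_fun setT f -> (forall x, `|f x| <= 1) -> integ unif f.
  by move=> mf bf; exact: (@integ_bounded _ RR R unif _ 1).
have mo (f : R -> R) : measurable_fun setT f -> measurable_fun setT (fun x => f (osplit x)).
  by move=> mf; apply: (measurableT_comp (f := f)) => //; exact: measurable_osplit.
have me (f : R -> R) : measurable_fun setT f -> measurable_fun setT (fun x => f (esplit x)).
  by move=> mf; apply: (measurableT_comp (f := f)) => //; exact: measurable_esplit.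
have n1 (u v : R) : `|cos u * cos v| <= 1 by rewrite normrM mulr_ile1 ?cos_max.
have n2 (u v : R) : `|sin u * sin v| <= 1 by rewrite normrM mulr_ile1 ?sin_max.
rewrite meanB; last 2 first.
- by apply: ib => // ; apply: measurable_funM; [exact: (mo _ mf1)|exact: (me _ mf3)].
- by apply: ib => // ; apply: measurable_funM; [exact: (mo _ mf2)|exact: (me _ mf4)].
rewrite (mean_split mf1 mf3 (fun x => cos_max _) (fun x => cos_max _)).
rewrite (mean_split mf2 mf4 (fun x => sin_max _) (fun x => sin_max _)).
rewrite msin mul0r subr0 mcos (IH (fun k => a k.+1)) mulrA -expRD; congr (expR _ * _).
by rewrite [in RHS]big_ord_recl /=; lra.
Qed.

End iid_normal.

(** * Cholesky factorization of infinite nonnegative definite matrices *)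

Section cholesky.
Context (R : realType).
Implicit Type K : nat -> nat -> R.

Definition quad K n (c : nat -> R) : R := \sum_(i < n) \sum_(j < n) c i * c j * K i j.

Definition psd K : Prop :=
  (forall i j, K i j = K j i) /\ forall n c, 0 <= quad K n c.

Lemma sum_kronecker n k (F : nat -> R) : (k < n)%N ->
  \sum_(i < n) (i == k :> nat)%:R * F i = F k.
Proof.
move=> kn; rewrite (bigD1 (Ordinal kn))//= eqxx mul1r big1 ?addr0// => i.
by rewrite -val_eqE/= => /negbTE ->; rewrite mul0r.
Qed.

Lemma quad_kronecker K n k c s : (forall i j, K i j = K j i) -> (k < n)%N ->
  quad K n (fun i => c i + s * (i == k)%:R) =
  quad K n c + 2 * s * (\sum_(i < n) c i * K i k) + s ^+ 2 * K k k.
Proof.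
move=> Ks kn; rewrite /quad.
have inner i : \sum_(j < n) (c i + s * (i == k)%:R) * (c j + s * (j == k :> nat)%:R) * K i j =
    (c i + s * (i == k)%:R) * (\sum_(j < n) c j * K i j + s * K i k).
  rewrite -(sum_kronecker (fun j => K i j) kn) mulr_sumr -big_split mulr_sumr/=.
  by apply: eq_bigr => j _; ring.
rewrite (eq_bigr _ (fun (i : 'I_n) _ => inner i)).
rewrite (eq_bigr (fun i : 'I_n => (\sum_(j < n) c i * c j * K i j + s * (c i * K i k)) +
   (i == k :> nat)%:R * (s * (\sum_(j < n) c j * K i j + s * K i k)))).
  rewrite big_split/= (sum_kronecker (fun i => s * (\sum_(j < n) c j * K i j + s * K i k)) kn).
  rewrite big_split/= -mulr_sumr.
  rewrite (eq_bigr (fun j : 'I_n => c j * K j k) (F1 := fun j : 'I_n => c j * K k j)).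
    by ring.
  by move=> j _; rewrite Ks.
move=> i _; have -> : \sum_(j < n) c i * c j * K i j = c i * \sum_(j < n) c j * K i j.
  by rewrite mulr_sumr; apply: eq_bigr => j _; rewrite mulrA.
ring.
Qed.

(** Padding with zeros brings any pivot index into the range of summation. *)
Lemma quad_extend K n k c : quad K n c = quad K (n + k) (fun i => if (i < n)%N then c i else 0).
Proof.
rewrite /quad big_split_ord/= [X in _ + X]big1 ?addr0.
  apply: eq_bigr => i _; rewrite ltn_ord big_split_ord/= [X in _ + X]big1 ?addr0.
    by apply: eq_bigr => j _; rewrite ltn_ord.
  by move=> j _; rewrite ltnNge leq_addr/= mulr0 mul0r.
by move=> i _; apply: big1 => j _; rewrite ltnNge leq_addr/= !mul0r.
Qed.

(* When K k k = 0 the quotient is 0, and rightly so: by [psd_null] row k is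
   then already zero. *)
Definition schur K k i j := K i j - K i k * K j k / K k k.

Lemma psd_diag K k : psd K -> 0 <= K k k.
Proof.
move=> [Ks Kp]; have := Kp k.+1 (fun i => 0 + 1 * (i == k)%:R).
rewrite (@quad_kronecker K k.+1 k (fun=> 0))// /quad !big1 => [|i _|i _].
- by rewrite mulr0 !add0r expr1n mul1r.
- by rewrite mul0r.
- by rewrite big1// => j _; rewrite !mul0r.
Qed.

Lemma psd_null K k i : psd K -> K k k = 0 -> K i k = 0.
Proof.
move=> hK; have [Ks Kp] := hK => Kk; case: (eqVneq i k) => [->//|ik].
have Ki := psd_diag i hK.
have h s : 0 <= K i i + 2 * s * K i k.
  pose n := (i + k).+1; have := Kp n (fun j => (j == i)%:R + s * (j == k)%:R).
  rewrite quad_kronecker//; last by rewrite /n ltnS leq_addl.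
  rewrite Kk mulr0 addr0 (sum_kronecker (fun j => K j k)); last by rewrite /n ltnS leq_addr.
  rewrite /quad (eq_bigr (fun j : 'I_n => (j == i :> nat)%:R * K j i)).
    by rewrite (sum_kronecker (fun j => K j i))// /n ltnS leq_addr.
  move=> j _; rewrite (eq_bigr (fun l : 'I_n => (l == i :> nat)%:R * ((j == i :> nat)%:R * K j l))).
    by rewrite (sum_kronecker (fun l => (j == i :> nat)%:R * K j l))// /n ltnS leq_addr.
  by move=> l _; rewrite mulrCA mulrA.
apply/eqP/negPn/negP => K0.
(* This value of s makes the nonnegative quantity equal to -1. *)
have := h (- (K i i + 1) / (2 * K i k)).
have -> : 2 * (- (K i i + 1) / (2 * K i k)) * K i k = - (K i i + 1) by field; rewrite K0.
lra.
Qed.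

(** Completing the square: for a nonzero pivot, the form of the Schur complement at b is the form of
    K at b moved along the k-th basis vector by the minimizing amount. *)
Lemma psd_schur K k : psd K -> psd (schur K k).
Proof.
move=> hK; have [Ks Kp] := hK; split => [i j|n c].
  by rewrite /schur Ks [K i k * _]mulrC.
rewrite (quad_extend _ n k.+1); set m := (n + k.+1)%N; set b := (X in quad _ _ X).
have km : (k < m)%N by rewrite /m addnS ltnS leq_addl.
have e : quad (schur K k) m b = quad K m b - (\sum_(i < m) b i * K i k) ^+ 2 / K k k.
  rewrite /quad expr2 mulr_suml mulr_suml -sumrB; apply: eq_bigr => i _.
  rewrite mulr_sumr mulr_suml -sumrB; apply: eq_bigr => j _.
  by rewrite /schur; ring.
have [K0|K0] := eqVneq (K k k) 0; first by rewrite e K0 invr0 mulr0 subr0; exact: Kp.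
have := Kp m (fun i => b i + (- (\sum_(i < m) b i * K i k) / K k k) * (i == k)%:R).
rewrite quad_kronecker// e.
set B := \sum_(i < m) _; set Q := quad _ _ _.
have -> // : Q + 2 * (- B / K k k) * B + (- B / K k k) ^+ 2 * K k k = Q - B ^+ 2 / K k k.
by field.
Qed.

Lemma schur_null K k i : psd K -> schur K k k i = 0 .
Proof.
move=> hK; have [Ks _] := hK; rewrite /schur [K k i]Ks.
have [K0|K0] := eqVneq (K k k) 0; first by rewrite (psd_null i hK K0) mulr0 mul0r subr0.
by rewrite [K k k * _]mulrC mulfK ?subrr.
Qed.

(** Elimination one index at a time: K is the sum of the first n rank one terms and of the n-th
    complement, whose rows of index less than n vanish. Triangularity makes all sums finite although
    the matrix is infinite. *)
Lemma exists_cholesky K : psd K -> exists L : nat -> nat -> R,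
  (forall i k, (i < k)%N -> L i k = 0) /\
  forall n i j, (i < n)%N -> \sum_(k < n) L i k * L j k = K i j.
Proof.
move=> hK; pose S := fix S k := if k is k'.+1 then schur (S k') k' else K.
have hS k : psd (S k) by elim: k => //= k IH; exact: psd_schur.
have S0 k i j : (i < k)%N -> S k i j = 0.
  elim: k i j => // k IH i j; rewrite ltnS leq_eqVlt => /orP[/eqP -> /=|ik /=].
    exact: schur_null.
  by rewrite /schur !(IH _ _ ik) !mul0r subrr.
exists (fun i k => S k i k / Num.sqrt (S k k k)); split => [i k ik|n i j ik].
  by rewrite S0// mul0r.
suff -> : K i j = \sum_(k < n) S k i k / Num.sqrt (S k k k) * (S k j k / Num.sqrt (S k k k)) + S n i j.
  by rewrite S0// addr0.
elim: n {ik} => [|n IH]; first by rewrite big_ord0 add0r.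
rewrite big_ord_recr/= {1}IH -addrA; congr (_ + _); rewrite /schur.
have e : (Num.sqrt (S n n n))^-1 * (Num.sqrt (S n n n))^-1 = (S n n n)^-1.
  by rewrite -invfM -expr2 sqr_sqrtr// psd_diag.
by rewrite mulrACA e; ring.
Qed.

End cholesky.

Section gaussian_process.
Context (R : realType).
Local Notation RR := (measurableTypeR R).
Local Notation unif := (unif R).

(** Enumerating the integers by [pickle] makes each variable of the process a finite combination of
    the independent normal variables, with the Cholesky rows as coefficients. *)
Lemma exists_gaussian_process (Gamma : int -> R) :
  (forall t, Gamma (- t) = Gamma t) ->
  (forall n (t : nat -> int) (c : nat -> R),
    0 <= \sum_(i < n) \sum_(j < n) c i * c j * Gamma (t j - t i)) ->
  exists X : int -> {RV unif >-> R},
    [/\ centered_gaussian_process X Gamma, forall t, sqint unif (X t) &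
     forall n (t : 'I_n -> int) (a : 'I_n -> R) th,
       mean unif (fun w => cos (\sum_k a k * X (t k) w + th)) =
       expR (- ((\sum_k \sum_l a k * a l * Gamma (t l - t k)) / 2)) * cos th].
Proof.
move=> Gs Gp.
(* Numbers that code no integer, if any, are sent to 0; [K] may then repeat rows, which preserves
   nonnegativity. *)
pose tm i : int := odflt 0 (unpickle i).
have tmK t : tm (pickle t) = t by rewrite /tm pickleK.
pose K i j := Gamma (tm j - tm i).
have hK : psd K.
  by split => [i j|n c]; [rewrite /K -Gs opprB|exact: Gp].
have [L [L0 LK]] := exists_cholesky hK.
have [G [sG cG]] := exists_iid_normal R.
pose Y (t : int) (x : R) := \sum_(k < (pickle t).+1) L (pickle t) k * G k x.
have sY t : sqint unif (Y t) by apply: sqint_sum => k; exact: sqintZ.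
have YE t N x : (pickle t < N)%N -> Y t x = \sum_(k < N) L (pickle t) k * G k x.
  move=> tN; rewrite -(subnK tN) addnC big_split_ord/= [X in _ + X]big1 ?addr0// => i _.
  by rewrite L0 ?mul0r// leq_addr.
have cY n (t : 'I_n -> int) (a : 'I_n -> R) th :
    mean unif (fun w => cos (\sum_k a k * Y (t k) w + th)) =
    expR (- ((\sum_k \sum_l a k * a l * Gamma (t l - t k)) / 2)) * cos th.
  pose N := (\max_k pickle (t k)).+1.
  have tN k : (pickle (t k) < N)%N by rewrite ltnS leq_bigmax.
  rewrite (eq_mean unif (g := fun w => cos (\sum_(m < N) (\sum_k a k * L (pickle (t k)) m) * G m w + th))); last first.
    move=> w; congr (cos (_ + _)).
    rewrite (eq_bigr (fun k => \sum_(m < N) a k * L (pickle (t k)) m * G m w)) => [|k _].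
      by rewrite exchange_big; apply: eq_bigr => m _; rewrite mulr_suml.
    by rewrite (YE _ N)// mulr_sumr; apply: eq_bigr => m _; rewrite mulrA.
  rewrite (cG N (fun m => \sum_k a k * L (pickle (t k)) m)); congr (expR (- (_ / 2)) * _).
  rewrite (eq_bigr (fun m : 'I_N => \sum_k \sum_l (a k * a l) * (L (pickle (t k)) m * L (pickle (t l)) m))).
    rewrite exchange_big; apply: eq_bigr => k _; rewrite exchange_big; apply: eq_bigr => l _.
    by rewrite -mulr_sumr/= LK// /K !tmK.
  move=> m _; rewrite expr2 mulr_suml; apply: eq_bigr => k _; rewrite mulr_sumr.
  by apply: eq_bigr => l _; ring.
have mY t : measurable_fun setT (Y t : RR -> R) by case: (sY t).
pose X t : {RV unif >-> R} := HB.pack (Y t) (isMeasurableFun.Build _ _ RR R (Y t) (mY t)).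
have law n (t : 'I_n -> int) (a : 'I_n -> R) :
    let s := Num.sqrt (\sum_k \sum_l a k * a l * Gamma (t l - t k)) in
    (forall B : set R, measurable B -> unif [set w | B (\sum_k a k * Y (t k) w)] = gaussian_law 0 s B) /\
    (mean unif (fun w => \sum_k a k * Y (t k) w) = 0 /\
     mean unif (fun w => (\sum_k a k * Y (t k) w) ^+ 2) = \sum_k \sum_l a k * a l * Gamma (t l - t k)).
  move=> s.
  have q0 : 0 <= \sum_k \sum_l a k * a l * Gamma (t l - t k).
    case: n t a {s} => [|n] t a; first by rewrite big_ord0.
    have := Gp n.+1 (fun i => t (inord i)) (fun i => a (inord i)).
    by under eq_bigr do under eq_bigr do rewrite !inord_val.
  rewrite -(sqr_sqrtr q0) -/s; apply: gaussian_law_of_cos.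
    by apply: sqint_sum => k; exact: sqintZ.
  move=> b th; rewrite (eq_mean unif (g := fun w => cos (\sum_k (b * a k) * Y (t k) w + th))); last first.
    by move=> w; rewrite mulr_sumr; congr (cos (_ + _)); apply: eq_bigr => k _; rewrite mulrA.
  rewrite cY sqr_sqrtr//; congr (expR (- (_ / 2)) * _).
  rewrite mulr_suml; apply: eq_bigr => k _; rewrite mulr_suml; apply: eq_bigr => l _; ring.
have m0 t : mean unif (Y t) = 0.
  have [_ [<- _]] := law 1%N (fun=> t) (fun=> 1).
  by apply: eq_mean => w; rewrite big_ord1 mul1r.
exists X; split => //; split.
- by move=> n t a; have [h _] := law n t a; exists 0, (Num.sqrt (\sum_k \sum_l a k * a l * Gamma (t l - t k))).
- by move=> t; rewrite (expectation_mean (sqint_integ (sY t))) m0.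
move=> t tau.
have sXY (t1 t2 : int) : integ unif (fun w => Y t1 w * Y t2 w) by exact: sqint_mul.
rewrite (@covariance_mean _ RR R unif); first last.
- exact: sXY.
- exact: sqint_integ (sY _).
- exact: sqint_integ (sY _).
rewrite !m0 mulr0 subr0; congr (_%:E).
have m2 t1 : mean unif (fun w => Y t1 w * Y t1 w) = Gamma 0.
  have [_ [_]] := law 1%N (fun=> t1) (fun=> 1).
  rewrite !big_ord1 mulr1 mul1r subrr => <-.
  by apply: eq_mean => w; rewrite big_ord1 mul1r expr2.
(* Polarization: the variance of Y t + Y (t + tau) is 2 Gamma 0 + 2 Gamma tau, from which the
   covariance is extracted. *)
have [_ [_]] := law 2%N (fun i => if i == ord0 then t else t + tau) (fun=> 1).
rewrite !big_ord_recl !big_ord0/= !mulr1 !addr0 !mul1r !subrr.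
have e1 : t + tau - t = tau by rewrite addrAC subrr add0r.
have e2 : t - (t + tau) = - tau by rewrite opprD addrA subrr add0r.
rewrite e1 e2 Gs.
rewrite (eq_mean unif (g := fun w => (Y t w * Y t w + Y (t + tau) w * Y (t + tau) w) +
    (Y t w * Y (t + tau) w + Y t w * Y (t + tau) w))); last first.
  by move=> w; rewrite !big_ord_recl !big_ord0/=; ring.
rewrite meanD ?meanD ?m2; try by [exact: integD|exact: sXY].
by move=> h; rewrite [LHS](_ : _ = mean unif (fun w => Y t w * Y (t + tau) w)) //; lra.
Qed.

End gaussian_process.

(** * Almost sure convergence along geometric scales *)

Section summable_means.
Context d (T : measurableType d) (R : realType) (nu : probability T R).

Lemma sum_geometric_le (rho : R) n : 0 <= rho -> rho < 1 ->
  \sum_(k < n) rho ^+ k <= (1 - rho)^-1.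
Proof.
move=> r0 r1; have d0 : 0 < 1 - rho by rewrite subr_gt0.
rewrite -[leRHS]mul1r ler_pdivlMr// mulrC.
have -> : (1 - rho) * \sum_(k < n) rho ^+ k = 1 - rho ^+ n.
  by rewrite -[1 - _ ^+ _]opprB subrX1 -mulNr opprB.
by rewrite gerBl exprn_ge0.
Qed.

(** The series of the nonnegative functions [h l] has finite mean, hence converges almost surely,
    and its terms tend to 0. *)
Lemma ae_cvg0_of_geometric_mean (h : nat -> T -> R) (C rho : R) :
  (forall l, integ nu (h l)) -> (forall l w, 0 <= h l w) ->
  0 <= rho -> rho < 1 -> 0 <= C -> (forall l, mean nu (h l) <= C * rho ^+ l) ->
  {ae nu, forall y, h ^~ y @ \oo --> (0 : R)}.
Proof.
move=> ih h0 r0 r1 C0 hC.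
have mh l : measurable_fun setT (EFin \o h l) by apply/measurable_EFinP; exact: integ_meas.
have f0 l y : (0 <= (EFin \o h l) y)%E by rewrite /= lee_fin.
pose S y := (\big[+%E/0]_(0 <= l <oo) (EFin \o h l) y)%E.
have iS : nu.-integrable setT S.
  apply/integrableP; split.
    by apply: ge0_emeasurable_sum => // l y _ _; exact: f0.
  under eq_integral do rewrite gee0_abs ?nneseries_ge0//.
  rewrite integral_nneseries//.
  apply: (@le_lt_trans _ _ (C * (1 - rho)^-1)%:E); last exact: ltry.
  apply: lime_le; first by apply: is_cvg_nneseries => n _ _; apply: integral_ge0.
  apply: nearW => n.
  rewrite (eq_bigr (fun l => (mean nu (h l))%:E)) => [|l _]; last first.
    by rewrite /mean /Rintegral fineK//; exact: (integrable_fin_num measurableT (ih l)).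
  rewrite sumEFin lee_fin big_mkord; apply: (@le_trans _ _ (\sum_(l < n) C * rho ^+ l)).
    by apply: ler_sum.
  by rewrite -mulr_sumr ler_wpM2l// sum_geometric_le.
have := integrable_ae measurableT iS; apply: filterS => y /(_ I) fS.
apply: cvg_series_cvg_0; apply: nondecreasing_is_cvgn.
  by apply: nondecreasing_series => l _ _; exact: h0.
exists (fine (S y)) => _ [n _ <-].
by rewrite -lee_fin fineK// /series/= -sumEFin; apply: nneseries_lim_ge => l _ _; exact: f0.
Qed.

End summable_means.

(** * Choice of the geometric scales *)

Section scales.
Context (R : realType).

Lemma powR_exprn (a e : R) l : 0 <= a -> (a ^+ l) `^ e = (a `^ e) ^+ l.
Proof. by move=> a0; rewrite -!powR_mulrn ?powR_ge0// -!powRrM mulrC. Qed.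

(* The three conditions make the exponents of the geometric ratios in
   [exists_scales] negative; they are compatible as p > 2 + 2 / dlt. *)
Lemma exists_exponents (dlt p : R) : 0 < dlt -> 2 + 2 / dlt < p ->
  exists J x : nat, [/\ (x.+1 <= J)%N, J%:R < p * x%:R &
    x.+1%:R * (1 + dlt) < J%:R * (dlt / 2)].
Proof.
move=> d0 hp; have p0 : 0 < p by apply: lt_trans hp; rewrite addr_gt0// divr_gt0.
(* Positivity of [al] is the hypothesis on p rewritten. Rounding makes x + 1 at most J / p + 2, and
   [J] is taken so large that J al exceeds the resulting excess 2 (1 + dlt). *)
pose al := dlt / 2 - (1 + dlt) / p.
have al0 : 0 < al.
  rewrite subr_gt0 ltr_pdivrMr// mulrC -ltr_pdivrMr ?divr_gt0//.
  apply: le_lt_trans hp; rewrite le_eqVlt; apply/orP; left; apply/eqP; field.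
  by rewrite gt_eqF.
pose J := (Num.truncn (2 * (1 + dlt) / al)).+1.
pose x := (Num.truncn (J%:R / p)).+1.
have hJ : 2 * (1 + dlt) < J%:R * al.
  by rewrite -ltr_pdivrMr//; exact: truncnS_gt.
have xJ : J%:R < p * x%:R.
  by rewrite mulrC -ltr_pdivrMr//; exact: truncnS_gt.
have xle : x.+1%:R <= J%:R / p + 2 :> R.
  rewrite /x -addn2 natrD lerD2r.
  have := truncn_le (J%:R / p); rewrite divr_ge0 ?(ltW p0)//.
have h3 : x.+1%:R * (1 + dlt) < J%:R * (dlt / 2).
  apply: (@le_lt_trans _ _ ((J%:R / p + 2) * (1 + dlt))).
    by rewrite ler_wpM2r// addr_ge0// ltW.
  move: hJ; rewrite /al mulrBr.
  have -> : J%:R * ((1 + dlt) / p) = J%:R / p * (1 + dlt) by field; rewrite gt_eqF.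
  by lra.
exists J, x; split => //.
rewrite -(ler_nat R); have : x.+1%:R * (1 + dlt) <= J%:R * (1 + dlt).
  apply: (le_trans (ltW h3)); apply: ler_wpM2l => //; lra.
by rewrite ler_pM2r// addr_gt0.
Qed.

(** The finitely many r before the asymptotic range are absorbed in the constant, through kappa r <=
    kappa 0 and r <= N + 1. *)
Lemma bigO_powR_bound (kappa : nat -> R) (p : R) :
  (forall r s, (r <= s)%N -> kappa s <= kappa r) -> 0 <= p ->
  (kappa : nat -> R^o) =O_\oo (fun r : nat => (r%:R `^ (- p) : R^o)) ->
  exists2 C, 0 <= C & forall r, (0 < r)%N -> kappa r <= C * r%:R `^ (- p).
Proof.
move=> knon p0 /eqO_exP[C0 C00 [N _ hN]].
pose C := Num.max C0 (`|kappa 0%N| * N.+1%:R `^ p).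
exists C; first by rewrite le_max (ltW C00).
move=> r r0; have [rN|rN] := leqP N r.
  have := hN r rN; rewrite (ger0_norm (powR_ge0 _ _)) => h.
  apply: (le_trans (ler_norm _)); apply: (le_trans h).
  by rewrite ler_wpM2r ?powR_ge0// le_max lexx.
apply: (@le_trans _ _ (`|kappa 0%N| * N.+1%:R `^ p * r%:R `^ (- p))); last first.
  by rewrite ler_wpM2r ?powR_ge0// le_max lexx orbT.
apply: (le_trans (knon 0%N r _)) => //; apply: (le_trans (ler_norm _)).
rewrite -mulrA ler_peMr// powRN -[X in _ <= X]/(_ / _) ler_pdivlMr ?powR_gt0 ?ltr0n//.
by rewrite mul1r ge0_ler_powR// ?nnegrE// ler_nat (leq_trans (ltnW rN)).
Qed.

Lemma sum_sqr_inv_le n : \sum_(r < n) (r.+1%:R ^+ 2)^-1 <= 2 :> R.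
Proof.
(* The stronger bound 2 - 1 / n makes the induction telescope. *)
suff : (0 < n)%N -> \sum_(r < n) (r.+1%:R ^+ 2)^-1 <= 2 - n%:R^-1 :> R.
  case: n => [|n]; first by rewrite big_ord0.
  move=> /(_ isT); have : 0 <= n.+1%:R^-1 :> R by rewrite invr_ge0.
  by move=> h1 h2; apply: (le_trans h2); rewrite lerBlDr lerDl.
case: n => // n _; elim: n => [|n IH].
  by rewrite big_ord1 -[1%:R]/(1 : R) expr1n !invr1; lra.
rewrite big_ord_recr/=; apply: (le_trans (lerD IH (lexx _))).
have e : n.+2%:R = n.+1%:R + 1 :> R by rewrite -natr1.
have a0 : 0 < n.+1%:R :> R by rewrite ltr0n.
rewrite e; set a := n.+1%:R in a0 *.
have a1 : 0 < a + 1 by rewrite addr_gt0.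
have h1 : a^-1 - (a + 1)^-1 = (a * (a + 1))^-1 by field; rewrite !gt_eqF.
have h2 : ((a + 1) ^+ 2)^-1 <= (a * (a + 1))^-1.
  rewrite lef_pV2 ?posrE ?exprn_gt0 ?mulr_gt0//.
  by rewrite expr2 ler_wpM2r ?(ltW a1)// lerDl.
by move: h1 h2; move: (a^-1) (_ ^- 2) (_ * _)^-1 (a + 1)^-1 => u v w z; lra.
Qed.

Lemma sum_kappa_le (kappa : nat -> R) (C p : R) : 2 <= p -> 0 <= C ->
  (forall r, 0 <= kappa r) -> (forall r, (0 < r)%N -> kappa r <= C * r%:R `^ (- p)) ->
  forall n, \sum_(r < n) kappa r <= kappa 0%N + C * 2.
Proof.
move=> p2 C0 k0 kC [|n]; first by rewrite big_ord0 addr_ge0// mulr_ge0.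
rewrite big_ord_recl lerD2l; apply: (@le_trans _ _ (C * \sum_(r < n) (r.+1%:R ^+ 2)^-1)).
  rewrite mulr_sumr; apply: ler_sum => r _; apply: (le_trans (kC _ _)) => //=.
  rewrite ler_wpM2l// powRN lef_pV2 ?posrE ?powR_gt0 ?exprn_gt0 ?ltr0n//.
  by rewrite -powR_mulrn// ler_powR// ler1n.
by rewrite ler_wpM2l// sum_sqr_inv_le.
Qed.

(** Each distance occurs at most once on either side of i. *)
Lemma sum_gap_le (kappa : nat -> R) (S : R) (T i : nat) : (i < T)%N ->
  (forall n, \sum_(r < n) kappa r <= S) ->
  \sum_(j < T | j != i :> nat) kappa (gap i j) <= 2 * S.
Proof.
move=> iT hS; have -> : T = (i + (1 + (T - i.+1)))%N by lia.
rewrite big_mkcond big_split_ord/= [X in _ + X]big_split_ord/= big_ord1/=.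
rewrite addn0 eqxx add0r mulr2n mulrDl mul1r; apply: lerD.
  apply: le_trans (hS i); rewrite (reindex_inj rev_ord_inj) le_eqVlt; apply/orP; left; apply/eqP.
  apply: eq_bigr => j _ /=; have ji := ltn_ord j.
  have -> : (i - j.+1)%N != i by apply/eqP; lia.
  by rewrite /gap; congr kappa; lia.
apply: le_trans (hS (T - i.+1)%N); rewrite le_eqVlt; apply/orP; left; apply/eqP.
apply: eq_bigr => j _ /=; have -> : (i + (1 + j))%N != i by apply/eqP; lia.
by rewrite /gap; congr kappa; lia.
Qed.

(** A period contains q gap indices, and at most T / b + 1 periods are met; b <= T absorbs the
    rounding into the factor 2. *)
Lemma sum_small_le (b q T : nat) : (0 < b)%N -> (b <= T)%N ->
  \sum_(i < T | small b q i) (1 : R) <= 2 * (q%:R * (T%:R / b%:R)).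
Proof.
move=> b0 bT; pose c := (b + q)%N; pose K := (T %/ c).+1.
have TK : (T <= K * c)%N by rewrite ltnW// ltn_ceil// /c addn_gt0 b0.
have cnt : \sum_(i < K * c | small b q i) (1 : R) = K%:R * q%:R.
  rewrite big_mkcond (sum_blocks (fun i => if small b q i then 1 else 0)).
  rewrite (eq_bigr (fun _ => q%:R)) ?sumr_const ?card_ord ?mulr_natl// => k _.
  rewrite big_split_ord/= big1 ?add0r => [|i _]; last first.
    by rewrite /small modnMDl modn_small ?ltn_addr//= leqNgt ltn_ord.
  rewrite (eq_bigr (fun=> 1)) ?sumr_const ?card_ord// => i _.
  by rewrite /small modnMDl modn_small ?ltn_add2l// leq_addr.
apply: (@le_trans _ _ (\sum_(i < K * c | small b q i) (1 : R))).
  rewrite -(subnKC TK) big_mkcond [leRHS]big_mkcond big_split_ord/= lerDl.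
  by apply: sumr_ge0 => i _; case: ifP.
have bR : 0 < b%:R :> R by rewrite ltr0n.
rewrite cnt mulrC [leRHS]mulrCA ler_wpM2l// mulrA ler_pdivlMr// -!natrM ler_nat /K.
have := leq_trunc_div T c; rewrite /c; nia.
Qed.

End scales.

Section scale_choice.
Context (R : realType).

Lemma exists_scales (dlt p : R) (kappa : nat -> R) : 0 < dlt -> 2 + 2 / dlt < p ->
  (forall r, 0 <= kappa r) -> (forall r s, (r <= s)%N -> kappa s <= kappa r) ->
  (kappa : nat -> R^o) =O_\oo (fun r : nat => (r%:R `^ (- p) : R^o)) ->
  exists (M b q T lv : nat -> nat) (C rho : R),
  [/\ [/\ forall l, (0 < M l)%N, forall l, (0 < b l + q l)%N,
          forall N, (0 < N)%N -> (M (lv N) <= N)%N,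
          forall N, (0 < N)%N -> (N + (b (lv N) + q (lv N)) <= T (lv N))%N &
          lv @ \oo --> \oo],
      [/\ 0 <= C, 0 <= rho & rho < 1] &
      forall l,
        [/\ (M l)%:R^-1 * (\sum_(i < T l) \sum_(j < T l | j != i :> nat)
              (kappa (q l) + (if small (b l) (q l) i then kappa (gap i j) else 0))) <= C * rho ^+ l,
            (M l)%:R^-1 * (\sum_(i < T l | small (b l) (q l) i) 1) <= C * rho ^+ l &
            (Num.sqrt (M l)%:R)^-1 `^ (2 + dlt) *
              ((b l + q l)%:R `^ (1 + dlt) * (T l)%:R) <= C * rho ^+ l]].
Proof.
have arith (n X m u v : nat) : (n < X -> u <= m -> v <= u -> n + (u + v) <= X + 2 * m)%N.
  by lia.
move=> d0 hp k0 kn kO.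
have [J [x [xJ Jp xd]]] := exists_exponents d0 hp.
have p2 : 2 <= p by apply: ltW; apply: le_lt_trans hp; rewrite lerDl divr_ge0// ltW.
have [C1 C10 kC] := bigO_powR_bound kn (le_trans (ler0n R 2) p2) kO.
have kS := sum_kappa_le p2 C10 k0 kC; set S := _ + _ in kS.
have S0 : 0 <= S by rewrite addr_ge0// mulr_ge0.
pose M l := ((2 ^ J) ^ l)%N; pose b l := ((2 ^ x.+1) ^ l)%N; pose q l := ((2 ^ x) ^ l)%N.
(* A number N of scale l satisfies N < 2^J * M l, and b l + q l <= 2 * M l; hence the factor 2^J +
   2. *)
pose T l := ((2 ^ J + 2) * M l)%N; pose lv N := trunc_log (2 ^ J) N.
have J1 : (1 < 2 ^ J)%N by rewrite -[1%N]/(2 ^ 0)%N ltn_exp2l// (leq_trans _ xJ).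
have M0 l : (0 < M l)%N by rewrite !expn_gt0.
have b0 l : (0 < b l)%N by rewrite !expn_gt0.
have q0 l : (0 < q l)%N by rewrite !expn_gt0.
have qb l : (q l <= b l)%N by rewrite /q /b -!expnM leq_exp2l// leq_mul2r leqnSn orbT.
have bM l : (b l <= M l)%N by rewrite /M /b -!expnM leq_exp2l// leq_mul2r xJ orbT.
have bT l : (b l <= T l)%N by rewrite (leq_trans (bM l))// leq_pmull// addn_gt0 orbT.
pose A : R := (2 ^ J)%:R; pose B : R := (2 ^ x.+1)%:R; pose Q : R := (2 ^ x)%:R.
pose c0 : R := (2 ^ J + 2)%:R.
have p2E n : (2 ^ n)%:R = 2 `^ n%:R :> R by rewrite powR_mulrn// natrX.
have p2lt (e : R) : e < 0 -> 2 `^ e < 1.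
  move=> e0; have : 1 `^ (- e) < 2 `^ (- e) :> R.
    by apply: gt0_ltr_powR; rewrite ?nnegrE ?oppr_gt0// ltr1n.
  rewrite powR1 => h; have -> : 2 `^ e = (2 `^ (- e))^-1 :> R by rewrite powRN invrK.
  by rewrite invf_lt1// powR_gt0.
have p2D (e f : R) : 2 `^ (e + f) = 2 `^ e * 2 `^ f :> R.
  by rewrite powRD// pnatr_eq0 implybT.
have A0 : 0 < A by rewrite ltr0n expn_gt0.
have B0 : 0 < B by rewrite ltr0n expn_gt0.
have Q0 : 0 < Q by rewrite ltr0n expn_gt0.
have c00 : 0 <= c0 by rewrite ler0n.
(* As powers of 2, [rho1] has exponent J - p x and [rho3] has exponent (x + 1) (1 + dlt) - J dlt /
   2, both negative by [exists_exponents]. The ratio of q to b contributes the remaining value 2^-1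
   to [rho]. *)
pose rho1 := A * Q `^ (- p); pose rho3 := A `^ (- (1 + dlt / 2)) * B `^ (1 + dlt) * A.
have r1 : 0 <= rho1 < 1.
  rewrite mulr_ge0 ?powR_ge0 ?(ltW A0)//= /rho1 /A /Q !p2E -powRrM -p2D; apply: p2lt.
  by lra.
have r3 : 0 <= rho3 < 1.
  rewrite !mulr_ge0 ?powR_ge0 ?(ltW A0)//= /rho3 /A /B !p2E -!powRrM -!p2D; apply: p2lt.
  by lra.
pose rho := Num.max (Num.max rho1 2^-1) rho3.
have rho0 : 0 <= rho by rewrite /rho le_max; case/andP: r3 => ->; rewrite orbT.
have rle (r : R) l : 0 <= r -> r <= rho -> r ^+ l <= rho ^+ l.
  by move=> *; rewrite lerXn2r// nnegrE.
pose C := c0 ^+ 2 * C1 + 4 * S * c0 + 2 * c0 + 2 `^ (1 + dlt) * c0.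
have k1 : 0 <= c0 ^+ 2 * C1 by rewrite mulr_ge0// sqr_ge0.
have k2 : 0 <= 4 * S * c0 by rewrite !mulr_ge0.
have k3 : 0 <= 2 * c0 by rewrite mulr_ge0.
have k4 : 0 <= 2 `^ (1 + dlt) * c0 by rewrite mulr_ge0// powR_ge0.
have C0 : 0 <= C by rewrite /C !addr_ge0.
have ME l : (M l)%:R = A ^+ l by rewrite natrX.
have bE l : (b l)%:R = B ^+ l by rewrite natrX.
have qE l : (q l)%:R = Q ^+ l by rewrite natrX.
have TE l : (T l)%:R = c0 * A ^+ l by rewrite natrM ME.
have QB : Q / B = 2^-1.
  by rewrite /Q /B expnS natrM invfM mulrCA divff ?mulr1// gt_eqF.
have hsm l : (M l)%:R^-1 * (2 * ((q l)%:R * ((T l)%:R / (b l)%:R))) = 2 * c0 * 2^-1 ^+ l.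
  have a0 : A ^+ l != 0 by rewrite expf_neq0// gt_eqF.
  rewrite ME qE TE bE -QB expr_div_n; field; rewrite a0 expf_neq0// gt_eqF//.
exists M, b, q, T, lv, C, rho; split.
- split => //.
  + by move=> l; rewrite addn_gt0 b0.
  + by move=> N N0; exact: trunc_logP.
  + move=> N N0; have h1 := trunc_log_ltn N J1.
    by rewrite /T mulnDl; apply: arith => //; rewrite /M -expnS.
  + apply/cvgnyPge => n; exists ((2 ^ J) ^ n)%N => //= N hN.
    exact: trunc_log_max.
- split => //; rewrite /rho !gt_max; case/andP: r1 => _ ->; case/andP: r3 => _ ->.
  by rewrite invf_lt1 ?ltr1n.
move=> l; split.
- have e1 : \sum_(i < T l) \sum_(j < T l | j != i :> nat)
      (kappa (q l) + (if small (b l) (q l) i then kappa (gap i j) else 0)) <=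
      (T l)%:R ^+ 2 * kappa (q l) + 2 * S * (2 * ((q l)%:R * ((T l)%:R / (b l)%:R))).
    apply: (@le_trans _ _ (\sum_(i < T l) ((T l)%:R * kappa (q l) + if small (b l) (q l) i then 2 * S else 0))).
      apply: ler_sum => i _; rewrite big_split/=; apply: lerD.
        rewrite big_mkcond/=; apply: (@le_trans _ _ (\sum_(j < T l) kappa (q l))).
          by apply: ler_sum => j _; case: ifP.
        by rewrite sumr_const card_ord mulr_natl.
      case: ifP => _; last by rewrite big1.
      exact: (sum_gap_le (ltn_ord i) kS).
    rewrite big_split/=; apply: lerD.
      by rewrite sumr_const card_ord -[_ *+ T l]mulr_natl mulrA -expr2.
    rewrite -big_mkcond/= -[X in _ <= X * _]mulr1.
    have := sum_small_le R (q l) (b0 l) (bT l).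
    move=> /(ler_wpM2l (mulr_ge0 (ler0n R 2) S0)); rewrite mulr1 mulr_sumr.
    by under [X in X <= _ -> _]eq_bigr do rewrite mulr1.
  apply: (le_trans (ler_wpM2l _ e1)); first by rewrite invr_ge0.
  rewrite mulrDr [X in _ + X]mulrCA hsm.
  have e2 : (M l)%:R^-1 * ((T l)%:R ^+ 2 * kappa (q l)) <= c0 ^+ 2 * C1 * rho1 ^+ l.
    rewrite TE ME; apply: (@le_trans _ _ ((A ^+ l)^-1 * ((c0 * A ^+ l) ^+ 2 * (C1 * (q l)%:R `^ (- p))))).
      rewrite ler_wpM2l ?invr_ge0 ?exprn_ge0 ?(ltW A0)// ler_wpM2l ?sqr_ge0// kC//.
    rewrite qE powR_exprn ?(ltW Q0)// /rho1 [(A * _) ^+ l]exprMn.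
    rewrite le_eqVlt; apply/orP; left; apply/eqP; field.
    by rewrite expf_neq0// gt_eqF.
  apply: (@le_trans _ _ (c0 ^+ 2 * C1 * rho ^+ l + 4 * S * c0 * rho ^+ l)).
    apply: lerD; first apply: (le_trans e2).
      rewrite ler_wpM2l// rle//; first by case/andP: r1.
      by rewrite /rho !le_max lexx.
    have -> : 2 * S * (2 * c0 * 2^-1 ^+ l) = 4 * S * c0 * 2^-1 ^+ l by ring.
    by rewrite ler_wpM2l// rle ?invr_ge0// /rho !le_max lexx orbT.
  by rewrite -mulrDl ler_wpM2r ?exprn_ge0// /C -addrA lerDl addr_ge0.
- apply: (@le_trans _ _ (2 * c0 * 2^-1 ^+ l)).
    by rewrite -hsm ler_wpM2l ?invr_ge0//; exact: sum_small_le.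
  apply: ler_pM => //; rewrite ?exprn_ge0 ?invr_ge0//.
    by rewrite /C addrAC lerDr !addr_ge0.
  by rewrite rle ?invr_ge0// /rho !le_max lexx orbT.
rewrite TE ME -powR12_sqrt ?exprn_ge0 ?(ltW A0)// -powRN -powRrM.
have -> : - 2^-1 * (2 + dlt) = - (1 + dlt / 2) by lra.
rewrite (powR_exprn _ _ (ltW A0)).
have e1 : (b l + q l)%:R `^ (1 + dlt) <= 2 `^ (1 + dlt) * (B `^ (1 + dlt)) ^+ l.
  rewrite -powR_exprn ?(ltW B0)// -powRM ?exprn_ge0 ?(ltW B0)//.
  apply: ge0_ler_powR; rewrite ?nnegrE ?mulr_ge0 ?exprn_ge0 ?(ltW B0)//; first lra.
  by rewrite -bE -natrM ler_nat mul2n -addnn leq_add2l.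
apply: (@le_trans _ _ (2 `^ (1 + dlt) * c0 * rho3 ^+ l)).
  have -> : 2 `^ (1 + dlt) * c0 * rho3 ^+ l =
    (A `^ (- (1 + dlt / 2))) ^+ l * (2 `^ (1 + dlt) * (B `^ (1 + dlt)) ^+ l * (c0 * A ^+ l)).
    by rewrite /rho3 !exprMn; ring.
  rewrite ler_wpM2l ?exprn_ge0 ?powR_ge0// ler_wpM2r// mulr_ge0// exprn_ge0// ltW//.
apply: ler_pM => //; rewrite ?exprn_ge0//; case/andP: r3 => // r30 _; rewrite ?exprn_ge0//.
  by rewrite /C lerDr !addr_ge0.
by rewrite rle// /rho le_max lexx orbT.
Qed.

End scale_choice.

(** * Means over random trajectories *)

Section trajectories.
Context (R : realType).

Lemma measurable_eval (I : Type) d (T : measurableType d) (i : I) :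
  measurable_fun setT (fun x : family_space I T => x i).
Proof.
move=> _ B mB; rewrite setTI; apply: sub_gen_smallest.
by exists i, B.
Qed.

Context d (Om : measurableType d) (P : probability Om R).

Lemma mean_distribution_ge0 d' (T : measurableType d') (X : {RV P >-> T}) (f : T -> R) :
  measurable_fun setT f -> (forall x, 0 <= f x) ->
  mean (distribution P X) f = mean P (fun w => f (X w)).
Proof.
move=> mf f0; rewrite /mean /Rintegral ge0_integral_distribution//.
exact/measurable_EFinP.
Qed.

Lemma integ_distribution d' (T : measurableType d') (X : {RV P >-> T}) (f : T -> R) :
  measurable_fun setT f -> integ P (fun w => f (X w)) -> integ (distribution P X) f.
Proof.
move=> mf /integrableP[_ fX]; apply/integrableP; split; first exact/measurable_EFinP.
rewrite ge0_integral_distribution//.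
apply: measurableT_comp => //; exact/measurable_EFinP.
Qed.

(** Meant for conditional moments given the trajectory, which may be infinite on a null set. *)
Lemma integ_fine (m : Om -> \bar R) : measurable_fun setT m -> (forall w, (0 <= m w)%E) ->
  (\int[P]_w m w < +oo)%E ->
  [/\ integ P (fun w => fine (m w)), mean P (fun w => fine (m w)) <= fine (\int[P]_w m w) &
      {ae P, forall w, (m w < +oo)%E}].
Proof.
move=> mm m0 mfin.
have fm w : ((fine (m w))%:E <= m w)%E.
  by case: (m w) (m0 w) => //= x _; rewrite lee_fin leey.
have mf : measurable_fun setT (fun w => fine (m w)) by exact: measurableT_comp.
have iP : P.-integrable setT m.
  by apply/integrableP; split => //; under eq_integral do rewrite gee0_abs//.
have i1 : integ P (fun w => fine (m w)).
  apply: le_integrable iP => //; first exact/measurable_EFinP.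
  by move=> w _; rewrite /= ger0_norm ?fine_ge0// gee0_abs.
split => //.
  rewrite /mean /Rintegral fine_le//.
  - exact: (integrable_fin_num measurableT i1).
  - exact: integrable_fin_num.
  - apply: ge0_le_integral => //; last exact/measurable_EFinP.
    by move=> w _; rewrite lee_fin fine_ge0.
have := integrable_ae measurableT iP; apply: filterS => w /(_ I).
by rewrite ge0_fin_numE.
Qed.

End trajectories.

Section setting.
Context d (Omega : measurableType d) (R : realType) (P : probability Omega R) (s : nat).
Variables (mu : probability (s.-tuple R) R)
  (Y : {RV P >-> family_space nat (s.-tuple R)})
  (eps : {RV P >-> family_space nat (family_space int R)})
  (Z : int -> s.-tuple R -> family_space int R -> R)
  (V : s.-tuple R -> R).
Hypotheses (Y_indep : mutually_independent P (fun (i : nat) w => Y w i))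
  (Y_law : forall (i : nat) (B : set (s.-tuple R)), measurable B ->
     P [set w | B (Y w i)] = mu B)
  (Y_eps_indep : independent2 P Y eps)
  (Z_meas : forall t : int, measurable_fun setT
     (fun q : s.-tuple R * family_space int R => Z t q.1 q.2)).
Local Notation nu := (distribution P Y).

Lemma measurable_coordinate (i : nat) : measurable_fun setT (fun w => Y w i).
Proof.
by apply: (measurableT_comp (f := fun y : family_space nat (s.-tuple R) => y i)) => //; exact: measurable_eval.
Qed.

Definition coordinate (i : nat) : {RV P >-> s.-tuple R} :=
  HB.pack (fun w => Y w i)
    (isMeasurableFun.Build _ _ _ _ (fun w => Y w i) (measurable_coordinate i)).

Lemma measurable_innovation (i : nat) : measurable_fun setT (fun w => eps w i).
Proof.
by apply: (measurableT_comp (f := fun e : family_space nat (family_space int R) => e i)) => //; exact: measurable_eval.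
Qed.

Lemma ae_coordinates (Q : s.-tuple R -> Prop) :
  {ae mu, forall x, Q x} -> {ae nu, forall y : family_space nat (s.-tuple R), forall i : nat, Q (y i)}.
Proof.
move=> [B [mB B0 QB]]; apply: ae_foralln => i.
exists [set y : family_space nat (s.-tuple R) | B (y i)]; split.
- by rewrite -[X in measurable X]setTI; apply: (measurable_eval i).
- by rewrite -B0 -(Y_law i mB).
- by move=> y /= nQ; exact: QB.
Qed.

Lemma coordinates_independent (i j : nat) : i != j ->
  independent2 P (coordinate i) (coordinate j).
Proof.
move=> ij A B mA mB.
have u : uniq [:: i; j] by rewrite /= inE ij.
have := @Y_indep [:: i; j] (fun k => if k == i then A else B) u.
rewrite !big_cons big_nil eqxx eq_sym (negbTE ij) mule1 => <-; last first.
  by move=> k; case: ifP.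
congr (P _); apply/seteqP; split => w /=.
  move=> [h1 h2] k; rewrite !inE => /orP[/eqP ->|/eqP ->]; first by rewrite eqxx.
  by rewrite eq_sym (negbTE ij).
move=> h; split; first by have := h i; rewrite inE !eqxx => /(_ isT).
by have := h j; rewrite !inE eqxx orbT eq_sym (negbTE ij) => /(_ isT).
Qed.

Lemma ae_forall_int (Q : int -> family_space nat (s.-tuple R) -> Prop) :
  (forall t, {ae nu, forall y, Q t y}) -> {ae nu, forall y, forall t, Q t y}.
Proof.
move=> hQ; have := ae_foralln (fun n => hQ (odflt 0 (unpickle n))).
by apply: filterS => y h t; have := h (pickle t); rewrite pickleK.
Qed.

Variables (kappa : nat -> R) (M b q T : nat -> nat) (C rho : R).
Hypotheses (kappa0 : forall r, 0 <= kappa r) (C0 : 0 <= C) (rho0 : 0 <= rho) (rho1 : rho < 1).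

Section weights.
Hypotheses (mV : measurable_fun setT V) (V_gt0 : {ae mu, forall x, 0 < V x})
  (V_int : (\int[mu]_x (V x)%:E < +oo)%E).

Lemma integ_norm_weight : (\int[mu]_x (`|V x|)%:E < +oo)%E.
Proof.
apply: le_lt_trans V_int; rewrite le_eqVlt; apply/orP; left; apply/eqP.
apply: ae_eq_integral => //; try exact/measurable_EFinP; last first.
  by apply: filterS V_gt0 => x V0 _; rewrite gtr0_norm.
by apply/measurable_EFinP; exact: measurableT_comp.
Qed.

(** Distinct coordinates are independent, so by [freezing] the product is integrable as soon as V
    is, with a bound that does not depend on i and j. Absolute values are taken because V is
    positive only almost everywhere. *)
Lemma weights_pair (i j : nat) : i != j ->
  let f := fun y : family_space nat (s.-tuple R) => `|V (y i)| * `|V (y j)| in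
  integ nu f /\ mean nu f <= mean mu (fun x => `|V x|) ^+ 2.
Proof.
move=> ij f.
have mVn : measurable_fun setT (fun x => `|V x|) by exact: measurableT_comp.
have me k : measurable_fun setT (fun y : family_space nat (s.-tuple R) => `|V (y k)|).
  apply: (measurableT_comp (f := fun x : s.-tuple R => `|V x|)) => //.
  exact: measurable_eval.
have mf : measurable_fun setT f by exact: measurable_funM.
pose G (q : s.-tuple R * s.-tuple R) : \bar R := (`|V q.1| * `|V q.2|)%:E.
have mG : measurable_fun setT G.
  apply/measurable_EFinP/measurable_funM.
    by apply: (measurableT_comp (f := fun x : s.-tuple R => `|V x|)).
  by apply: (measurableT_comp (f := fun x : s.-tuple R => `|V x|)).
have G0 x : (0 <= G x)%E by rewrite lee_fin mulr_ge0.
pose m := mean mu (fun x => `|V x|).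
have em : (\int[mu]_x (`|V x|)%:E)%E = m%:E.
  rewrite /m /mean /Rintegral fineK// ge0_fin_numE ?integ_norm_weight//.
  by apply: integral_ge0 => x _; rewrite lee_fin.
have key : (\int[P]_w (f (Y w))%:E = (m ^+ 2)%:E)%E.
  transitivity (\int[P]_(w in coordinate i @^-1` setT) G (coordinate i w, coordinate j w))%E.
    by rewrite preimage_setT.
  rewrite (freezing (coordinates_independent ij) measurableT mG G0).
  transitivity (\int[mu]_x (m%:E * (`|V x|)%:E))%E; last first.
    by rewrite ge0_integralZl_EFin ?em//; [exact/measurable_EFinP|exact: mean_ge0].
  transitivity (\int[distribution P (coordinate i)]_x (m%:E * (`|V x|)%:E))%E; last first.
    by apply: eq_measure_integral => A mA _; exact: Y_law.
  apply: eq_integral => x _; rewrite /G/=.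
  under eq_integral do rewrite EFinM.
  rewrite ge0_integralZl_EFin//; last first.
    by apply/measurable_EFinP; apply: (measurableT_comp (f := fun x : s.-tuple R => `|V x|)) => //; exact: measurable_coordinate.
  rewrite muleC; congr (_ * _)%E; rewrite -em.
  have -> : (\int[mu]_x (`|V x|)%:E = \int[distribution P (coordinate j)]_x (`|V x|)%:E)%E.
    by apply: eq_measure_integral => A mA _; exact: (esym (Y_law j mA)).
  by rewrite ge0_integral_distribution//; exact/measurable_EFinP.
split.
  apply: integ_distribution => //; apply/integrableP; split.
    by apply/measurable_EFinP; exact: measurableT_comp.
  under eq_integral do rewrite gee0_abs ?lee_fin ?mulr_ge0//.
  by rewrite key ltry.
rewrite mean_distribution_ge0 => [|//|y]; last exact: mulr_ge0.
by rewrite /mean /Rintegral key.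
Qed.

(** The uniform bound on pairs reduces the mean of the normalized [hsum] to a constant times the
    deterministic sum of its kernel, which decays geometrically. *)
Lemma ae_hsum_cvg0 :
  (forall l, (M l)%:R^-1 * (\sum_(i < T l) \sum_(j < T l | j != i :> nat)
     (kappa (q l) + (if small (b l) (q l) i then kappa (gap i j) else 0))) <= C * rho ^+ l) ->
  {ae nu, forall y : family_space nat (s.-tuple R), (forall i, 0 <= V (y i)) /\
    (fun l => (M l)%:R^-1 * hsum (fun i => V (y i)) kappa (b l) (q l) (T l)) @ \oo --> (0 : R)}.
Proof.
move=> hC.
have Vy := ae_coordinates V_gt0.
(* The condition j != i is moved into the kernel, since only products over distinct coordinates are
   known to be integrable. *)
pose K l (i j : nat) : R := if j != i then
  kappa (q l) + (if small (b l) (q l) i then kappa (gap i j) else 0) else 0.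
have K0 l i j : 0 <= K l i j.
  by rewrite /K; case: ifP => // _; rewrite addr_ge0//; case: ifP.
pose h l (y : family_space nat (s.-tuple R)) : R :=
  (M l)%:R^-1 * \sum_(i < T l) \sum_(j < T l) K l i j * (`|V (y i)| * `|V (y j)|).
have iK l (i j : nat) : integ nu (fun y => K l i j * (`|V (y i)| * `|V (y j)|)).
  rewrite /K; case: ifPn => [ji|_].
    have ij : i != j by rewrite eq_sym.
    by apply: integZ; have [] := weights_pair ij.
  have -> : (fun y : family_space nat (s.-tuple R) => 0 * (`|V (y i)| * `|V (y j)|)) = cst 0.
    by apply/funext => y; rewrite mul0r.
  exact: integ_cst.
have iS l (i : nat) : integ nu (fun y => \sum_(j < T l) K l i j * (`|V (y i)| * `|V (y j)|)).
  by apply: integ_sum => j; exact: iK.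
pose m := mean mu (fun x => `|V x|).
have mh l : mean nu (h l) <= m ^+ 2 * C * rho ^+ l.
  rewrite /h meanZ; last by apply: integ_sum => i; exact: iS.
  rewrite mean_sum => [|i]; last exact: iS.
  rewrite -mulrA; apply: (le_trans _ (ler_wpM2l (sqr_ge0 m) (hC l))).
  rewrite mulrCA ler_wpM2l ?invr_ge0// mulr_sumr; apply: ler_sum => i _.
  rewrite mean_sum => [|j]; last exact: iK.
  rewrite mulr_sumr [leRHS]big_mkcond; apply: ler_sum => j _.
  rewrite /K; case: ifPn => [ji|_]; last first.
    rewrite (eq_mean _ (g := fun=> 0)) ?mean_cst// => y; exact: mul0r.
  have ij : (i : nat) != j by rewrite eq_sym.
  have [iV hV] := weights_pair ij.
  rewrite meanZ// [leRHS]mulrC ler_wpM2l//.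
  by rewrite addr_ge0//; case: ifP.
have H : {ae nu, forall y, h ^~ y @ \oo --> (0 : R)}.
  apply: (ae_cvg0_of_geometric_mean _ _ rho0 rho1 _ mh).
  - by move=> l; apply: integZ; apply: integ_sum => i; exact: iS.
  - move=> l y; rewrite mulr_ge0 ?invr_ge0//; apply: sumr_ge0 => i _; apply: sumr_ge0 => j _.
    by rewrite !mulr_ge0.
  - by rewrite mulr_ge0// sqr_ge0.
refine (@filterS2 _ (almost_everywhere nu) _ _ _ _ _ Vy H) => y Vp hy.
have Vp' i : 0 <= V (y i) by exact: ltW.
split => //; rewrite (_ : (fun l => _) = h ^~ y)//; apply/funext => l.
rewrite /h /hsum; congr (_ * _); apply: eq_bigr => i _; rewrite [LHS]big_mkcond.
apply: eq_bigr => j _; rewrite /K; case: ifP => _; last by rewrite mul0r.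
by rewrite !ger0_norm// mulrA.
Qed.

End weights.

Section moments.
Hypothesis Z_stationary : stationary P (annealed eps Z Y).

Lemma measurable_quenched (y : family_space nat (s.-tuple R)) (i : nat) (t : int) :
  measurable_fun setT (quenched eps Z y i t).
Proof.
apply: (measurableT_comp (f := fun x : s.-tuple R * family_space int R => Z t x.1 x.2)
  (g := fun w => (y i, eps w i))) => //.
by apply: measurable_fun_pair => //; exact: measurable_innovation.
Qed.

Lemma measurable_annealed (i : nat) (t : int) :
  measurable_fun setT (fun w => annealed eps Z Y i w t).
Proof.
apply: (measurableT_comp (f := fun x : s.-tuple R * family_space int R => Z t x.1 x.2)
  (g := fun w => (Y w i, eps w i))) => //.
by apply: measurable_fun_pair => //; [exact: measurable_coordinate|exact: measurable_innovation].
Qed.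

(** The one-dimensional case of stationarity in i; it makes the moment bounds uniform over the
    components. *)
Lemma annealed_moment_stationary (f : R -> R) (i : nat) (t : int) :
  measurable_fun setT f -> (forall x, 0 <= f x) ->
  (\int[P]_w (f (annealed eps Z Y i w t))%:E = \int[P]_w (f (annealed eps Z Y 0%N w t))%:E)%E.
Proof.
move=> mf f0.
pose X (k : nat) : {RV P >-> R} := HB.pack (fun w => annealed eps Z Y k w t)
  (isMeasurableFun.Build _ _ Omega R (fun w => annealed eps Z Y k w t) (measurable_annealed k t)).
have law k : (\int[P]_w (f (annealed eps Z Y k w t))%:E = \int[distribution P (X k)]_x (f x)%:E)%E.
  rewrite ge0_integral_distribution//; exact/measurable_EFinP.
rewrite !law; apply: eq_measure_integral => B mB _.
have mB' : measurable [set x : family_space int R | B (x t)].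
  by rewrite -[X in measurable X]setTI; exact: (measurable_eval t).
have := @Z_stationary 1%N (fun=> 0%N) i (fun=> [set x : family_space int R | B (x t)]) (fun=> mB').
rewrite (_ : [set w | forall k, _] = X i @^-1` B); last first.
  by apply/seteqP; split => w /= h; [exact: (h ord0)|move=> k].
rewrite (_ : [set w | forall k, _] = X 0%N @^-1` B)//.
by apply/seteqP; split => w /= h; [exact: (h ord0)|move=> k].
Qed.

(** By [freezing], integrating over y the moment along the trajectory y returns the annealed moment,
    which is finite and does not depend on i. *)
Lemma quenched_moment (r : R) (t : int) :
  (forall i, 'E_P[ (fun w => (`| annealed eps Z Y i w t | `^ r)%R) ] < +oo)%E ->
  exists2 c : R, 0 <= c & forall i : nat,
    let m := fun y => mean P (fun w => `|quenched eps Z y i t w| `^ r) in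
    [/\ integ nu m, mean nu m <= c &
     {ae nu, forall y, integ P (fun w => `|quenched eps Z y i t w| `^ r)}].
Proof.
move=> Zq; have mq : measurable_fun setT (fun x : R => `|x| `^ r).
  by apply: measurable_norm_powR; exact: measurable_id.
pose c := (\int[P]_w (`|annealed eps Z Y 0%N w t| `^ r)%:E)%E.
have cfin : (c < +oo)%E by have := Zq 0%N; rewrite unlock.
exists (fine c); first by apply: fine_ge0; apply: integral_ge0 => w _; rewrite lee_fin powR_ge0.
move=> i m.
pose G (q0 : family_space nat (s.-tuple R) * family_space nat (family_space int R)) : \bar R :=
  (`|Z t (q0.1 i) (q0.2 i)| `^ r)%:E.
have mG : measurable_fun setT G.
  apply/measurable_EFinP; apply: (measurableT_comp (f := fun x : R => `|x| `^ r)) => //.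
  apply: (measurableT_comp (f := fun q : s.-tuple R * family_space int R => Z t q.1 q.2)
    (g := fun q0 : family_space nat (s.-tuple R) * family_space nat (family_space int R) =>
      (q0.1 i, q0.2 i))) => //.
  apply: measurable_fun_pair.
    apply: (measurableT_comp (f := fun y : family_space nat (s.-tuple R) => y i)) => //.
    exact: measurable_eval.
  apply: (measurableT_comp (f := fun e : family_space nat (family_space int R) => e i)) => //.
  exact: measurable_eval.
have G0 q0 : (0 <= G q0)%E by rewrite lee_fin powR_ge0.
pose e (y : family_space nat (s.-tuple R)) := (\int[P]_w G (y, eps w))%E.
have eE : e = fubini_F (distribution P eps) G.
  apply/funext => y; rewrite /e /fubini_F ge0_integral_distribution//.
  by apply: (measurableT_comp mG); exact: measurable_fun_pair.
have me : measurable_fun setT e.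
  by rewrite eE; exact: measurable_fun_fubini_tonelli_F.
have e0 y : (0 <= e y)%E by apply: integral_ge0.
have ie : (\int[nu]_y e y = c)%E.
  rewrite -(freezing Y_eps_indep measurableT mG G0) preimage_setT.
  exact: (@annealed_moment_stationary (fun x => `|x| `^ r)).
have efin : (\int[nu]_y e y < +oo)%E by rewrite ie.
have [h1 h2 h3] := integ_fine me e0 efin.
split.
- exact: h1.
- by rewrite -ie.
apply: filterS h3 => y ey; apply/integrableP; split.
  apply/measurable_EFinP; apply: (measurableT_comp (f := fun x : R => `|x| `^ r)) => //.
  exact: measurable_quenched.
by under eq_integral do rewrite gee0_abs ?lee_fin ?powR_ge0//.
Qed.

(** Both sums are affine in the quenched moments, whose means are at most c, so their means inherit
    the deterministic geometric decay. *)
Lemma ae_moment_sums_cvg0 (dlt : R) (Zq : forall (i : nat) (t : int),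
     ('E_P[ (fun w => (`| annealed eps Z Y i w t | `^ (2 + dlt))%R) ] < +oo)%E) :
  (forall l, (M l)%:R^-1 * (\sum_(i < T l | small (b l) (q l) i) 1) <= C * rho ^+ l) ->
  (forall l, (Num.sqrt (M l)%:R)^-1 `^ (2 + dlt) *
              ((b l + q l)%:R `^ (1 + dlt) * (T l)%:R) <= C * rho ^+ l) ->
  {ae nu, forall y, forall t,
    let m i := mean P (fun w => `|quenched eps Z y i t w| `^ (2 + dlt)) in
    [/\ forall i, integ P (fun w => `|quenched eps Z y i t w| `^ (2 + dlt)),
      (fun l => (M l)%:R^-1 * \sum_(i < T l | small (b l) (q l) i) (1 + m i)) @ \oo --> (0 : R) &
      (fun l => (Num.sqrt (M l)%:R)^-1 `^ (2 + dlt) *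
              ((b l + q l)%:R `^ (1 + dlt) * \sum_(i < T l) m i)) @ \oo --> (0 : R)]}.
Proof.
move=> hG hF; apply: ae_forall_int => t.
have [c c0 hc] := quenched_moment (fun i => Zq i t).
pose m (i : nat) y := mean P (fun w => `|quenched eps Z y i t w| `^ (2 + dlt)).
have im i : integ nu (m i) by have [] := hc i.
have mc i : mean nu (m i) <= c by have [] := hc i.
have m0 i y : 0 <= m i y by exact: mean_powR_ge0.
have im1 i : integ nu (fun y => 1 + m i y) by apply: integD => //; exact: integ_cst.
have iP : {ae nu, forall y, forall i, integ P (fun w => `|quenched eps Z y i t w| `^ (2 + dlt))}.
  by apply: ae_foralln => i; have [] := hc i.
pose g l y := (M l)%:R^-1 * \sum_(i < T l | small (b l) (q l) i) (1 + m i y).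
pose f l y := (Num.sqrt (M l)%:R)^-1 `^ (2 + dlt) *
              ((b l + q l)%:R `^ (1 + dlt) * \sum_(i < T l) m i y).
have Hg : {ae nu, forall y, g ^~ y @ \oo --> (0 : R)}.
  apply: (@ae_cvg0_of_geometric_mean _ _ _ _ _ ((1 + c) * C) rho) => //.
  - by move=> l; apply: integZ; apply: integ_sum => i.
  - by move=> l y; rewrite mulr_ge0 ?invr_ge0//; apply: sumr_ge0 => i _; rewrite addr_ge0.
  - by rewrite mulr_ge0// addr_ge0.
  move=> l; rewrite /g meanZ; last by apply: integ_sum => i.
  rewrite mean_sum// -mulrA; apply: (le_trans _ (ler_wpM2l _ (hG l))); last by rewrite addr_ge0.
  rewrite mulrCA ler_wpM2l ?invr_ge0// mulr_sumr; apply: ler_sum => i _.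
  by rewrite meanD ?mean_cst ?mulr1 ?lerD2l//; exact: integ_cst.
have Hf : {ae nu, forall y, f ^~ y @ \oo --> (0 : R)}.
  apply: (@ae_cvg0_of_geometric_mean _ _ _ _ _ (c * C) rho) => //.
  - by move=> l; apply: integZ; apply: integZ; apply: integ_sum => i.
  - by move=> l y; rewrite !mulr_ge0 ?powR_ge0//; apply: sumr_ge0 => i _.
  - by rewrite mulr_ge0.
  move=> l; rewrite /f meanZ; last by apply: integZ; apply: integ_sum => i.
  rewrite meanZ; last by apply: integ_sum => i.
  rewrite mean_sum// -mulrA; apply: (le_trans _ (ler_wpM2l c0 (hF l))).
  rewrite [leRHS]mulrCA ler_wpM2l ?powR_ge0// [leRHS]mulrCA ler_wpM2l ?powR_ge0//.
  apply: (@le_trans _ _ (\sum_(i < T l) c)); first by apply: ler_sum => i _.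
  by rewrite sumr_const card_ord mulr_natr.
refine (@filterS3 _ (almost_everywhere nu) _ _ _ _ _ _ iP Hg Hf) => y ? ? ?.
by split.
Qed.

End moments.
End setting.

(** * Assembly for almost every trajectory *)

Theorem theorem6
  (R : realType) (d : measure_display) (Omega : measurableType d)
  (P : probability Omega R) (s : nat)
  (mu : probability (s.-tuple R) R)
  (Y : {RV P >-> family_space nat (s.-tuple R)})
  (eps : {RV P >-> family_space nat (family_space int R)})
  (Z : int -> s.-tuple R -> family_space int R -> R)
  (V : s.-tuple R -> R) (kappa : nat -> R) (Gamma : int -> R)
  (delta p : R)
  (Y_indep : mutually_independent P (fun (i : nat) w => Y w i))
  (Y_law : forall (i : nat) (B : set (s.-tuple R)), measurable B ->
     P [set w | B (Y w i)] = mu B)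
  (eps_noise : forall i : nat, strong_white_noise P (fun t w => eps w i t))
  (Y_eps_indep : independent2 P Y eps)
  (Z_meas : forall t : int, measurable_fun setT
     (fun q : s.-tuple R * family_space int R => Z t q.1 q.2))
  (Z_time_stationary : {ae distribution P Y, forall y,
     forall i : nat, stationary P (quenched eps Z y i)})
  (Z_centered : {ae distribution P Y, forall y,
     forall (i : nat) (t : int), ('E_P[quenched eps Z y i t] = 0)%E})
  (Z_stationary : stationary P (annealed eps Z Y))
  (Z_wdep : weakly_dependent P eps Z mu (distribution P Y) V kappa)
  (delta_gt0 : 0 < delta)
  (Z_moment : forall (i : nat) (t : int),
     ('E_P[ (fun w => (`| annealed eps Z Y i w t | `^ (2 + delta))%R) ] < +oo)%E)
  (cvg_cov : forall t tau : int, {ae distribution P Y, forall y,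
     (fun N => aggregation_cov P eps Z N t tau y) @ \oo --> (Gamma tau)%:E})
  (V_int : (\int[mu]_x (V x)%:E < +oo)%E)
  (p_gt : 2 + 2 / delta < p)
  (kappa_O : (kappa : nat -> R^o) =O_\oo (fun r : nat => (r%:R `^ (- p) : R^o))) :
  exists (d' : measure_display) (Omega' : measurableType d')
    (P' : probability Omega' R) (X : int -> {RV P' >-> R}),
    centered_gaussian_process X Gamma /\
    {ae distribution P Y, forall y,
       cvg_fdd P (fun N t => partial_aggregation eps Z N y t) X}.
Proof.
have [[mV V_gt0] kappa_dec kappa_cvg wd _] := Z_wdep.
have kappa_noninc r u : (r <= u)%N -> kappa u <= kappa r by exact: kappa_dec.
have kappa0 r : 0 <= kappa r.
  rewrite -(cvg_lim _ kappa_cvg)//; apply: limr_le; first by apply/cvg_ex; exists 0.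
  by exists r => // u; exact: kappa_noninc.
have [M [b [q [T [lv [C [rho [[M0 bq lvM lvT lv_oo] [C0 rho0 rho1] hCrho]]]]]]]] :=
  exists_scales delta_gt0 p_gt kappa0 kappa_noninc kappa_O.
have aeH := ae_hsum_cvg0 Y_indep Y_law kappa0 C0 rho0 rho1 mV V_gt0 V_int
  (fun l => let: And3 h _ _ := hCrho l in h).
have aeGF := ae_moment_sums_cvg0 Y_eps_indep Z_meas C0 rho0 rho1 Z_stationary Z_moment
  (fun l => let: And3 _ h _ := hCrho l in h) (fun l => let: And3 _ _ h := hCrho l in h).
have aeC : {ae distribution P Y, forall y, forall t tau,
    (fun N => aggregation_cov P eps Z N t tau y) @ \oo --> (Gamma tau)%:E}.
  by apply: ae_forall_int => t; apply: ae_forall_int => tau; exact: cvg_cov.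
pose A y := ((forall (i : nat) (t : int), ('E_P[quenched eps Z y i t] = 0)%E) /\
  forall t tau, (fun N => aggregation_cov P eps Z N t tau y) @ \oo --> (Gamma tau)%:E) /\
  forall (i : nat) (t : int), integ P (fun w => `|quenched eps Z y i t w| `^ (2 + delta)).
have aeA : {ae distribution P Y, forall y, A y}.
  refine (@filterS3 _ (almost_everywhere _) _ _ _ _ _ _ Z_centered aeC aeGF) => y h1 h2 h3.
  by split => // i t; have [h4 _ _] := h3 t.
have mZ := measurable_quenched eps Z_meas.
have pf : ProperFilter (almost_everywhere (distribution P Y)).
  apply: ae_properfilter_algebraOfSetsType.
  by rewrite [X in (_ < X)%E](@probability_setT _ _ _ (distribution P Y)) lte01.
(* Gamma is deterministic, so one good trajectory shows that it is even and nonnegative definite;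
   the limit process is built from it once and for all, independently of y. *)
have [y0 [[y0c y0G] y0m]] := filter_ex aeA.
have Geven := Gamma_even (mZ y0) delta_gt0 y0m y0G.
have Gpsd := Gamma_psd (mZ y0) delta_gt0 y0m y0G.
pose P' := unif R.
have [X [XG sX cX]] := exists_gaussian_process Geven Gpsd.
exists _, _, _, X; split => //.
have ff : Filter (almost_everywhere (distribution P Y)) by exact: filter_filter.
have ae1 := @filterI _ _ ff _ _ aeH aeGF.
have ae2 := @filterI _ _ ff _ _ aeA wd.
refine (@filterS2 _ (almost_everywhere _) _ _ _ _ _ ae1 ae2) => y [[V0 hH] hGF] [[[yc yG] ym] ywd].
have hG t : (fun l => (M l)%:R^-1 * \sum_(i < T l | small (b l) (q l) i)
  (1 + mean P (fun w => `|quenched eps Z y i t w| `^ (2 + delta)))) @ \oo --> (0 : R).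
  by have [] := hGF t.
have hF t : (fun l => (Num.sqrt (M l)%:R)^-1 `^ (2 + delta) * ((b l + q l)%:R `^ (1 + delta) *
  \sum_(i < T l) mean P (fun w => `|quenched eps Z y i t w| `^ (2 + delta)))) @ \oo --> (0 : R).
  by have [] := hGF t.
have sN := sqint_aggregation (mZ y) delta_gt0 ym.
move=> n t f fc [B fB].
(* Without times there is a single row vector and f is constant; the variables [comb] involve at
   least one time. *)
case: n => [|n] in t f fc fB *.
  have e (h : 'I_0 -> R) : \row_k h k = 0 by apply/rowP => -[].
  rewrite (_ : (fun w => f (\row_k X (t k) w)) = cst (f 0)); last by apply/funext => w; rewrite e.
  rewrite (_ : (fun N => _) = cst (f 0)%:E).
    by rewrite expectation_cst; exact: cvg_cst.
  apply/funext => N; rewrite (_ : (fun w => _) = cst (f 0)) ?expectation_cst//.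
  by apply/funext => w; rewrite e.
have iN N : integ P (fun w => f (\row_k partial_aggregation eps Z N y (t k) w)).
  apply: (integ_bounded _ (c := B)) => //.
  by apply: (measurable_continuous_row (B := B)) => // k; have [] := sN N (t k).
have iX : integ P' (fun w => f (\row_k X (t k) w)).
  apply: (integ_bounded _ (c := B)) => //.
  by apply: (measurable_continuous_row (B := B)) => // k; have [] := sX (t k).
rewrite (expectation_mean iX).
rewrite (_ : (fun N => _) = (fun N => (mean P (fun w => f (\row_k partial_aggregation eps Z N y (t k) w)))%:E)); last first.
  by apply/funext => N; rewrite (expectation_mean (iN N)).
apply: cvg_EFin; first exact: nearW.
(* The second moments converge to Gamma 0, hence are eventually at most Gamma 0 + 1. *)
apply: (cvg_of_cvg_cos (C := Gamma 0 + 1)) fc fB => //.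
  apply: filter_forall => k.
  have /(_ (t k) (t k)) := aggregation_cov_cvg (mZ y) delta_gt0 ym yG.
  rewrite subrr => /cvgr_le/(_ (Gamma 0 + 1)); rewrite ltrDl => /(_ ltr01).
  by [].
move=> lam th; rewrite cX.
exact: (mean_cos_aggregation_cvg (mZ y) delta_gt0 ym yc yG V0 kappa0 kappa_noninc ywd
  M0 bq lvM lvT lv_oo hH hG hF).
Qed.
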